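(* Let $\mu$ be a Borel probability measure on $\mathbb{R}$ with mean zero, variance one and $\beta_9=\int|x|^9\,\mu(dx)<\infty$. There exists a constant $c(\mu)>0$ such that for every $\delta\in(0,1/10)$ and every $n\in\mathbb{N}$ with $n\ge c(\mu)\,\delta^{-6}$ and $\operatorname{supp}\mu\subset[-\sqrt[3]{n},\sqrt[3]{n}]$, the density $p_{\mu_n}$ of $\mu_n$ admits, for $x\in[-2+2\delta,\,2-2\delta]$, the expansion $$\begin{aligned}p_{\mu_n}(x)=\;&p_\omega(x)+\frac{\kappa_3(x^2-3)x\,p_\omega(x)}{(4-x^2)\sqrt n}\\&-\frac{\left(\kappa_4(x^6-8x^4+18x^2-8)-\kappa_3^2(2x^6-15x^4+30x^2-10)\right)p_\omega(x)}{(4-x^2)^2\,n}\\&+\left(\frac{\kappa_5(x^4-5x^2+5)x}{4-x^2}+\frac{\kappa_3\kappa_4(5x^6-42x^4+105x^2-70)x}{(4-x^2)^2}\right.\\&\qquad\left.+\frac{\kappa_3^3(5x^8-60x^6+252x^4-420x^2+210)x}{(4-x^2)^3}\right)\frac{p_\omega(x)}{n^{3/2}}+O\left(\frac1{n^2}\right),\end{aligned}$$ where the implied constant in $O(n^{-2})$ depends at most on $\mu$ and $\delta$ (not on $n$ or $x$).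
   Context: $\mu_n$ is the distribution of $\frac1{\sqrt n}\sum_{j=1}^nX_j$, where $X_1,X_2,\dots$ are free self-adjoint identically distributed random variables with distribution $\mu$; that is, $\mu_n$ is the $n$-fold free additive convolution of the dilation of $\mu$ by the factor $1/\sqrt n$. For sufficiently large $n$, $\mu_n$ is absolutely continuous with respect to Lebesgue measure, with density $p_{\mu_n}$ (on the interval considered, the continuous version of the density). $p_\omega(x)=\frac1{2\pi}\sqrt{(4-x^2)_+}$ is the density of the standard semicircle law $\omega$. The $\kappa_j$ are the free cumulants of $\mu$; with $m_k=\int x^k\mu(dx)$, $m_1=0$, $m_2=1$, they are $\kappa_3=m_3$, $\kappa_4=m_4-2$, $\kappa_5=m_5-5m_3$. *)

(* Defs.v *)
From HB Require Import structures.
From mathcomp Require Import all_boot all_order all_algebra.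
From mathcomp Require Import all_classical all_reals all_analysis.
From mathcomp Require Import complex ring.

Set Implicit Arguments.
Unset Strict Implicit.
Unset Printing Implicit Defensive.

Import Order.TTheory GRing.Theory Num.Theory.
Import numFieldNormedType.Exports.

Local Open Scope classical_set_scope.
Local Open Scope ring_scope.

Notation borel_prob R := (probability (measurableTypeR R) R).

Definition moment (R : realType) (mu : borel_prob R) (k : nat) : R :=
  \int[mu]_x (x ^+ k).

Definition supp (R : realType) (mu : borel_prob R) : set R :=
  [set x | forall U : set R, open U -> U x -> (0 < mu U)%E].

Definition is_density (R : realType) (nu : borel_prob R) (p : R -> R) : Prop :=
  [/\ measurable_fun [set: measurableTypeR R] p,
      forall x, 0 <= p x
    & forall A : set (measurableTypeR R), measurable A ->
        nu A = (\int[lebesgue_measure]_(x in A) (p x)%:E)%E].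

Definition semicircle_density (R : realType) (x : R) : R :=
  (2 * pi)^-1 * Num.sqrt (Num.max 0 (4 - x ^+ 2)).

(* The free cumulants k of a moment sequence m (with m 0 = 1) are determined
   by the moment-cumulant formula
     m_n = \sum_(1 <= s <= n) k_s \sum_(i_1 + .. + i_s = n - s) m_i1 .. m_is,
   i.e., M(z) = 1 + \sum_(s >= 1) k_s (z M(z))^s for M(z) = \sum_i m_i z^i,
   which is the sum over non-crossing partitions sorted by the block of the
   first point. The inner sum is a coefficient of a power of the truncation of
   M, and the term s = n is k_n. *)
Definition moment_coef (R : realType) (m : nat -> R) (n s : nat) : R :=
  ((\poly_(i < n) m i) ^+ s)`_(n - s).

Fixpoint free_cumulants_seq (R : realType) (m : nat -> R) (n : nat) : seq R :=
  if n is n'.+1 then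
    let ks := free_cumulants_seq m n' in
    rcons ks (m n - \sum_(1 <= s < n) ks`_s * moment_coef m n s)
  else [:: 0].

Definition free_cumulant (R : realType) (mu : borel_prob R) (n : nat) : R :=
  (free_cumulants_seq (moment mu) n)`_n.

Lemma moment_coef_low (R : realType) (m : nat -> R) (n s : nat) :
  m 0%N = 1 -> m 1%N = 0 -> (1 < n)%N ->
  let c j := ((\poly_(i < n) m i) ^+ s)`_j in
  [/\ c 0%N = 1, c 1%N = 0, (2 < n)%N -> c 2%N = m 2%N *+ s
    & (3 < n)%N -> c 3%N = m 3%N *+ s].
Proof.
move=> m0 m1 n1 /=; have n0 := ltnW n1.
elim: s => [|s [c0 c1 c2 c3]]; first by rewrite expr0 !coef1 !mulr0n.
split=> [||n2|n3]; rewrite exprS coefM !big_ord_recl big_ord0 !coef_poly /=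
  /bump /= ?n0 ?n1 ?m0 ?m1 !mul1r ?mul0r ?c0 ?c1 ?addr0 ?add0r ?mulr1//.
  by rewrite n2 c2// mulrSr.
by rewrite n3 mulr0 add0r c3// mulrSr.
Qed.

Lemma free_cumulants_low (R : realType) (mu : borel_prob R) :
  moment mu 1 = 0 -> moment mu 2 = 1 ->
  [/\ free_cumulant mu 1 = 0, free_cumulant mu 2 = 1,
      free_cumulant mu 3 = moment mu 3,
      free_cumulant mu 4 = moment mu 4 - 2
    & free_cumulant mu 5 = moment mu 5 - 5 * moment mu 3].
Proof.
move=> m1 m2.
have m0 : moment mu 0 = 1.
  rewrite /moment; under eq_Rintegral do rewrite expr0.
  rewrite Rintegral_cst// mul1r.
  by rewrite [X in fine X](_ : _ = 1%E) //; exact: probability_setT.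
pose K := free_cumulants_seq (moment mu).
have KS n : K n.+1 = rcons (K n) (moment mu n.+1 -
    \sum_(1 <= s < n.+1) (K n)`_s * moment_coef (moment mu) n.+1 s) by [].
have C n s := moment_coef_low (n := n) s m0 m1.
have K1 : K 1%N = [:: 0; 0] by rewrite KS big_geq// subr0 m1.
have K2 : K 2%N = [:: 0; 0; 1].
  by rewrite KS K1 big_nat1 /= mul0r subr0 m2.
have K3 : K 3%N = [:: 0; 0; 1; moment mu 3].
  rewrite KS K2 2?big_ltn// big_geq//= /moment_coef.
  by have [//|_ -> _ _] := C 3%N 2%N; rewrite mul0r mulr0 !addr0 subr0.
have K4 : K 4%N = [:: 0; 0; 1; moment mu 3; moment mu 4 - 2].
  rewrite KS K3 3?big_ltn// big_geq//= /moment_coef.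
  have [//|_ _ -> // _] := C 4%N 2%N; have [//|_ -> _ _] := C 4%N 3%N.
  by rewrite m2 mul0r mulr0 mul1r !addr0 add0r.
rewrite /free_cumulant -/(K _) -/(K _) -/(K _) -/(K _) -/(K _) K1 K2 K3 K4.
split=> //.
rewrite KS K4 4?big_ltn// big_geq//= /moment_coef.
have [//|_ _ _ -> //] := C 5%N 2%N; have [//|_ _ -> // _] := C 5%N 3%N.
have [//|_ -> _ _] := C 5%N 4%N.
by rewrite m2; ring.
Qed.

Record star_prob_space (R : realType) := StarProbSpace {
  sps_alg :> algType R[i];
  star : sps_alg -> sps_alg;
  state : {scalar sps_alg};
  starK : forall a, star (star a) = a;
  starD : forall a b, star (a + b) = star a + star b;
  starZ : forall (c : R[i]) a, star (c *: a) = c^* *: star a;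
  starM : forall a b, star (a * b) = star b * star a;
  state1 : state 1 = 1;
  state_ge0 : forall a, 0 <= state (star a * a) }.

Arguments state {R} s.

Definition selfadjoint (R : realType) (A : star_prob_space R) (a : A) : Prop :=
  star a = a.

(* unital algebra generated by a; a *-algebra when a is self-adjoint *)
Definition generated_alg (R : realType) (A : star_prob_space R) (a : A) : set A :=
  range (fun q : {poly R[i]} => horner_alg a q).

(* The state vanishes on every product a_1 a_2 .. a_k (k >= 1) of centred
   elements a_j of B i_j such that i_j != i_(j+1) for all j. *)
Definition free_algebras (R : realType) (A : star_prob_space R) (I : eqType)
    (B : I -> set A) : Prop :=
  forall s : seq (I * A), s != [::] ->
    sorted (fun u v => u.1 != v.1) s ->
    (forall u, u \in s -> B u.1 u.2 /\ state A u.2 = 0) ->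
    state A (\prod_(u <- s) u.2) = 0.

Definition free_family (R : realType) (A : star_prob_space R) (I : eqType)
    (X : I -> A) : Prop :=
  free_algebras (fun i => generated_alg (X i)).

(* For a self-adjoint a, the compactly supported nu is unique if it exists; it
   does in a C*-probability space. *)
Definition has_distribution (R : realType) (A : star_prob_space R) (a : A)
    (nu : borel_prob R) : Prop :=
  compact (supp nu) /\ forall k, state A (a ^+ k) = (moment nu k)%:C%C.

(* nu is the n-fold free additive convolution of the dilation by 1 / sqrt n of
   the compactly supported mu *)
Definition is_free_normalized_sum_law (R : realType) (mu : borel_prob R)
    (n : nat) (nu : borel_prob R) : Prop :=
  exists (A : star_prob_space R) (X : 'I_n -> A),
    [/\ forall j, selfadjoint (X j),
        forall j, has_distribution (X j) mu,
        free_family X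
      & has_distribution ((Num.sqrt n%:R : R)^-1%:C%C *: \sum_j X j) nu].

Definition density_expansion (R : realType) (mu : borel_prob R) (n : nat)
    (x : R) : R :=
  let k3 := free_cumulant mu 3 in
  let k4 := free_cumulant mu 4 in
  let k5 := free_cumulant mu 5 in
  let p := semicircle_density x in
  p + k3 * (x ^+ 2 - 3) * x * p / ((4 - x ^+ 2) * Num.sqrt n%:R)
  - (k4 * (x ^+ 6 - 8 * x ^+ 4 + 18 * x ^+ 2 - 8)
     - k3 ^+ 2 * (2 * x ^+ 6 - 15 * x ^+ 4 + 30 * x ^+ 2 - 10)) * p
    / ((4 - x ^+ 2) ^+ 2 * n%:R)
  + (k5 * (x ^+ 4 - 5 * x ^+ 2 + 5) * x / (4 - x ^+ 2)
     + k3 * k4 * (5 * x ^+ 6 - 42 * x ^+ 4 + 105 * x ^+ 2 - 70) * x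
       / (4 - x ^+ 2) ^+ 2
     + k3 ^+ 3 * (5 * x ^+ 8 - 60 * x ^+ 6 + 252 * x ^+ 4 - 420 * x ^+ 2 + 210)
       * x / (4 - x ^+ 2) ^+ 3) * (p / n%:R `^ (3 / 2)).

(* Main.v *)
(* Put eps = 1 / sqrt n and A(v) = \sum_k m_(k+2) (eps v)^k. Expanding the
   resolvents of the X_j into alternating products of centred elements gives, as
   formal power series, the Cauchy transform of mu_n in parametric form:
     W = v (1 + eps^2 v^2 A(v))   at   x = (1 + v^2 A(v)) / W.
   With v = u h(u) and x = c + (1 + s) (u + 1 / u) this becomes a fixed point
   problem for h, c, s, solved for small eps in a weighted l^1 algebra of power
   series in u that converge for |u| <= 2. So W extends across |u| = 1, where
   its imaginary part defines a continuous density Im W / pi. Integrating this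
   density against the Poisson kernel recovers W inside the disc, so the density
   has the moments of mu_n, which determine mu_n. At a fixed x inside (-2, 2),
   v solves a perturbation of 1 + v^2 = x v in powers of eps; the terms up to
   eps^3 give the expansion, and c, s = O(eps) only shift the edges. *)

Require Import Defs.
From HB Require Import structures.
From mathcomp Require Import all_boot all_order all_algebra.
From mathcomp Require Import all_classical all_reals all_analysis.
From mathcomp Require Import complex ring lra measurable_realfun.
Import Order.TTheory GRing.Theory Num.Theory.
Import numFieldNormedType.Exports.
Local Open Scope classical_set_scope.
Local Open Scope ring_scope.

(** * Moments of a sum of free variables *)

(** In the variable u the linearised equation multiplies the correction of h by u^2 - 1, which
    vanishes at the two edges u = 1 and u = -1. This operator is not onto; the unknowns c and s
    supply the two missing dimensions. If the edges were kept at -2 and 2, W would have branch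
    points near u = 1 and u = -1 and would not extend across the circle. Radius 2 leaves room beyond
    the circle: the weight 2^k dominates k, so one norm bound makes the boundary values Lipschitz
    and, through |sin kx| <= k |sin x|, keeps Im W within (sin x) / 2 of sin x. This is why the
    candidate density is nonnegative up to the edges. Limits are carried by polynomials with
    explicit errors of order 2^-j, and formal identities modulo X^N become estimates O(u^N) on 0 < u
    <= 1/2. The final expansion is made for W, not v. Eliminating v gives x W = 1 + W^2 + eps k3 W^3
    + eps^2 k4 W^4 + eps^3 k5 W^5 + O(eps^4), the R-transform equation of mu_n, and this is where
    free cumulants replace moments. It is solved only below a threshold for eps that depends on
    delta; larger eps are absorbed by the implied constant. *)

Section poly_congruence.
Context {R : nzRingType} (N : nat).

Definition eqmodX (p q : {poly R}) := forall k, (k < N)%N -> p`_k = q`_k.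

Lemma eqmodX_sym p q : eqmodX p q -> eqmodX q p.
Proof. by move=> h k kN; rewrite h. Qed.

Lemma eqmodX_trans q p r : eqmodX p q -> eqmodX q r -> eqmodX p r.
Proof. by move=> h1 h2 k kN; rewrite h1 // h2. Qed.

Lemma eqmodXD p1 q1 p2 q2 :
  eqmodX p1 q1 -> eqmodX p2 q2 -> eqmodX (p1 + p2) (q1 + q2).
Proof. by move=> h1 h2 k kN; rewrite !coefD h1 // h2. Qed.

Lemma eqmodXB p1 q1 p2 q2 :
  eqmodX p1 q1 -> eqmodX p2 q2 -> eqmodX (p1 - p2) (q1 - q2).
Proof. by move=> h1 h2 k kN; rewrite !coefB h1 // h2. Qed.

Lemma eqmodXM p1 q1 p2 q2 :
  eqmodX p1 q1 -> eqmodX p2 q2 -> eqmodX (p1 * p2) (q1 * q2).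
Proof.
move=> h1 h2 k kN; rewrite !coefM; apply: eq_bigr => i _; rewrite h1.
  by rewrite h2 //; apply: leq_ltn_trans kN; exact: leq_subr.
exact: leq_ltn_trans (leq_ord i) kN.
Qed.

Lemma eqmodX_sum (I : Type) (r : seq I) (P : pred I) (F G : I -> {poly R}) :
  (forall i, P i -> eqmodX (F i) (G i)) ->
  eqmodX (\sum_(i <- r | P i) F i) (\sum_(i <- r | P i) G i).
Proof.
move=> h k kN; rewrite !coef_sum; apply: eq_bigr => i Pi; exact: h.
Qed.

Lemma eqmodX_mulXn p : eqmodX (p * 'X^N) 0.
Proof. by move=> k kN; rewrite coefMXn kN coef0. Qed.

(** A constant term 1 makes [c] invertible as a power series; strong induction on the index avoids
    the inverse series. *)
Lemma eqmodX_cancel (c p : {poly R}) : c`_0 = 1 -> eqmodX (c * p) 0 -> eqmodX p 0.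
Proof.
move=> c0 h k; elim/ltn_ind: k => k IH kN; rewrite coef0.
have := h k kN; rewrite coefM big_ord_recl c0 mul1r subn0 coef0 big1 ?addr0 //.
move=> i _; rewrite lift0 IH ?coef0 ?mulr0 //.
  by rewrite ltn_subrL /=; case: (k) i => // -[].
by rewrite (leq_ltn_trans _ kN) // leq_subr.
Qed.

End poly_congruence.

Lemma stateZ {R : realType} (A : star_prob_space R) c (x : A) :
  state A (c *: x) = c * state A x.
Proof. exact: (scalarZ (state A)). Qed.

Lemma state_scalar {R : realType} (A : star_prob_space R) c :
  state A (c%:A) = c.
Proof. by rewrite stateZ state1 mulr1. Qed.

(** * Alternating products of centred elements *)

Section centred_words.
Context {R : realType} {A : star_prob_space R} {I : eqType} (B : I -> set A).
Hypothesis freeB : free_algebras B.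

Definition centred_in (i : I) (x : A) := B i x /\ state A x = 0.

(* By freeness this holds for the span of the alternating products of centred
   elements whose first factor has index i. *)
Definition starts_at (i : I) (x : A) :=
  forall s : seq (I * A), sorted (fun a b => a != b) (rcons (map fst s) i) ->
    (forall u, u \in s -> centred_in u.1 u.2) ->
    state A ((\prod_(u <- s) u.2) * x) = 0.

Lemma starts_at_sum i (J : Type) (r : seq J) (P : pred J) (F : J -> A) :
  (forall j, P j -> starts_at i (F j)) -> starts_at i (\sum_(j <- r | P j) F j).
Proof.
move=> h s s1 s2; rewrite mulr_sumr raddf_sum big1 // => j Pj; exact: h.
Qed.

Lemma starts_at_centred i x : centred_in i x -> starts_at i x.
Proof.
move=> cx s s1 s2; have -> : \prod_(u <- s) u.2 * x = \prod_(u <- rcons s (i, x)) u.2.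
  by rewrite -cats1 big_cat big_seq1.
apply: freeB; first by case: (s).
  rewrite -(map_rcons fst s (i, x)) in s1.
  by rewrite sorted_map in s1.
move=> u; rewrite mem_rcons inE => /orP[/eqP -> //|]; exact: s2.
Qed.

(** Since [starts_at] quantifies over every alternating prefix, the letter [x] can be appended to
    the prefix and the hypothesis on [y] applied to the longer one. This is what permits induction
    on the length of a word. *)
Lemma starts_at_cons i j x y :
  i != j -> centred_in i x -> starts_at j y -> starts_at i (x * y).
Proof.
move=> ij cx hy s s1 s2; rewrite mulrA.
have -> : \prod_(u <- s) u.2 * x = \prod_(u <- rcons s (i, x)) u.2.
  by rewrite -cats1 big_cat big_seq1.
apply: hy.
  rewrite map_rcons /=; case: (map fst s) s1 => [|a t] /=; first by rewrite ij.
  by rewrite !rcons_path last_rcons => ->.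
move=> u; rewrite mem_rcons inE => /orP[/eqP -> //|]; exact: s2.
Qed.

Lemma starts_at_state i x : starts_at i x -> state A x = 0.
Proof. by move=> h; have := h [::]; rewrite big_nil mul1r; apply. Qed.

End centred_words.

(** * The resolvent of a sum of free variables *)

Section free_sum.
Context {R : realType} {A : star_prob_space R} {n : nat} (X : 'I_n -> A)
  (m : nat -> R[i]).
Hypothesis freeX : free_family X.
Hypothesis m0 : m 0%N = 1.
Hypothesis momX : forall j k, state A (X j ^+ k) = m k.
Variable N : nat.

Let S := \sum_j X j.

Let in_poly (c : {poly R[i]}) : {poly A} := map_poly (in_alg A) c.
Let phi (p : {poly A}) : {poly R[i]} := map_poly (state A) p.

Let coef_phi p k : (phi p)`_k = state A p`_k.
Proof. by rewrite coef_map_id0 // raddf0. Qed.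

Let phi_eqmod p q : eqmodX N p q -> eqmodX N (phi p) (phi q).
Proof. by move=> h k kN; rewrite !coef_phi h. Qed.

Let coef_in_poly c k : (in_poly c)`_k = (c`_k)%:A.
Proof. by rewrite coef_map. Qed.

Let in_polyC c p : in_poly c * p = p * in_poly c.
Proof.
apply/polyP => k; rewrite coefM coefMr; apply: eq_bigr => i _.
by rewrite coef_in_poly mulr_algl mulr_algr.
Qed.

Let phi_in_poly c p : phi (in_poly c * p) = c * phi p.
Proof.
apply/polyP => k; rewrite coef_phi !coefM raddf_sum; apply: eq_bigr => i _.
by rewrite coef_in_poly mulr_algl coef_phi; exact: stateZ.
Qed.

Let phi_sum (J : Type) (r : seq J) (P : pred J) (F : J -> {poly A}) :
  phi (\sum_(j <- r | P j) F j) = \sum_(j <- r | P j) phi (F j).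
Proof.
apply/polyP => k; rewrite coef_phi !coef_sum raddf_sum.
by apply: eq_bigr => i _; rewrite coef_phi.
Qed.

Definition moment_poly : {poly R[i]} := \poly_(k < N) m k.
Let M := in_poly moment_poly.
Let B i := \poly_(k < N) (X i) ^+ k.
Let C i := B i - M.

(* The sum of C i_1 * .. * C i_k over i_1 = i and i_j != i_(j+1). *)
Fixpoint words (k : nat) (i : 'I_n) : {poly A} :=
  if k is k'.+1 then
    C i * ((if k' is 0%N then 1 else \sum_j words k' j) - words k' i)
  else 0.
Let all_words k := if k is 0%N then 1 else \sum_j words k j.

Let wordsS k i : words k.+1 i = C i * (all_words k - words k i).
Proof. by case: k. Qed.

Let centred_C i k : centred_in (fun i => generated_alg (X i)) i (C i)`_k.
Proof.
rewrite coefB coef_in_poly !coef_poly; case: ltnP => kN; last first.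
  split; last by rewrite scale0r subr0 raddf0.
  by exists 0 => //; rewrite rmorph0 scale0r subr0.
split; last first.
  rewrite raddfB /= momX.
  apply: (etrans (congr1 (fun z => m k - z) (state_scalar A (m k)))).
  exact: subrr.
exists ('X^k - (m k)%:P) => //.
by rewrite rmorphB rmorphXn /= horner_algX horner_algC.
Qed.

Let starts_words k i j :
  starts_at (fun i => generated_alg (X i)) i (words k.+1 i)`_j.
Proof.
elim: k i j => [|k IH] i j.
  by rewrite wordsS /= subr0 mulr1; exact: starts_at_centred.
rewrite wordsS coefM; apply: starts_at_sum => l _.
have -> : all_words k.+1 - words k.+1 i = \sum_(i' | i' != i) words k.+1 i'.
  by rewrite [all_words _](bigD1 i) //= addrAC subrr add0r.
rewrite coef_sum mulr_sumr; apply: starts_at_sum => i' i'i.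
by apply: (@starts_at_cons _ _ _ _ _ i'); rewrite // eq_sym.
Qed.

Let phi_all_words k : phi (all_words k) = (k == 0%N)%:R.
Proof.
case: k => [|k] /=.
  by apply/polyP => j; rewrite coef_phi !coef1 raddfMn /= state1.
rewrite phi_sum big1 // => i _; apply/polyP => j; rewrite coef_phi coef0.
exact: starts_at_state (starts_words k i j).
Qed.

Let P (a : A) : {poly A} := a%:P * 'X.

Let P_exp a k : P a ^+ k = (a ^+ k)%:P * 'X^k.
Proof. by rewrite exprMn_comm; [rewrite -polyC_exp | exact: commr_polyX]. Qed.

Let PN a : eqmodX N (P a ^+ N) 0.
Proof. by rewrite P_exp; exact: eqmodX_mulXn. Qed.

Let BE i : B i = \sum_(k < N) P (X i) ^+ k.
Proof.
rewrite /B poly_def; apply: eq_bigr => k _.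
by rewrite P_exp mul_polyC.
Qed.

Let resolvent i : eqmodX N ((1 - P (X i)) * B i) 1.
Proof.
have -> : (1 - P (X i)) * B i = 1 - P (X i) ^+ N.
  by rewrite BE -[1 - P (X i)]opprB mulNr -subrX1 opprB.
rewrite -[X in eqmodX _ _ X]subr0; apply: eqmodXB => //; exact: PN.
Qed.

(** As m_0 = 1, [C i] has no constant term, so a word of length k is divisible by X^k. Modulo X^N
    only lengths below N count, and the series over all words becomes a finite sum. *)
Let low_words k i j : (j < k)%N -> (words k i)`_j = 0.
Proof.
elim: k i j => // k IH i j jk; rewrite wordsS coefM big1 // => -[l /= lj] _.
have [->|l0] := eqVneq l 0%N.
  rewrite coefB coef_in_poly !coef_poly; case: ltnP => _.
    by rewrite expr0 -(momX i 0) expr0 state1 scale1r subrr mul0r.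
  by rewrite scale0r subr0 mul0r.
have jlk : (j - l < k)%N.
  by rewrite ltn_subLR // (leq_trans jk) // -add1n leq_add2r lt0n.
rewrite [X in _ * X]coefB IH // subr0; case: (k) jlk IH => // k' jlk IH.
by rewrite /all_words coef_sum big1 ?mulr0 // => j' _; exact: IH.
Qed.

Hypothesis N_gt0 : (0 < N)%N.

(** Up to the factor M^N this is the sum of M^-k [words k i] over k, and [VT] is the same for all
    words. The factor clears the negative powers and is cancelled at the end by [eqmodX_cancel]. *)
Let V i := \sum_(k < N) M ^+ (N - k) * words k i.
Let VT := \sum_(k < N) M ^+ (N - k) * all_words k.

Let MC p : M * p = p * M. Proof. exact: in_polyC. Qed.
Let MXC k p : M ^+ k * p = p * M ^+ k.
Proof. by apply/esym; apply: commrX; apply/esym; exact: MC. Qed.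

Let sum_first {Z : nmodType} (F : nat -> Z) :
  \sum_(k < N) F k = F 0%N + \sum_(k < N.-1) F k.+1.
Proof. by rewrite -[in LHS](prednK N_gt0) big_ord_recl. Qed.

Let sum_last {Z : nmodType} (F : nat -> Z) :
  \sum_(k < N) F k = \sum_(k < N.-1) F k + F N.-1.
Proof. by rewrite -[in LHS](prednK N_gt0) big_ord_recr. Qed.

(** Multiplication by M shifts the length by one, and [wordsS] peels off the first letter. The
    surplus term on the right consists of words of length N, which vanish by [low_words]. *)
Let V_rec i : eqmodX N (M * V i) (C i * (VT - V i)).
Proof.
have -> : VT - V i = \sum_(k < N) M ^+ (N - k) * (all_words k - words k i).
  by rewrite -sumrB; apply: eq_bigr => k _; rewrite mulrBr.
have -> : C i * (\sum_(k < N) M ^+ (N - k) * (all_words k - words k i)) =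
    \sum_(k < N) M ^+ (N - k) * words k.+1 i.
  by rewrite mulr_sumr; apply: eq_bigr => k _; rewrite wordsS mulrA -MXC mulrA.
rewrite /V mulr_sumr (sum_first (fun k => M * (M ^+ (N - k) * words k i))).
rewrite (sum_last (fun k => M ^+ (N - k) * words k.+1 i)) [words 0 _]/= !mulr0 add0r.
rewrite -[X in eqmodX _ X _]addr0; apply: eqmodXD.
  apply: eqmodX_sum => j _; rewrite mulrA -exprS -subSn ?subSS; first exact.
  by have := ltn_ord j; rewrite ltn_predRL => /ltnW; exact: leq_trans.
apply: eqmodX_sym; rewrite -[X in eqmodX _ _ X](mulr0 (M ^+ (N - N.-1))).
by apply: eqmodXM => // k kN; rewrite low_words ?prednK // coef0.
Qed.

(** Adding [C i * V i] to the recursion turns the factor M into [B i], the truncated resolvent of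
    [X i], and [1 - P (X i)] inverts it. *)
Let V_eq i : eqmodX N (V i) ((1 - P (X i)) * C i * VT).
Proof.
have h : eqmodX N (B i * V i) (C i * VT).
  have -> : B i * V i = M * V i + C i * V i by rewrite -mulrDl /C addrC subrK.
  rewrite -[X in eqmodX _ _ X](subrK (C i * V i)) -mulrBr.
  apply: eqmodXD => //; exact: V_rec.
rewrite -mulrA; apply: (@eqmodX_trans _ _ ((1 - P (X i)) * (B i * V i))).
  rewrite mulrA -[X in eqmodX _ X _]mul1r; apply: eqmodXM => //.
  by apply: eqmodX_sym; exact: resolvent.
exact: eqmodXM.
Qed.

Let q := 1 + n%:R * (moment_poly - 1).

(** Because (1 - P (X i)) [C i] is congruent to 1 - (1 - P (X i)) M, each [V i] is [VT] times an
    expression linear in [X i]. Summing over i therefore leaves only the sum [S]. *)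
Let VT_eq : eqmodX N ((in_poly q - M * P S) * VT) (M ^+ N).
Proof.
have PS : P S = \sum_i P (X i) by rewrite /P /S rmorph_sum mulr_suml.
have VTE : VT = M ^+ N + \sum_i V i.
  rewrite /V exchange_big /= /VT (sum_first (fun k => M ^+ (N - k) * all_words k)).
  rewrite (sum_first (fun k => \sum_j M ^+ (N - k) * words k j)) subn0.
  have -> : \sum_j M ^+ N * words 0 j = 0 by apply: big1 => j _; exact: mulr0.
  rewrite [all_words 0]/= mulr1 add0r; congr (_ + _); apply: eq_bigr => k _; exact: mulr_sumr.
have -> : M ^+ N = VT - \sum_i V i by rewrite VTE addrK.
have -> : in_poly q - M * P S = 1 - \sum_i (1 - M + M * P (X i)).
  rewrite big_split /= -mulr_sumr -PS sumr_const card_ord.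
  have -> : in_poly q = 1 + (M - 1) *+ n.
    by rewrite /q /in_poly rmorphD rmorph1 rmorphM rmorphB rmorph1 rmorph_nat mulr_natl.
  by rewrite opprD addrA -mulNrn opprB.
rewrite mulrBl mul1r; apply: eqmodXB => //.
rewrite mulr_suml; apply: eqmodX_sum => i _; apply: eqmodX_sym.
apply: eqmodX_trans (V_eq i) _; apply: eqmodXM => //.
have -> : (1 - P (X i)) * C i = (1 - P (X i)) * B i - (1 - P (X i)) * M.
  by rewrite mulrBr.
have -> : 1 - M + M * P (X i) = 1 - (1 - P (X i)) * M.
  by rewrite mulrBl mul1r opprB addrCA addrC MC.
by apply: eqmodXB => //; exact: resolvent.
Qed.

(** The state kills every nonempty alternating word, so [VT_eq] says that (q - z M S)^-1 has state
    1. Expanding in powers of S and clearing denominators with q^N gives the congruence. In terms of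
    the Cauchy transform G of S it reads G(q / (z M)) = z M. *)
Lemma free_sum_moments :
  eqmodX N (q ^+ N)
    (\sum_(k < N) state A (S ^+ k) *: (q ^+ (N.-1 - k) * (moment_poly * 'X) ^+ k)).
Proof.
(* Modulo X^N, [G] is q^N times the inverse of q - Z: q is central, q^N - Z^N = G (q - Z), and Z^N
   is divisible by X^N. *)
set Z := M * P S; pose G := \sum_(k < N) in_poly q ^+ (N.-1 - k) * Z ^+ k.
have qC p : GRing.comm (in_poly q) p by exact: in_polyC.
have qZG : in_poly q ^+ N - Z ^+ N = G * (in_poly q - Z).
  have cq : GRing.comm (in_poly q - Z) (in_poly q) by exact: esym (qC _).
  have cZ : GRing.comm (in_poly q - Z) Z.
    by apply/commr_sym/commrB => //; exact: esym (qC _).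
  rewrite subrXX_comm //; apply: commr_sum => k _.
  by apply: commrM; exact: commrX.
have ZXE k : Z ^+ k = M ^+ k * P S ^+ k by rewrite /Z exprMn_comm //; exact: MC.
have ZN : eqmodX N (Z ^+ N) 0.
  rewrite ZXE -[X in eqmodX _ _ X](mulr0 (M ^+ N)).
  by apply: eqmodXM => //; exact: PN.
have h : eqmodX N (in_poly q ^+ N * VT) (G * M ^+ N).
  rewrite -(subrK (Z ^+ N) (in_poly q ^+ N)) qZG mulrDl -[X in eqmodX _ _ X]addr0.
  apply: eqmodXD; first by rewrite -mulrA; apply: eqmodXM => //; exact: VT_eq.
  by rewrite -[X in eqmodX _ _ X](mul0r VT); apply: eqmodXM.
have in_polyX c k : in_poly c ^+ k = in_poly (c ^+ k) by rewrite /in_poly rmorphXn.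
have phiVT : phi VT = moment_poly ^+ N.
  rewrite /VT phi_sum (sum_first (fun k => phi (M ^+ (N - k) * all_words k))) big1 /=.
    by rewrite addr0 subn0 mulr1 in_polyX -[in_poly _]mulr1 phi_in_poly
       (phi_all_words 0) mulr1.
  by move=> k _; rewrite in_polyX phi_in_poly (phi_all_words k.+1) mulr0.
have phiG : phi (G * M ^+ N) = moment_poly ^+ N *
    \sum_(k < N) state A (S ^+ k) *: (q ^+ (N.-1 - k) * (moment_poly * 'X) ^+ k).
  rewrite -MXC in_polyX phi_in_poly; congr (_ * _); rewrite phi_sum.
  apply: eq_bigr => k _; rewrite ZXE !in_polyX mulrA -rmorphM phi_in_poly.
  have -> : phi (P S ^+ k) = (state A (S ^+ k))%:P * 'X^k.
    apply/polyP => j; rewrite P_exp coef_phi !coefCM !coefXn.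
    by case: eqP; rewrite ?mulr1 ?mulr0 ?raddf0.
  by rewrite -mul_polyC exprMn mulrCA !mulrA.
have := phi_eqmod _ _ h; rewrite in_polyX phi_in_poly phiVT phiG => h2.
have : eqmodX N (q ^+ N - (\sum_(k < N) state A (S ^+ k) *:
    (q ^+ (N.-1 - k) * (moment_poly * 'X) ^+ k))) 0.
  apply: (@eqmodX_cancel _ _ (moment_poly ^+ N)).
    rewrite -horner_coef0 horner_exp horner_coef0.
    by rewrite coef_poly N_gt0 m0 expr1n.
  move=> k kN; rewrite mulrBr [_ * q ^+ N]mulrC [LHS]coefB h2 //.
  by rewrite subrr coef0.
by move=> h3 k kN; apply/eqP; rewrite -subr_eq0 -coefB h3 // coef0.
Qed.

End free_sum.

Lemma moment0 {R : realType} (mu : borel_prob R) : moment mu 0 = 1.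
Proof.
rewrite /moment; under eq_Rintegral do rewrite expr0.
rewrite Rintegral_cst // mul1r.
by rewrite [X in fine X](_ : _ = 1%E) //; exact: probability_setT.
Qed.

(** Undoing the normalisation multiplies the k-th moment of [nu] by n^(k/2); injectivity of the
    embedding of R in R[i] then brings the congruence down to real polynomials. *)
Lemma free_normalized_sum_moments {R : realType} (mu nu : borel_prob R) n N :
  (0 < n)%N -> (0 < N)%N -> is_free_normalized_sum_law mu n nu ->
  let M := \poly_(k < N) moment mu k in
  let q := 1 + n%:R * (M - 1) in
  eqmodX N (q ^+ N) (\sum_(k < N) (Num.sqrt n%:R ^+ k * moment nu k) *:
                       (q ^+ (N.-1 - k) * (M * 'X) ^+ k)).
Proof.
move=> n0 N0 [A [X [_ distX freeX [_ distS]]]] M q.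
pose m k := (moment mu k)%:C%C.
have m0 : m 0%N = 1 by rewrite /m moment0.
have := @free_sum_moments R A n X m freeX m0 (fun j => (distX j).2) N N0.
have C_inj : injective (real_complex R) by exact: fmorph_inj.
have ME : moment_poly m N = map_poly (real_complex R) M.
  by apply/polyP => k; rewrite coef_map !coef_poly; case: ifP.
have qE : 1 + n%:R * (moment_poly m N - 1) = map_poly (real_complex R) q.
  by rewrite ME /q rmorphD rmorphM rmorphB !rmorph1 rmorph_nat.
have sE k : state A ((\sum_j X j) ^+ k) = (Num.sqrt n%:R ^+ k * moment nu k)%:C%C.
  have sn0 : Num.sqrt n%:R != 0 :> R by rewrite gt_eqF // sqrtr_gt0 ltr0n.
  have := distS k; rewrite exprZn stateZ -rmorphXn /= => h.
  rewrite rmorphM /= -h mulrA -rmorphM /= -exprMn divff // expr1n rmorph1 mul1r //.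
rewrite qE ME => h k kN; apply: C_inj.
have := h k kN; rewrite -rmorphXn coef_map => ->.
rewrite -coef_map rmorph_sum; congr (polyseq _)`_k; apply: eq_bigr => j _.
rewrite sE -!mul_polyC [RHS]rmorphM; congr (_ * _); first exact/esym/map_polyC.
rewrite [RHS]rmorphM !rmorphXn rmorphM; congr (_ * (_ * _) ^+ _).
exact/esym/map_polyX.
Qed.

(** * Fixed point in a weighted algebra of polynomials *)

Section weighted_norm.
Context {R : realFieldType}.
Implicit Types (p q : {poly R}).

Definition nrm p := \sum_(i < size p) `|p`_i| * 2 ^+ i.

Lemma sum_coef_widen {V : lmodType R} (f : nat -> R -> V) n p :
  (forall i, f i 0 = 0) -> (size p <= n)%N ->
  \sum_(i < size p) f i p`_i = \sum_(i < n) f i p`_i.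
Proof.
move=> f0 pn; rewrite (big_ord_widen n (fun i => f i p`_i) pn) big_mkcond /=.
by apply: eq_bigr => i _; case: ltnP => // h; rewrite nth_default.
Qed.

Lemma nrm_widen n p : (size p <= n)%N -> nrm p = \sum_(i < n) `|p`_i| * 2 ^+ i.
Proof.
move=> pn; rewrite /nrm (@sum_coef_widen R^o (fun i a => `|a| * 2 ^+ i) n) //.
by move=> i; rewrite normr0 mul0r.
Qed.

Lemma nrm_ge0 p : 0 <= nrm p.
Proof. by apply: sumr_ge0 => i _; rewrite mulr_ge0 // exprn_ge0. Qed.

Lemma nrmN p : nrm (- p) = nrm p.
Proof.
by rewrite /nrm size_polyN; apply: eq_bigr => i _; rewrite coefN normrN.
Qed.

Lemma nrmD p q : nrm (p + q) <= nrm p + nrm q.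
Proof.
pose n := maxn (size p) (size q).
rewrite (nrm_widen n) ?size_polyD // (nrm_widen n p) ?leq_maxl //.
rewrite (nrm_widen n q) ?leq_maxr // -big_split /=.
apply: ler_sum => i _; rewrite coefD -mulrDl ler_wpM2r ?exprn_ge0 //.
exact: ler_normD.
Qed.

Lemma nrmZ c p : nrm (c *: p) = `|c| * nrm p.
Proof.
rewrite (nrm_widen (size p)) ?size_scale_leq // /nrm mulr_sumr.
by apply: eq_bigr => i _; rewrite coefZ normrM mulrA.
Qed.

Lemma nrmXM p : nrm ('X * p) = 2 * nrm p.
Proof.
rewrite (nrm_widen (size p).+1); last first.
  by rewrite (leq_trans (size_polyMleq _ _)) // size_polyX.
rewrite big_ord_recl coefXM eqxx normr0 mul0r add0r /nrm mulr_sumr.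
by apply: eq_bigr => i _; rewrite coefXM lift0 /= exprS mulrCA.
Qed.

Lemma nrmXnM n p : nrm ('X^n * p) = 2 ^+ n * nrm p.
Proof.
elim: n => [|n IH]; first by rewrite !expr0 !mul1r.
by rewrite exprS -mulrA nrmXM IH mulrA -exprS.
Qed.

Lemma nrmC c : nrm c%:P = `|c|.
Proof.
rewrite (nrm_widen 1) ?size_polyC ?leq_b1 //.
by rewrite big_ord_recl big_ord0 coefC eqxx addr0 expr0 mulr1.
Qed.

Lemma nrm0 : nrm 0 = 0. Proof. by rewrite -[0]/(0%:P) nrmC normr0. Qed.
Lemma nrm1 : nrm 1 = 1. Proof. by rewrite -[1]/(1%:P) nrmC normr1. Qed.
Lemma nrmXn n : nrm 'X^n = 2 ^+ n.
Proof. by rewrite -[_ ^+ n]mulr1 nrmXnM nrm1 mulr1. Qed.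
Lemma nrmX : nrm 'X = 2. Proof. exact: nrmXn 1%N. Qed.

Lemma nrm_sum (I : Type) (r : seq I) (P : pred I) (F : I -> {poly R}) :
  nrm (\sum_(i <- r | P i) F i) <= \sum_(i <- r | P i) nrm (F i).
Proof.
elim/big_rec2: _ => [|i y x _ h]; first by rewrite nrm0.
by rewrite (le_trans (nrmD _ _)) // lerD2l.
Qed.

Lemma nrmM p q : nrm (p * q) <= nrm p * nrm q.
Proof.
rewrite -{1}[p]coefK poly_def mulr_suml (le_trans (nrm_sum _ _ _ _)) //.
rewrite {2}/nrm mulr_suml; apply: ler_sum => i _.
by rewrite -scalerAl nrmZ nrmXnM mulrA.
Qed.

Lemma nrm_exp p n : nrm (p ^+ n) <= nrm p ^+ n.
Proof.
elim: n => [|n IH]; first by rewrite !expr0 nrm1.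
by rewrite !exprS (le_trans (nrmM _ _)) // ler_wpM2l // nrm_ge0.
Qed.

(** Sizes and distance are carried together because the Lipschitz constant of a product involves the
    sizes of its factors. The rules below then show in one computation that the fixed point map
    preserves a ball and contracts it. *)
Definition near_poly M d p q := [/\ nrm p <= M, nrm q <= M & nrm (p - q) <= d].

Lemma near_polyD M1 d1 M2 d2 p1 q1 p2 q2 :
  near_poly M1 d1 p1 q1 -> near_poly M2 d2 p2 q2 ->
  near_poly (M1 + M2) (d1 + d2) (p1 + p2) (q1 + q2).
Proof.
move=> [a1 b1 c1] [a2 b2 c2]; split.
- by rewrite (le_trans (nrmD _ _)) // lerD.
- by rewrite (le_trans (nrmD _ _)) // lerD.
- by rewrite opprD addrACA (le_trans (nrmD _ _)) // lerD.
Qed.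

Lemma near_polyN M d p q : near_poly M d p q -> near_poly M d (- p) (- q).
Proof. by move=> [a b c]; split; rewrite -?opprD nrmN. Qed.

Lemma near_polyM M1 d1 M2 d2 p1 q1 p2 q2 :
  near_poly M1 d1 p1 q1 -> near_poly M2 d2 p2 q2 ->
  near_poly (M1 * M2) (d1 * M2 + M1 * d2) (p1 * p2) (q1 * q2).
Proof.
move=> [a1 b1 c1] [a2 b2 c2]; split.
- by rewrite (le_trans (nrmM _ _)) // ler_pM // nrm_ge0.
- by rewrite (le_trans (nrmM _ _)) // ler_pM // nrm_ge0.
- have -> : p1 * p2 - q1 * q2 = (p1 - q1) * p2 + q1 * (p2 - q2) by ring.
  by rewrite (le_trans (nrmD _ _)) // lerD // (le_trans (nrmM _ _)) // ler_pM // nrm_ge0.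
Qed.

Lemma near_poly_cst M p : nrm p <= M -> near_poly M 0 p p.
Proof. by move=> h; split=> //; rewrite subrr nrm0. Qed.

Lemma near_poly_le M d M' d' p q :
  near_poly M d p q -> M <= M' -> d <= d' -> near_poly M' d' p q.
Proof. by move=> [a b c] h1 h2; split; apply: le_trans; eauto. Qed.

Lemma near_polyX M d p q n : 1 <= M -> 0 <= d ->
  near_poly M d p q -> near_poly (M ^+ n) (n%:R * M ^+ n * d) (p ^+ n) (q ^+ n).
Proof.
move=> M1 d0 h; elim: n => [|n IH].
  by rewrite !expr0 !mul0r; apply: near_poly_cst; rewrite nrm1.
rewrite !exprS; apply: near_poly_le (near_polyM _ _ _ _ _ _ _ _ h IH) _ _ => //.
have M0 : 0 <= M by exact: le_trans M1.
have Mn : 0 <= M ^+ n by rewrite exprn_ge0.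
have -> : n.+1%:R * (M * M ^+ n) * d = M * (M ^+ n * d) + M * (n%:R * M ^+ n * d).
  by rewrite -addn1 natrD; ring.
by rewrite lerD2r mulrC ler_peMl // mulr_ge0.
Qed.

End weighted_norm.

(** * Inverting the linearised equation *)

Section linear_step.
Context {R : realFieldType}.
Implicit Types (N : {poly R}).

(* The solution of (X^2 - 1) t - c X - s (1 + X^2) = X^k; the scalars c and s
   are those that make X^k + c X + s (1 + X^2) vanish at 1 and -1. *)
Fixpoint step_poly (k : nat) : {poly R} :=
  match k with
  | 0%N => (- 2^-1)%:P
  | 1%N => 0
  | k'.+2 => step_poly k' + 'X^k'
  end.
Definition step_c (k : nat) : R := if odd k then -1 else 0.
Definition step_s (k : nat) : R := if odd k then 0 else - 2^-1.

Lemma nat_ind2 (P : nat -> Prop) :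
  P 0%N -> P 1%N -> (forall k, P k -> P k.+2) -> forall k, P k.
Proof.
move=> P0 P1 PS k; suff [] : P k /\ P k.+1 by [].
by elim: k => // k [h1 h2]; split=> //; exact: PS.
Qed.

Lemma step_polyE k :
  ('X^2 - 1) * step_poly k - (step_c k)%:P * 'X - (step_s k)%:P * (1 + 'X^2) = 'X^k.
Proof.
elim/nat_ind2: k => [||k IH].
- rewrite /step_c /step_s /= polyCN mul0r subr0 expr0.
  have h : 1 = (2^-1)%:P + (2^-1)%:P :> {poly R} by rewrite -[1]/(1%:P) -polyCD; congr polyC; lra.
  by rewrite [X in _ = X]h; ring.
- by rewrite /step_c /step_s /= polyCN mulr0 mul0r subr0 expr1 sub0r mulN1r opprK.
- have -> : step_c k.+2 = step_c k by rewrite /step_c /= negbK.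
  have -> : step_s k.+2 = step_s k by rewrite /step_s /= negbK.
  rewrite [step_poly _]/= -[in RHS]addn2 exprD; move: IH.
  set t := step_poly k; set y := 'X ^+ k => IH.
  have -> : y * 'X^2 = y + ('X^2 - 1) * y by ring.
  by rewrite -[X in _ = X + _]IH; ring.
Qed.

Lemma nrm_step_poly k : nrm (step_poly k) <= 2 ^+ k.
Proof.
elim/nat_ind2: k => [||k IH] /=.
- by rewrite nrmC normrN ger0_norm ?invr_ge0 //; lra.
- by rewrite nrm0.
- apply: le_trans (nrmD _ _) _; rewrite nrmXn !exprS.
  have h0 : 0 <= 2 ^+ k :> R by rewrite exprn_ge0.
  by lra.
Qed.

Lemma step_c_le k : `|step_c k| <= 2 ^+ k.
Proof.
rewrite /step_c; case: odd; rewrite ?normrN ?normr1 ?normr0 ?exprn_ge0 //.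
by rewrite exprn_ege1 // ler1n.
Qed.

Lemma step_s_le k : `|step_s k| <= 2 ^+ k.
Proof.
rewrite /step_s; case: odd; rewrite ?normr0 ?exprn_ge0 //.
rewrite normrN ger0_norm ?invr_ge0 //.
have : 1 <= 2 ^+ k :> R by rewrite exprn_ege1 // ler1n.
by lra.
Qed.

(** Linear extension of f from the monomials X^i. The target is a general module so that the
    polynomial eta and the scalars c and s share one linearity lemma. *)
Definition lin_poly {V : lmodType R} (f : nat -> V) N := \sum_(i < size N) N`_i *: f i.

Lemma lin_polyB {V : lmodType R} (f : nat -> V) N N' :
  lin_poly f (N - N') = lin_poly f N - lin_poly f N'.
Proof.
pose n := maxn (size N) (size N').
have W (p : {poly R}) : (size p <= n)%N -> lin_poly f p = \sum_(i < n) p`_i *: f i.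
  move=> pn; apply: (@sum_coef_widen _ _ (fun i a => a *: f i)) => // i.
  exact: scale0r.
rewrite !W ?leq_maxl ?leq_maxr //; last first.
  by rewrite (leq_trans (size_polyD _ _)) // size_polyN.
by rewrite -sumrB; apply: eq_bigr => i _; rewrite coefB scalerBl.
Qed.

Definition solve_eta N : {poly R} := lin_poly step_poly N.
Definition solve_c N : R := \sum_(i < size N) N`_i * step_c i.
Definition solve_s N : R := \sum_(i < size N) N`_i * step_s i.

Lemma solve_cB N N' : solve_c (N - N') = solve_c N - solve_c N'.
Proof. exact: (lin_polyB (step_c : nat -> R^o)). Qed.

Lemma solve_sB N N' : solve_s (N - N') = solve_s N - solve_s N'.
Proof. exact: (lin_polyB (step_s : nat -> R^o)). Qed.

Lemma solveE N :
  ('X^2 - 1) * solve_eta N - (solve_c N)%:P * 'X - (solve_s N)%:P * (1 + 'X^2) = N.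
Proof.
rewrite /solve_eta /solve_c /solve_s /lin_poly !rmorph_sum !mulr_sumr !mulr_suml -!sumrB.
rewrite -[RHS]coefK poly_def; apply: eq_bigr => i _.
rewrite -[in RHS](step_polyE i) -!mul_polyC /= !polyCM.
by set x := _%:P; set a := _%:P; set b := _%:P; ring.
Qed.

Lemma nrm_solve_eta N : nrm (solve_eta N) <= nrm N.
Proof.
apply: le_trans (nrm_sum _ _ _ _) _; apply: ler_sum => i _.
by rewrite nrmZ ler_wpM2l // nrm_step_poly.
Qed.

Lemma solve_c_le N : `|solve_c N| <= nrm N.
Proof.
apply: le_trans (ler_norm_sum _ _ _) _; apply: ler_sum => i _.
by rewrite normrM ler_wpM2l // step_c_le.
Qed.

Lemma solve_s_le N : `|solve_s N| <= nrm N.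
Proof.
apply: le_trans (ler_norm_sum _ _ _) _; apply: ler_sum => i _.
by rewrite normrM ler_wpM2l // step_s_le.
Qed.

(** The three solution operators are linear of norm at most 1, so they lose nothing in either
    bound. *)
Lemma solve_near M d N N' : near_poly M d N N' ->
  [/\ near_poly M d (solve_eta N) (solve_eta N'),
      near_poly M d (solve_c N)%:P (solve_c N')%:P
    & near_poly M d (solve_s N)%:P (solve_s N')%:P].
Proof.
move=> [a b c]; split; split; 
  rewrite -?polyCB -?solve_cB -?solve_sB /solve_eta -?lin_polyB ?nrmC.
1-3: exact: le_trans (nrm_solve_eta _) _.
1-3: exact: le_trans (solve_c_le _) _.
1-3: exact: le_trans (solve_s_le _) _.
Qed.

End linear_step.

(** * The fixed point iteration *)

Section iteration.
Context {R : realFieldType} (a : nat -> R) (L eps : R).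
Hypothesis L1 : 1 <= L.
Hypothesis a0 : a 0%N = 1.
Hypothesis aL : forall k, `|a k| <= L ^+ k.+2.
Hypothesis eps0 : 0 < eps.

(** A(v) cut after J terms; [a k] will be the moment of order k + 2. *)
Definition tail_poly J (v : {poly R}) := \sum_(k < J) (a k * eps ^+ k) *: v ^+ k.

(** What is left of the equation once the part linear in eta, c and s stands alone on the other
    side. Every term is quadratic in these unknowns or small with eps, through A - 1 or eps^2,
    whence the contraction. *)
Definition step_map (eta c s A : {poly R}) : {poly R} :=
  let h := 1 + eta in
  - ('X^2 * eta ^+ 2) - 'X^2 * h ^+ 2 * (A - 1) + c * 'X * eta
  + s * (1 + 'X^2) * eta
  + (c * 'X + (1 + s) * (1 + 'X^2)) * h ^+ 3 * (eps ^+ 2)%:P * 'X^2 * A.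

(* The equation 1 + v^2 A(v) = x v (1 + eps^2 v^2 A(v)) at v = u h(u),
   x = c + (1 + s) (u + 1/u), multiplied out. *)
Definition residual (eta c s A : {poly R}) : {poly R} :=
  let h := 1 + eta in
  1 + 'X^2 * h ^+ 2 * A
  - (c * 'X + (1 + s) * (1 + 'X^2)) * h * (1 + (eps ^+ 2)%:P * 'X^2 * h ^+ 2 * A).

Lemma residualE eta c s A :
  residual eta c s A =
    ('X^2 - 1) * eta - c * 'X - s * (1 + 'X^2) - step_map eta c s A.
Proof. by rewrite /residual /step_map; ring. Qed.

(** Radius of the ball that contains all iterates. The factor 10^6 is generous, so that crude
    estimates suffice in [near_step]. *)
Definition tau : R := 1000 * 1000 * (L ^+ 3 * eps).
Hypothesis tau_small : tau <= 200^-1.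

(** For v of norm at most 4, the k-th term of A has size and Lipschitz constant at most L^2 (8 L
    eps)^k, since k 4^k <= 8^k. With ratio at most 1/2, the sum over k >= 1 is at most twice its
    first term 8 L^3 eps. *)
Definition tail_bound : R := 16 * L ^+ 3 * eps.
Local Notation K := tail_bound.

Let L0 : 0 < L. Proof. exact: lt_le_trans L1. Qed.
Let L31 : 1 <= L ^+ 3. Proof. exact: exprn_ege1. Qed.
Let LL3 : L <= L ^+ 3.
Proof. by rewrite exprS ler_peMr ?(ltW L0) // exprn_ege1. Qed.
Let L3eps : 0 < L ^+ 3 * eps. Proof. exact: mulr_gt0 (exprn_gt0 _ L0) eps0. Qed.
Let tau0 : 0 < tau.
Proof. by have := L3eps; rewrite /tau; set y := L ^+ 3 * eps; lra. Qed.
Let eps_tau : 1000 * 1000 * eps <= tau.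
Proof.
have : eps <= L ^+ 3 * eps by rewrite ler_peMl // ltW.
by rewrite /tau; set y := L ^+ 3 * eps; lra.
Qed.
Let K0 : 0 < K.
Proof. by have := L3eps; rewrite /tail_bound -mulrA; set y := L ^+ 3 * eps; lra. Qed.
Let K_tau : 100 * 100 * K <= tau.
Proof.
have := L3eps.
by rewrite /tau /tail_bound -[16 * L ^+ 3 * eps]mulrA; set y := L ^+ 3 * eps; lra.
Qed.

Let x : R := 8 * L * eps.
Let x0 : 0 < x. Proof. by rewrite !mulr_gt0. Qed.
Let x_half : x <= 2^-1.
Proof.
have h : L * eps <= L ^+ 3 * eps by rewrite ler_pM2r.
have := tau_small; rewrite /tau /x -[8 * L * eps]mulrA; move: h.
by set y := L * eps; set z := L ^+ 3 * eps; lra.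
Qed.

Lemma geometric_le2 (y : R) n : 0 <= y -> y <= 2^-1 -> \sum_(k < n) y ^+ k <= 2.
Proof.
move=> y0 y2; have h := subrX1 y n; have yn : 0 <= y ^+ n by rewrite exprn_ge0.
have s0 : 0 <= \sum_(k < n) y ^+ k by apply: sumr_ge0 => k _; exact: exprn_ge0.
by nra.
Qed.

Lemma near_poly_sum (I : Type) (r : seq I) (M d : I -> R) (p q : I -> {poly R}) :
  (forall i, near_poly (M i) (d i) (p i) (q i)) ->
  near_poly (\sum_(i <- r) M i) (\sum_(i <- r) d i)
    (\sum_(i <- r) p i) (\sum_(i <- r) q i).
Proof.
move=> h; elim: r => [|i r IH]; first by rewrite !big_nil; apply: near_poly_cst; rewrite nrm0.
by rewrite !big_cons; exact: near_polyD.
Qed.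

Let term_le k : `|a k * eps ^+ k| * 8 ^+ k <= L ^+ 2 * x ^+ k.
Proof.
rewrite normrM (ger0_norm (exprn_ge0 _ (ltW eps0))) /x !exprMn.
have -> : L ^+ 2 * (8 ^+ k * L ^+ k * eps ^+ k) = L ^+ k.+2 * eps ^+ k * 8 ^+ k.
  by rewrite -[k.+2]addn2 exprD; ring.
by rewrite !ler_wpM2r ?exprn_ge0 // ltW.
Qed.

Let sum_terms J : \sum_(k < J) L ^+ 2 * x ^+ k.+1 <= K.
Proof.
rewrite -mulr_sumr; under eq_bigr do rewrite exprS.
rewrite -mulr_sumr; have h := geometric_le2 x J (ltW x0) x_half.
have -> : K = L ^+ 2 * (x * 2) by rewrite /tail_bound /x; ring.
by rewrite ler_pM2l ?exprn_gt0 // ler_pM2l.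
Qed.

Lemma nat_le_exp2 n : (n%:R : R) <= 2 ^+ n.
Proof. by rewrite -natrX ler_nat ltnW // ltn_expl. Qed.

Lemma near_tail J v v' d : 0 <= d -> near_poly 4 d v v' ->
  near_poly K (K * d) (tail_poly J.+1 v - 1) (tail_poly J.+1 v' - 1).
Proof.
move=> d0 h; rewrite /tail_poly !big_ord_recl /= a0 !expr0 mulr1 scale1r.
rewrite ![1 + _]addrC !addrK.
have e w : \sum_(i < J) (a (lift ord0 i) * eps ^+ lift ord0 i) *: w ^+ lift ord0 i =
   \sum_(i < J) (a i.+1 * eps ^+ i.+1)%:P * w ^+ i.+1.
  by apply: eq_bigr => i _; rewrite mul_polyC.
rewrite !e.
apply: near_poly_le (near_poly_sum _ _ (fun i : 'I_J => L ^+ 2 * x ^+ i.+1) (fun i : 'I_J => L ^+ 2 * x ^+ i.+1 * d) _ _ _) _ _;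
  [|exact: sum_terms|by rewrite -mulr_suml ler_wpM2r ?sum_terms].
move=> i; have h41 : 1 <= 4 :> R by rewrite ler1n.
apply: near_poly_le (near_polyM _ _ _ _ _ _ _ _ (near_poly_cst _ _ (lexx _))
  (near_polyX _ _ _ _ i.+1 h41 d0 h)) _ _.
  rewrite nrmC; apply: le_trans (term_le i.+1); apply: ler_wpM2l => //.
  by apply: lerXn2r; rewrite ?nnegrE; lra.
rewrite mul0r add0r nrmC mulrA ler_wpM2r //; apply: le_trans (term_le i.+1).
have -> : 8 = 2 * 4 :> R by ring.
rewrite ler_wpM2l //.
by rewrite exprMn ler_wpM2r ?exprn_ge0 // nat_le_exp2.
Qed.

Lemma tail_polyS_near J v : nrm v <= 4 ->
  nrm (tail_poly J.+2 v - tail_poly J.+1 v) <= K * 2^-1 ^+ J.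
Proof.
move=> h; rewrite /tail_poly big_ord_recr /= addrAC subrr add0r nrmZ.
apply: (@le_trans _ _ (L ^+ 2 * x ^+ J.+1)).
  apply: le_trans (term_le J.+1); rewrite ler_wpM2l //.
  apply: le_trans (nrm_exp _ _) _; apply: lerXn2r; rewrite ?nnegrE ?nrm_ge0 //.
  by apply: le_trans h _; lra.
rewrite [x ^+ _]exprS mulrA; have h2 : x ^+ J <= 2^-1 ^+ J.
  by rewrite lerXn2r ?nnegrE ?(ltW x0) // ?invr_ge0.
have Lx0 : 0 <= L ^+ 2 * x by apply: mulr_ge0; [exact/exprn_ge0/ltW | exact: ltW].
apply: ler_pM => //; first exact/exprn_ge0/ltW.
have -> : K = 2 * (L ^+ 2 * x) by rewrite /tail_bound /x; ring.
by move: Lx0; set y := L ^+ 2 * x; lra.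
Qed.

(** In [iterate_near] this is used with dA = 3 K d and K <= 1/240, so the new distance is at most
    d/6 + d/4 < d/2. The coefficient of dA comes mainly from X^2 h^2 (A - 1), which contributes
    16. *)
Lemma near_step d dA eta c s A eta' c' s' A' : 0 <= d -> 0 <= dA ->
  near_poly tau d eta eta' -> near_poly tau d c c' -> near_poly tau d s s' ->
  near_poly K dA (A - 1) (A' - 1) ->
  near_poly tau (d / 6 + 20 * dA) (step_map eta c s A) (step_map eta' c' s' A').
Proof.
move=> d0 dA0 he hc hs hA1.
have t0 := tau0; have ts := tau_small; have ets := eps_tau; have kts := K_tau.
have k0 := K0; have e0 := eps0.
have n2 : near_poly 4 0 ('X^2 : {poly R}) 'X^2.
  by apply: near_poly_cst; rewrite nrmXn; lra.
have n1 : near_poly 1 0 (1 : {poly R}) 1 by apply: near_poly_cst; rewrite nrm1.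
have nX : near_poly 2 0 ('X : {poly R}) 'X by apply: near_poly_cst; rewrite nrmX.
have hA : near_poly 2 dA A A'.
  have := near_polyD _ _ _ _ _ _ _ _ n1 hA1; rewrite add0r ![1 + _]addrC !subrK.
  by move=> h; apply: near_poly_le h _ _; lra.
have hh : near_poly 2 d (1 + eta) (1 + eta').
  by apply: near_poly_le (near_polyD _ _ _ _ _ _ _ _ n1 he) _ _; lra.
have h1 : near_poly (tau / 50) (d / 25) ('X^2 * eta ^+ 2) ('X^2 * eta' ^+ 2).
  rewrite !expr2; apply: near_poly_le (near_polyM _ _ _ _ _ _ _ _ n2 (near_polyM _ _ _ _ _ _ _ _ he he)) _ _; nra.
have h2 : near_poly (tau / 100) (d / 100 + 16 * dA)
    ('X^2 * (1 + eta) ^+ 2 * (A - 1)) ('X^2 * (1 + eta') ^+ 2 * (A' - 1)).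
  rewrite !expr2; apply: near_poly_le (near_polyM _ _ _ _ _ _ _ _ (near_polyM _ _ _ _ _ _ _ _ n2 (near_polyM _ _ _ _ _ _ _ _ hh hh)) hA1) _ _; nra.
have h3 : near_poly (tau / 50) (d / 50) (c * 'X * eta) (c' * 'X * eta').
  apply: near_poly_le (near_polyM _ _ _ _ _ _ _ _ (near_polyM _ _ _ _ _ _ _ _ hc nX) he) _ _; nra.
have n12 := near_polyD _ _ _ _ _ _ _ _ n1 n2.
have h4 : near_poly (tau / 40) (d / 20) (s * (1 + 'X^2) * eta) (s' * (1 + 'X^2) * eta').
  apply: near_poly_le (near_polyM _ _ _ _ _ _ _ _ (near_polyM _ _ _ _ _ _ _ _ hs n12) he) _ _; nra.
have h5 : near_poly 11 (7 * d) (c * 'X + (1 + s) * (1 + 'X^2)) (c' * 'X + (1 + s') * (1 + 'X^2)).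
  apply: near_poly_le (near_polyD _ _ _ _ _ _ _ _ (near_polyM _ _ _ _ _ _ _ _ hc nX)
    (near_polyM _ _ _ _ _ _ _ _ (near_polyD _ _ _ _ _ _ _ _ n1 hs) n12)) _ _; nra.
have h6 : near_poly 8 (12 * d) ((1 + eta) ^+ 3) ((1 + eta') ^+ 3).
  rewrite !exprS !expr0 !mulr1; apply: near_poly_le (near_polyM _ _ _ _ _ _ _ _ hh (near_polyM _ _ _ _ _ _ _ _ hh hh)) _ _; nra.
have h7 : near_poly 88 (200 * d)
    ((c * 'X + (1 + s) * (1 + 'X^2)) * (1 + eta) ^+ 3)
    ((c' * 'X + (1 + s') * (1 + 'X^2)) * (1 + eta') ^+ 3).
  apply: near_poly_le (near_polyM _ _ _ _ _ _ _ _ h5 h6) _ _; nra.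
have h8 : near_poly (eps / 100) 0 (eps ^+ 2)%:P (eps ^+ 2)%:P.
  apply: near_poly_cst; rewrite nrmC ger0_norm ?exprn_ge0 ?(ltW e0) //.
  by rewrite expr2; nra.
have h9 := near_polyM _ _ _ _ _ _ _ _ (near_polyM _ _ _ _ _ _ _ _ (near_polyM _ _ _ _ _ _ _ _ h7 h8) n2) hA.
have := near_polyD _ _ _ _ _ _ _ _ (near_polyD _ _ _ _ _ _ _ _ (near_polyD _ _ _ _ _ _ _ _
  (near_polyD _ _ _ _ _ _ _ _ (near_polyN _ _ _ _ h1) (near_polyN _ _ _ _ h2)) h3) h4) h9.
move=> h; apply: near_poly_le h _ _; nra.
Qed.

(** The unknown is the right hand side N of the linear problem; eta, c and s are recovered from it.
    Stage j keeps j terms of A, so all iterates are polynomials and the truncation error decays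
    along with the iteration error. *)
Fixpoint iterate (j : nat) : {poly R} :=
  if j is j'.+1 then
    let N := iterate j' in
    step_map (solve_eta N) (solve_c N)%:P (solve_s N)%:P
      (tail_poly j (('X : {poly R}) * (1 + solve_eta N)))
  else 0.

Let tau1 : tau <= 1. Proof. by move: tau_small; lra. Qed.
Let K1 : K <= 240^-1.
Proof. by move: tau_small K_tau; lra. Qed.

Let near_v d N N' : near_poly tau d N N' ->
  near_poly 4 (2 * d) (('X : {poly R}) * (1 + solve_eta N)) ('X * (1 + solve_eta N')).
Proof.
move=> h; have [he _ _] := solve_near _ _ _ _ h.
have n1 : near_poly 1 0 (1 : {poly R}) 1 by apply: near_poly_cst; rewrite nrm1.
have nX : near_poly 2 0 ('X : {poly R}) 'X by apply: near_poly_cst; rewrite nrmX.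
have t1 := tau1.
by apply: near_poly_le (near_polyM _ _ _ _ _ _ _ _ nX (near_polyD _ _ _ _ _ _ _ _ n1 he)) _ _; lra.
Qed.

(** Of the distance 3 K d, the part 2 K d comes from the arguments and K d from the additional term
    of the longer truncation. *)
Let near_A d j N N' : 0 <= d -> 2^-1 ^+ j <= d -> near_poly tau d N N' ->
  near_poly K (3 * K * d) (tail_poly j.+1 ('X * (1 + solve_eta N)) - 1)
                          (tail_poly j.+2 ('X * (1 + solve_eta N')) - 1).
Proof.
move=> d0 hj h; have hv := near_v _ _ _ h; have [a1 b1 c1] := hv.
have d20 : 0 <= 2 * d by rewrite mulr_ge0.
have [a2 b2 c2] := near_tail j _ _ _ d20 hv.
have [a3 b3 c3] := near_tail j.+1 _ _ _ d20 hv.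
split=> //; rewrite opprB addrA subrK.
set p1 := tail_poly j.+1 ('X * (1 + solve_eta N)).
set p2 := tail_poly j.+2 ('X * (1 + solve_eta N')).
rewrite -(subrK (tail_poly j.+1 ('X * (1 + solve_eta N'))) p1) -addrA.
apply: le_trans (nrmD _ _) _.
have e1 : nrm (p1 - tail_poly j.+1 ('X * (1 + solve_eta N'))) <= K * (2 * d).
  by move: c2; rewrite opprB addrA subrK.
have e2 : nrm (tail_poly j.+1 ('X * (1 + solve_eta N')) - p2) <= K * d.
  rewrite -nrmN opprB; apply: le_trans (tail_polyS_near j _ b1) _.
  by rewrite ler_pM2l.
by apply: le_trans (lerD e1 e2) _; lra.
Qed.

Lemma iterate_near j : near_poly tau (2^-1 ^+ j) (iterate j) (iterate j.+1).
Proof.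
elim: j => [|j IH].
  have z : near_poly tau 0 (0 : {poly R}) 0 by apply: near_poly_cst; rewrite nrm0 ltW.
  have [he hc hs] := solve_near _ _ _ _ z.
  have hv := near_v _ _ _ z; rewrite mulr0 in hv.
  have hA := near_tail 0 _ _ _ (lexx _) hv.
  rewrite mulr0 in hA; have [b _ _] := near_step _ _ _ _ _ _ _ _ _ _ (lexx _) (lexx _) he hc hs hA.
  split; rewrite ?expr0 /= ?nrm0 ?(ltW tau0) // sub0r nrmN.
  exact: le_trans b tau1.
have [he hc hs] := solve_near _ _ _ _ IH.
have d0 : 0 <= 2^-1 ^+ j :> R by rewrite exprn_ge0 // invr_ge0.
have hA := near_A _ j _ _ d0 (lexx _) IH.
have dA0 : 0 <= 3 * K * 2^-1 ^+ j by rewrite !mulr_ge0 // ltW.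
have := near_step _ _ _ _ _ _ _ _ _ _ d0 dA0 he hc hs hA.
move=> h; apply: near_poly_le h (lexx _) _.
have k1 := K1; rewrite exprS; move: d0; set d := 2^-1 ^+ j => d0; nra.
Qed.

Lemma approximate_solutions :
  exists (h A : nat -> {poly R}) (c s : nat -> R), forall j,
  [/\ near_poly tau (2^-1 ^+ j) (h j - 1) (h j.+1 - 1)
      /\ A j = tail_poly j.+1 ('X * h j),
      near_poly tau (2^-1 ^+ j) (A j - 1) (A j.+1 - 1),
      near_poly tau (2^-1 ^+ j) (c j)%:P (c j.+1)%:P,
      near_poly tau (2^-1 ^+ j) (s j)%:P (s j.+1)%:P
    & nrm (residual (h j - 1) (c j)%:P (s j)%:P (A j)) <= 2^-1 ^+ j].
Proof.
exists (fun j => 1 + solve_eta (iterate j)).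
exists (fun j => tail_poly j.+1 ('X * (1 + solve_eta (iterate j)))).
exists (fun j => solve_c (iterate j)), (fun j => solve_s (iterate j)) => j.
have IH := iterate_near j; have [he hc hs] := solve_near _ _ _ _ IH.
have d0 : 0 <= 2^-1 ^+ j :> R by rewrite exprn_ge0 // invr_ge0.
rewrite ![1 + solve_eta _ - 1]addrC !addKr; split=> //.
  have k1 := K1; have kt := K_tau; have k0 := K0.
  by apply: near_poly_le (near_A _ j _ _ d0 (lexx _) IH) _ _; [lra | nra].
(* The linear part of the residual returns [iterate j] and [step_map] gives [iterate j.+1], so the
   residual is the difference of consecutive iterates. *)
rewrite residualE solveE -[step_map _ _ _ _]/(iterate j.+1).
by have [] := IH.
Qed.

End iteration.

(** * Analytic solution in the disc of radius 2 *)

Section modulus.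
Context {R : realType}.
Implicit Types (z w : R[i]) (x : R).

Lemma ReD z w : complex.Re (z + w) = complex.Re z + complex.Re w.
Proof. by case: z; case: w. Qed.
Lemma ImD z w : complex.Im (z + w) = complex.Im z + complex.Im w.
Proof. by case: z; case: w. Qed.
Lemma ReN z : complex.Re (- z) = - complex.Re z. Proof. by case: z. Qed.
Lemma ImN z : complex.Im (- z) = - complex.Im z. Proof. by case: z. Qed.

(** The norm of R[i] takes its values in R[i]; this is the same number in R. *)
Definition cabs z : R := complex.Re `|z|.

Lemma cabsE z : `|z| = (cabs z)%:C%C.
Proof. by rewrite /cabs normc_def. Qed.

Lemma cabs_ge0 z : 0 <= cabs z.
Proof. by rewrite -(@lecR R) -cabsE normr_ge0. Qed.

Lemma cabsM z w : cabs (z * w) = cabs z * cabs w.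
Proof. by apply: (@complexI R); rewrite rmorphM /= -!cabsE normrM. Qed.

Lemma cabsD z w : cabs (z + w) <= cabs z + cabs w.
Proof. by rewrite -(@lecR R) rmorphD /= -!cabsE ler_normD. Qed.

Lemma cabsN z : cabs (- z) = cabs z.
Proof. by rewrite /cabs normrN. Qed.

Lemma cabsB z w : cabs (z - w) <= cabs z + cabs w.
Proof. by rewrite -(cabsN w) cabsD. Qed.

Lemma cabs_distC z w : cabs (z - w) = cabs (w - z).
Proof. by rewrite -cabsN opprB. Qed.

Lemma cabsX z n : cabs (z ^+ n) = cabs z ^+ n.
Proof. by apply: (@complexI R); rewrite rmorphXn /= -!cabsE normrX. Qed.

Lemma cabsV z : cabs z^-1 = (cabs z)^-1.
Proof. by apply: (@complexI R); rewrite fmorphV /= -!cabsE normfV. Qed.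

Lemma cabs_real x : cabs x%:C%C = `|x|.
Proof.
rewrite /cabs normc_def /= expr0n addr0 sqrtr_sqr //.
Qed.

Lemma cabs1 : cabs 1 = 1. Proof. by rewrite (cabs_real 1) normr1. Qed.
Lemma cabs0 : cabs 0 = 0. Proof. by rewrite (cabs_real 0) normr0. Qed.

Lemma cabs_eq0 z : cabs z = 0 -> z = 0.
Proof. by move=> h; apply/eqP; rewrite -normr_eq0 cabsE h. Qed.

Lemma Re_le_cabs z : `|complex.Re z| <= cabs z.
Proof. by rewrite -(@lecR R) -cabsE normc_ge_Re. Qed.

Lemma Im_le_cabs z : `|complex.Im z| <= cabs z.
Proof.
rewrite /cabs normc_def /= -sqrtr_sqr ler_wsqrtr // lerDr sqr_ge0 //.
Qed.

Lemma cabs_le_ReIm z : cabs z <= `|complex.Re z| + `|complex.Im z|.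
Proof.
case: z => a b; rewrite [X in cabs X]complexE /=.
apply: le_trans (cabsD _ _) _; rewrite cabsM !cabs_real lerD2l.
have -> : cabs 'i%C = 1 by rewrite /cabs normc_def /= expr0n expr1n add0r sqrtr1.
by rewrite mul1r.
Qed.

Lemma cabs_sum (I : Type) (r : seq I) (P : pred I) (F : I -> R[i]) :
  cabs (\sum_(i <- r | P i) F i) <= \sum_(i <- r | P i) cabs (F i).
Proof.
elim/big_rec2: _ => [|i y x _ h]; first by rewrite cabs0.
by rewrite (le_trans (cabsD _ _)) // lerD2l.
Qed.

Definition ceval (p : {poly R}) z : R[i] := (map_poly (real_complex R) p).[z].

Lemma cevalD p q z : ceval (p + q) z = ceval p z + ceval q z.
Proof. by rewrite /ceval rmorphD hornerD. Qed.
Lemma cevalN p z : ceval (- p) z = - ceval p z.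
Proof. by rewrite /ceval rmorphN hornerN. Qed.
Lemma cevalM p q z : ceval (p * q) z = ceval p z * ceval q z.
Proof. by rewrite /ceval rmorphM hornerM. Qed.
Lemma cevalC x z : ceval x%:P z = x%:C%C.
Proof. by rewrite /ceval map_polyC hornerC. Qed.
Lemma ceval1 z : ceval 1 z = 1.
Proof. exact: (cevalC 1). Qed.
Lemma cevalX z : ceval 'X z = z.
Proof. by rewrite /ceval map_polyX hornerX. Qed.
Lemma cevalXn p n z : ceval (p ^+ n) z = ceval p z ^+ n.
Proof. by rewrite /ceval rmorphXn horner_exp. Qed.
Lemma cevalZ x p z : ceval (x *: p) z = x%:C%C * ceval p z.
Proof. by rewrite -mul_polyC cevalM cevalC. Qed.
Lemma ceval_sum (I : Type) (r : seq I) (P : pred I) (F : I -> {poly R}) z :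
  ceval (\sum_(i <- r | P i) F i) z = \sum_(i <- r | P i) ceval (F i) z.
Proof.
apply: (big_morph (fun p => ceval p z)) => [p q|]; first exact: cevalD.
exact: (cevalC 0).
Qed.

Lemma ceval_real p x : ceval p x%:C%C = (p.[x])%:C%C.
Proof. by rewrite /ceval horner_map. Qed.

Lemma cevalE p z : ceval p z = \sum_(i < size p) (p`_i)%:C%C * z ^+ i.
Proof.
rewrite -{1}[p]coefK poly_def ceval_sum; apply: eq_bigr => i _.
by rewrite cevalZ cevalXn cevalX.
Qed.

Lemma cabs_ceval p z : cabs z <= 2 -> cabs (ceval p z) <= nrm p.
Proof.
move=> z2; rewrite cevalE (le_trans (cabs_sum _ _ _ _)) //.
apply: ler_sum => i _; rewrite cabsM cabs_real cabsX ler_wpM2l //.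
by apply: lerXn2r; rewrite ?nnegrE ?cabs_ge0.
Qed.

End modulus.

(** * Sequences converging at the rate 2^-j *)

Section geometric_limits.
Context {R : realType}.
Local Notation half := (2^-1 : R).

Lemma half_expn_arbitrarily_small (e : R) : 0 < e -> exists n, half ^+ n < e.
Proof.
move=> e0; exists (Num.bound e^-1); have := upper_nthrootP (leqnn (Num.bound e^-1)).
by rewrite exprVn => h; rewrite invf_plt ?posrE ?exprn_gt0.
Qed.

Lemma geo_small_eq0 (C x : R) : 0 <= x -> (forall n, x <= C * half ^+ n) -> x = 0.
Proof.
move=> x0 h; apply/eqP; rewrite eq_le x0 andbT leNgt; apply/negP => xp.
have C0 : 0 < C.
  by have := h 0%N; rewrite expr0 mulr1; exact: lt_le_trans.
have [n hn] := half_expn_arbitrarily_small (x / C) (divr_gt0 xp C0).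
have := h n; rewrite leNgt => /negP; apply.
by rewrite mulrC -ltr_pdivlMr.
Qed.

(** The intervals of radius 2 C 2^-j around u_j are nested, and the limit is the supremum of their
    left ends. *)
Lemma real_geo_limit (u : nat -> R) C : 0 <= C ->
  (forall j, `|u j.+1 - u j| <= C * half ^+ j) ->
  exists l, forall j, `|u j - l| <= 2 * (C * half ^+ j).
Proof.
move=> C0 h.
have hS j : 2 * (C * half ^+ j.+1) = C * half ^+ j.
  by rewrite exprS mulrCA [2 * _]mulrA divff ?mul1r ?pnatr_eq0.
pose lo j := u j - 2 * (C * half ^+ j); pose up j := u j + 2 * (C * half ^+ j).
have lo_nd : {homo lo : i j / (i <= j)%N >-> i <= j}.
  apply: homo_leq => [//|y x z|j]; first exact: le_trans.
  rewrite /lo hS; have := h j; rewrite ler_norml => /andP[h1 _].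
  by move: h1; set d := C * half ^+ j; lra.
have up_ni : {homo up : i j / (i <= j)%N >-> j <= i}.
  apply: homo_leq => [//|y x z a b|j]; first exact: le_trans b a.
  rewrite /up hS; have := h j; rewrite ler_norml => /andP[_ h1].
  by move: h1; set d := C * half ^+ j; lra.
have d0 j : 0 <= C * half ^+ j by rewrite mulr_ge0 // exprn_ge0 // invr_ge0.
have lo_up i j : lo i <= up j.
  have [ij|/ltnW ji] := leqP i j.
    apply: le_trans (lo_nd _ _ ij) _; rewrite /lo /up; have := d0 j; lra.
  by apply: le_trans (up_ni _ _ ji); rewrite /lo /up; have := d0 i; lra.
pose E := [set x | exists j, x = lo j]%classic.
have hE : has_sup E.
  by split; [exists (lo 0%N), 0%N | exists (up 0%N) => _ [j ->]; exact: lo_up].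
exists (sup E) => j; rewrite ler_distl.
have h1 : lo j <= sup E by apply: (sup_upper_bound hE); exists j.
have h2 : sup E <= up j.
  by apply: ge_sup; [exact: hE.1 | move=> _ [i ->]; exact: lo_up].
by move: h1 h2; rewrite /lo /up; set d := C * half ^+ j; lra.
Qed.

(** A rate 2^-j up to a constant survives sums and products, so equations pass to the limit by
    estimates alone. *)
Definition geo_lim (u : nat -> R[i]) (l : R[i]) :=
  exists2 C, 0 <= C & forall j, cabs (u j - l) <= C * half ^+ j.

Lemma geo_lim_exists (u : nat -> R[i]) C : 0 <= C ->
  (forall j, cabs (u j.+1 - u j) <= C * half ^+ j) ->
  exists l, forall j, cabs (u j - l) <= 4 * (C * half ^+ j).
Proof.
move=> C0 h.
have [a ha] : exists a, forall j, `|complex.Re (u j) - a| <= 2 * (C * half ^+ j).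
  apply: real_geo_limit => // j; rewrite -ReN -ReD.
  exact: le_trans (Re_le_cabs _) (h j).
have [b hb] : exists b, forall j, `|complex.Im (u j) - b| <= 2 * (C * half ^+ j).
  apply: real_geo_limit => // j; rewrite -ImN -ImD.
  exact: le_trans (Im_le_cabs _) (h j).
exists (a +i* b)%C => j; apply: le_trans (cabs_le_ReIm _) _.
rewrite ReD ReN ImD ImN /=; have := ha j; have := hb j.
by set d := C * half ^+ j; lra.
Qed.

Lemma geo_lim_cst l : geo_lim (fun=> l) l.
Proof. by exists 0 => // j; rewrite subrr cabs0 mul0r. Qed.

Lemma geo_limD u l v m : geo_lim u l -> geo_lim v m -> geo_lim (fun j => u j + v j) (l + m).
Proof.
move=> [C C0 hC] [D D0 hD]; exists (C + D); first exact: addr_ge0.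
move=> j; rewrite opprD addrACA mulrDl; apply: le_trans (cabsD _ _) _.
by rewrite lerD.
Qed.

Lemma geo_limN u l : geo_lim u l -> geo_lim (fun j => - u j) (- l).
Proof. by move=> [C C0 hC]; exists C => // j; rewrite -opprD cabsN. Qed.

Lemma geo_limB u l v m : geo_lim u l -> geo_lim v m -> geo_lim (fun j => u j - v j) (l - m).
Proof. by move=> hu hv; apply: geo_limD => //; exact: geo_limN. Qed.

Lemma geo_limM u l v m : geo_lim u l -> geo_lim v m -> geo_lim (fun j => u j * v j) (l * m).
Proof.
move=> [C C0 hC] [D D0 hD]; exists (C * (D + cabs m) + cabs l * D).
  by rewrite addr_ge0 // mulr_ge0 ?addr_ge0 ?cabs_ge0.
move=> j; have -> : u j * v j - l * m = (u j - l) * v j + l * (v j - m) by ring.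
have d0 : 0 <= half ^+ j by rewrite exprn_ge0 // invr_ge0.
have d1 : half ^+ j <= 1 by rewrite exprn_ile1 ?invr_ge0 //; lra.
have vb : cabs (v j) <= D + cabs m.
  rewrite -(subrK m (v j)); apply: le_trans (cabsD _ _) _; rewrite lerD2r.
  by apply: le_trans (hD j) _; rewrite ler_piMr.
apply: le_trans (cabsD _ _) _; rewrite !cabsM mulrDl; apply: lerD.
  by rewrite mulrAC ler_pM ?cabs_ge0.
by rewrite -mulrA ler_wpM2l ?cabs_ge0.
Qed.

Lemma geo_limX u l n : geo_lim u l -> geo_lim (fun j => u j ^+ n) (l ^+ n).
Proof.
move=> h; elim: n => [|n IH]; first exact: geo_lim_cst.
rewrite exprS; have := geo_limM _ _ _ _ h IH.
by move=> [C C0 hC]; exists C => // j; rewrite exprS.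
Qed.

Lemma geo_lim_eq u v l : u =1 v -> geo_lim u l -> geo_lim v l.
Proof. by move=> e [C C0 h]; exists C => // j; rewrite -e. Qed.

Lemma geo_lim_shift u l J : geo_lim u l -> geo_lim (fun j => u (J + j)%N) l.
Proof.
move=> [C C0 h]; exists C => // j; apply: le_trans (h _) _.
rewrite ler_wpM2l // exprD ler_piMl ?exprn_ge0 ?invr_ge0 //.
by rewrite exprn_ile1 ?invr_ge0 //; lra.
Qed.

Lemma geo_lim_sum J (u : nat -> nat -> R[i]) (l : nat -> R[i]) :
  (forall k, geo_lim (u k) (l k)) ->
  geo_lim (fun j => \sum_(k < J) u k j) (\sum_(k < J) l k).
Proof.
move=> h; elim: J => [|J IH].
  by apply: (geo_lim_eq (fun=> 0)) => [j|]; rewrite big_ord0 //; exact: geo_lim_cst.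
rewrite big_ord_recr /=.
apply: geo_lim_eq (geo_limD _ _ _ _ IH (h J)) => j.
by rewrite big_ord_recr.
Qed.

Lemma geo_lim_le u l B : geo_lim u l -> (forall j, cabs (u j) <= B) -> cabs l <= B.
Proof.
move=> [C C0 h] hB; rewrite leNgt; apply/negP => lt.
have p : 0 <= cabs l - B by lra.
suff : cabs l - B = 0 by lra.
apply: (geo_small_eq0 C) => // n.
have := h n; have := hB n; have := cabsD (l - u n) (u n).
by rewrite subrK [cabs (l - _)]cabs_distC; lra.
Qed.

Lemma geo_lim0 u l C : geo_lim u l -> (forall j, cabs (u j) <= C * half ^+ j) -> l = 0.
Proof.
move=> [D D0 h] hC; apply: cabs_eq0; apply: (geo_small_eq0 (D + C)); first exact: cabs_ge0.
move=> n; have := h n; have := hC n; have := cabsD (l - u n) (u n).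
by rewrite subrK [cabs (l - _)]cabs_distC mulrDl; lra.
Qed.

Lemma geo_lim_uniq u l m : geo_lim u l -> geo_lim u m -> l = m.
Proof.
move=> hl hm; apply/eqP; rewrite -subr_eq0; apply/eqP.
apply: (geo_lim0 (fun=> 0) _ 0); last by move=> j; rewrite cabs0 mul0r.
by apply: geo_lim_eq (geo_limB _ _ _ _ hl hm) => j; rewrite subrr.
Qed.

Lemma geo_lim_real u l : (forall j, complex.Im (u j) = 0) -> geo_lim u l -> complex.Im l = 0.
Proof.
move=> h0 [C C0 h]; apply/eqP; rewrite -normr_eq0; apply/eqP.
apply: (geo_small_eq0 C) => // n; apply: le_trans (h n).
by apply: le_trans (Im_le_cabs _); rewrite ImD ImN h0 add0r normrN.
Qed.

End geometric_limits.

(** * The limit of the iterates *)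

Section solution.
Context {R : realType} (a : nat -> R) (L eps : R).
Hypothesis L1 : 1 <= L.
Hypothesis a0 : a 0%N = 1.
Hypothesis aL : forall k, `|a k| <= L ^+ k.+2.
Hypothesis eps0 : 0 < eps.
Hypothesis tau_small : tau L eps <= 200^-1.
Local Notation half := (2^-1 : R).
Local Notation tau := (tau L eps).

Let L0 : 0 < L. Proof. exact: lt_le_trans L1. Qed.
Let eps_small : eps <= 1000^-1.
Proof.
have h : 1 <= L ^+ 3 by exact: exprn_ege1.
have : 1 * eps <= L ^+ 3 * eps by rewrite ler_pM2r.
by move: tau_small; rewrite /tau mul1r; set y := L ^+ 3 * eps; lra.
Qed.

Definition cauchy_value (h A : {poly R}) : {poly R} :=
  'X * h * (1 + (eps ^+ 2)%:P * ('X^2 * (h * h)) * A).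

Let cauchy_value_near d h h' A A' : 0 <= d ->
  near_poly (1 + 200^-1) d h h' -> near_poly 2 d A A' ->
  near_poly 3 (3 * d) (cauchy_value h A) (cauchy_value h' A').
Proof.
move=> d0 hh hA.
have n1 : near_poly 1 0 (1 : {poly R}) 1 by apply: near_poly_cst; rewrite nrm1.
have nX : near_poly 2 0 ('X : {poly R}) 'X by apply: near_poly_cst; rewrite nrmX.
have n2 : near_poly 4 0 ('X^2 : {poly R}) 'X^2.
  by apply: near_poly_cst; rewrite nrmXn; lra.
have h8 : near_poly (1000^-1) 0 (eps ^+ 2)%:P (eps ^+ 2)%:P.
  apply: near_poly_cst; rewrite nrmC ger0_norm ?exprn_ge0 ?(ltW eps0) //.
  have := eps_small; have := eps0; rewrite expr2; nra.
have h3 : near_poly 50^-1 (d / 20) ((eps ^+ 2)%:P * ('X^2 * (h * h)) * A)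
    ((eps ^+ 2)%:P * ('X^2 * (h' * h')) * A').
  by apply: near_poly_le (near_polyM _ _ _ _ _ _ _ _ (near_polyM _ _ _ _ _ _ _ _ h8
    (near_polyM _ _ _ _ _ _ _ _ n2 (near_polyM _ _ _ _ _ _ _ _ hh hh))) hA) _ _; lra.
by apply: near_poly_le (near_polyM _ _ _ _ _ _ _ _ (near_polyM _ _ _ _ _ _ _ _ nX hh)
  (near_polyD _ _ _ _ _ _ _ _ n1 h3)) _ _; lra.
Qed.

(** That the bound is below 1 is what later keeps Im W nonnegative on the upper half circle, in
    [angular_ge0]. *)
Let cauchy_value_X h A : nrm (h - 1) <= 200^-1 -> nrm A <= 2 ->
  nrm (cauchy_value h A - 'X) <= 2^-1.
Proof.
move=> hh hA.
have n1 : near_poly 1 0 (1 : {poly R}) 1 by apply: near_poly_cst; rewrite nrm1.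
have hb : nrm h <= 1 + 200^-1.
  by rewrite -(subrK 1 h); apply: le_trans (nrmD _ _) _; rewrite nrm1 addrC lerD2l.
have e2 : `|eps ^+ 2| <= 1000^-1.
  rewrite ger0_norm ?exprn_ge0 ?(ltW eps0) //.
  have := eps_small; have := eps0; rewrite expr2; nra.
have -> : cauchy_value h A - 'X = 'X * (h - 1) + 'X * ((eps ^+ 2)%:P * ('X^2 * (h * (h * h) * A))).
  by rewrite /cauchy_value; ring.
apply: le_trans (nrmD _ _) _; rewrite !nrmXM mul_polyC nrmZ nrmXnM.
have h3 : nrm (h * (h * h) * A) <= (1 + 200^-1) ^+ 3 * 2.
  have g := nrm_ge0 h; have gA := nrm_ge0 A.
  apply: le_trans (nrmM _ _) _; apply: ler_pM; rewrite ?nrm_ge0 //.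
  rewrite !exprS expr0 mulr1.
  apply: le_trans (nrmM _ _) _; apply: ler_pM; rewrite ?nrm_ge0 //.
  by apply: le_trans (nrmM _ _) _; apply: ler_pM; rewrite ?nrm_ge0.
have g3 := nrm_ge0 (h * (h * h) * A).
have : `|eps ^+ 2| * (2 ^+ 2 * nrm (h * (h * h) * A)) <= 1000^-1 * (2 ^+ 2 * ((1 + 200^-1) ^+ 3 * 2)).
  by apply: ler_pM => //; rewrite ?mulr_ge0 ?exprn_ge0 // ler_wpM2l ?exprn_ge0.
by move: hh; rewrite !exprS !expr0; lra.
Qed.

(** Besides the limit equation, the statement records what later arguments consume: the polynomials
    [W_], which transfer identities for finite sine sums to W; the remainder of A after J terms,
    used for every J near u = 0 and for J = 4 on the unit circle; and reality on the real axis. *)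
Lemma exists_solution : exists (c s : R) (W_ : nat -> {poly R}) (H A W : R[i] -> R[i]),
  [/\ `|c| <= tau /\ `|s| <= tau,
      forall j, nrm (W_ j - 'X) <= 2^-1 /\ (W_ j)`_0 = 0,
      (forall z, cabs z <= 2 -> forall j, cabs (ceval (W_ j) z - W z) <= 12 * half ^+ j),
      forall z, cabs z <= 2 ->
        [/\ cabs (H z - 1) <= 200^-1,
            1 + z ^+ 2 * H z ^+ 2 * A z =
              (c%:C%C * z + (1 + s%:C%C) * (1 + z ^+ 2)) * H z *
              (1 + (eps ^+ 2)%:C%C * z ^+ 2 * H z ^+ 2 * A z),
            W z = z * H z * (1 + (eps ^+ 2)%:C%C * (z ^+ 2 * (H z * H z)) * A z)
          & cabs z <= 1 -> forall J,
            cabs (A z - \sum_(k < J) (a k * eps ^+ k)%:C%C * (z * H z) ^+ k) <=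
              2 * (L ^+ J.+2 * (2 * eps * cabs z) ^+ J)]
    & forall x : R, `|x| <= 2 ->
        complex.Im (H x%:C%C) = 0 /\ complex.Im (A x%:C%C) = 0].
Proof.
have [h [A_ [c_ [s_ sol]]]] := approximate_solutions a L eps L1 a0 aL eps0 tau_small.
have d0 j : 0 <= half ^+ j by rewrite exprn_ge0 // invr_ge0.
have lim_scalar (u : nat -> R) : (forall j, near_poly tau (half ^+ j) (u j)%:P (u j.+1)%:P) ->
    exists2 l, `|l| <= tau & geo_lim (fun j => (u j)%:C%C) l%:C%C.
  move=> hu; have [|l hl] := real_geo_limit u 1 ler01 _.
    by move=> j; have [_ _] := hu j; rewrite -polyCB nrmC distrC mul1r.
  have gl : geo_lim (fun j => (u j)%:C%C) l%:C%C.
    by exists 2 => // j; rewrite -rmorphB cabs_real; have := hl j; rewrite mul1r.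
  exists l => //; rewrite -cabs_real; apply: geo_lim_le gl _ => j.
  by rewrite cabs_real; have [+ _ _] := hu j; rewrite nrmC.
have [c hc gc] : exists2 l, `|l| <= tau & geo_lim (fun j => (c_ j)%:C%C) l%:C%C.
  by apply: lim_scalar => j; have [] := sol j.
have [s hs gs] : exists2 l, `|l| <= tau & geo_lim (fun j => (s_ j)%:C%C) l%:C%C.
  by apply: lim_scalar => j; have [] := sol j.
have lim_poly (p : nat -> {poly R}) C z : 0 <= C -> cabs z <= 2 ->
    (forall j, nrm (p j - p j.+1) <= C * half ^+ j) ->
    exists l, forall j, cabs (ceval (p j) z - l) <= 4 * (C * half ^+ j).
  move=> C0 z2 hp; apply: geo_lim_exists => // j.
  have -> : ceval (p j.+1) z - ceval (p j) z = - ceval (p j - p j.+1) z.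
    by rewrite cevalD cevalN opprB.
  by rewrite cabsN; apply: le_trans (hp j); exact: cabs_ceval.
pose Hp z l := cabs z <= 2 -> forall j, cabs (ceval (h j) z - l) <= 4 * half ^+ j.
(* Off the disc |z| <= 2 the value is 0 by convention; likewise for A. *)
have /choice[H hH] : forall z, exists l, Hp z l.
  move=> z; have [z2|nz] := boolP (cabs z <= 2); last by exists 0 => /(negP nz).
  have [|l hl] := lim_poly h 1 z ler01 z2 _.
    move=> j; have [[[_ _ +] _] _ _ _ _] := sol j.
    by rewrite opprB addrA subrK mul1r.
  by exists l => _ j; have := hl j; rewrite mul1r.
pose Ap z l := cabs z <= 2 -> forall j, cabs (ceval (A_ j) z - l) <= 4 * half ^+ j.
have /choice[A hA] : forall z, exists l, Ap z l.
  move=> z; have [z2|nz] := boolP (cabs z <= 2); last by exists 0 => /(negP nz).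
  have [|l hl] := lim_poly A_ 1 z ler01 z2 _.
    move=> j; have [_ [_ _ +] _ _ _] := sol j.
    by rewrite opprB addrA subrK mul1r.
  by exists l => _ j; have := hl j; rewrite mul1r.
pose W_ j := cauchy_value (h j) (A_ j).
pose W z := z * H z * (1 + (eps ^+ 2)%:C%C * (z ^+ 2 * (H z * H z)) * A z).
have gH z : cabs z <= 2 -> geo_lim (fun j => ceval (h j) z) (H z).
  by move=> z2; exists 4 => // j; exact: hH.
have gA z : cabs z <= 2 -> geo_lim (fun j => ceval (A_ j) z) (A z).
  by move=> z2; exists 4 => // j; exact: hA.
have gW z : cabs z <= 2 -> geo_lim (fun j => ceval (W_ j) z) (W z).
  move=> z2; apply: (geo_lim_eq (fun j => z * ceval (h j) z * (1 + (eps ^+ 2)%:C%C *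
      (z ^+ 2 * (ceval (h j) z * ceval (h j) z)) * ceval (A_ j) z))).
    by move=> j; rewrite /W_ /cauchy_value !(cevalM, cevalD, cevalXn, cevalX, cevalC, ceval1).
  have g1 := gH z z2; have g2 := gA z z2.
  by apply: geo_limM; [apply: geo_limM => //; exact: geo_lim_cst
    |apply: geo_limD; [exact: geo_lim_cst|]; apply: geo_limM => //; apply: geo_limM;
     [exact: geo_lim_cst|]; apply: geo_limM; [exact: geo_lim_cst|]; exact: geo_limM].
have hbnd j : near_poly 200^-1 (half ^+ j) (h j - 1) (h j.+1 - 1).
  by have [[+ _] _ _ _ _] := sol j => /near_poly_le; apply.
have n1 : near_poly 1 0 (1 : {poly R}) 1 by apply: near_poly_cst; rewrite nrm1.
have hbnd1 j : near_poly (1 + 200^-1) (half ^+ j) (h j) (h j.+1).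
  have := near_polyD _ _ _ _ _ _ _ _ n1 (hbnd j).
  by rewrite add0r ![1 + _]addrC !subrK.
have Abnd j : near_poly 2 (half ^+ j) (A_ j) (A_ j.+1).
  have [_ hAj _ _ _] := sol j; have := near_polyD _ _ _ _ _ _ _ _ n1 hAj.
  rewrite add0r ![1 + _]addrC !subrK => /near_poly_le; apply=> //.
  by move: tau_small; lra.
exists c, s, W_, H, A, W; split=> //.
- move=> j; split.
    by have [a1 _ _] := hbnd j; have [a2 _ _] := Abnd j; exact: cauchy_value_X.
  by rewrite /W_ /cauchy_value -mulrA coefXM.
- move=> z z2 j.
  have hW i : nrm (W_ i - W_ i.+1) <= 3 * half ^+ i.
    by have [] := cauchy_value_near _ _ _ _ _ (d0 i) (hbnd1 i) (Abnd i).
  (* The constant 12 is the 4 of [lim_poly] times the 3 of [cauchy_value_near]. *)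
  have [l hl] := lim_poly W_ 3 z (ler0n _ _) z2 hW.
  have -> : W z = l.
    apply: (geo_lim_uniq _ _ _ (gW z z2)); exists (4 * 3) => // i.
    by rewrite -mulrA; exact: hl.
  by apply: le_trans (hl j) _; rewrite mulrA; lra.
- move=> z z2; split=> //.
  + apply: (geo_lim_le (fun j => ceval (h j - 1) z)).
      apply: (geo_lim_eq (fun j => ceval (h j) z - 1)).
        by move=> j; rewrite cevalD cevalN ceval1.
      by apply: geo_limB; [exact: gH|exact: geo_lim_cst].
    move=> j; apply: le_trans (cabs_ceval _ _ z2) _.
    by have [] := hbnd j.
  + apply/eqP; rewrite -subr_eq0; apply/eqP.
    have g1 := gH z z2; have g2 := gA z z2.
    apply: (geo_lim0 (fun j => ceval (residual eps (h j - 1) (c_ j)%:P (s_ j)%:P (A_ j)) z) _ 1).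
      apply: (geo_lim_eq (fun j => 1 + z ^+ 2 * ceval (h j) z ^+ 2 * ceval (A_ j) z -
          ((c_ j)%:C%C * z + (1 + (s_ j)%:C%C) * (1 + z ^+ 2)) * ceval (h j) z *
          (1 + (eps ^+ 2)%:C%C * z ^+ 2 * ceval (h j) z ^+ 2 * ceval (A_ j) z))).
        move=> j; rewrite /residual [1 + (h j - 1)]addrC subrK.
        by rewrite !(cevalM, cevalD, cevalN, cevalXn, cevalX, cevalC, ceval1).
      by repeat lazymatch goal with
        | |- geo_lim (fun j => @?u j + @?v j) _ => apply: geo_limD
        | |- geo_lim (fun j => - @?u j) _ => apply: geo_limN
        | |- geo_lim (fun j => @?u j * @?v j) _ => apply: geo_limM
        | |- geo_lim (fun j => @?u j ^+ _) _ => apply: geo_limX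
        | |- _ => first [exact: g1 | exact: g2 | exact: gc | exact: gs | exact: geo_lim_cst]
        end.
    move=> j; rewrite mul1r; apply: le_trans (cabs_ceval _ _ z2) _.
    by have [] := sol j.
  + move=> z1 J; have g1 := gH z z2; have g2 := gA z z2.
    (* The index is shifted by J because [A_ (J + j)] is a sum of J + j + 1 terms: removing the
       first J always leaves j + 1 of them. *)
    apply: (geo_lim_le (fun j => ceval (A_ (J + j)%N) z -
         \sum_(k < J) (a k * eps ^+ k)%:C%C * (z * ceval (h (J + j)%N) z) ^+ k)).
      apply: geo_limB; first exact: (geo_lim_shift (fun j => ceval (A_ j) z)).
      apply: (geo_lim_sum J (fun k j => (a k * eps ^+ k)%:C%C * (z * ceval (h (J + j)%N) z) ^+ k)
        (fun k => (a k * eps ^+ k)%:C%C * (z * H z) ^+ k)) => k; apply: geo_limM; first exact: geo_lim_cst.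
      by apply: geo_limX; apply: geo_limM; [exact: geo_lim_cst | exact: (geo_lim_shift (fun j => ceval (h j) z))].
    move=> j; have [[_ ->] _ _ _ _] := sol (J + j)%N.
    rewrite /tail_poly ceval_sum -addnS big_split_ord /= addrAC.
    have -> : \sum_(i < J) ceval ((a i * eps ^+ i) *: ('X * h (J + j)%N) ^+ i) z =
       \sum_(k < J) (a k * eps ^+ k)%:C%C * (z * ceval (h (J + j)%N) z) ^+ k.
      by apply: eq_bigr => i _; rewrite cevalZ cevalXn cevalM cevalX.
    rewrite subrr add0r; apply: le_trans (cabs_sum _ _ _ _) _.
    have zb : cabs (z * ceval (h (J + j)%N) z) <= 2 * cabs z.
      rewrite cabsM mulrC ler_wpM2r ?cabs_ge0 //; apply: le_trans (cabs_ceval _ _ z2) _.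
      by have [hb _ _] := hbnd1 (J + j)%N; apply: le_trans hb _; lra.
    have y0 : 0 <= 2 * eps * cabs z by rewrite !mulr_ge0 ?cabs_ge0 // ltW.
    have q0 : 0 <= L * (2 * eps * cabs z) by rewrite mulr_ge0 // ltW.
    have q2 : L * (2 * eps * cabs z) <= 2^-1.
      have h3 : L <= L ^+ 3 by rewrite exprS ler_peMr ?(ltW L0) // exprn_ege1.
      have h4 : L * eps <= L ^+ 3 * eps by rewrite ler_pM2r.
      have h5 : L * (2 * eps * cabs z) <= 2 * (L * eps).
        have -> : L * (2 * eps * cabs z) = 2 * (L * eps) * cabs z by ring.
        by rewrite ler_piMr // !mulr_ge0 // ltW.
      move: tau_small h4 h5; rewrite /tau.
      by set y := L * eps; set w := L ^+ 3 * eps; lra.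
    (* With the first remaining bound factored out, the rest is a geometric series of ratio at most
       1/2, whence the factor 2. *)
    apply: (@le_trans _ _ (\sum_(i < j.+1) (L ^+ J.+2 * (2 * eps * cabs z) ^+ J) *
        (L * (2 * eps * cabs z)) ^+ i)).
      apply: ler_sum => i _; rewrite cevalZ cabsM cabs_real cevalXn cevalM cevalX cabsX.
      apply: (@le_trans _ _ (L ^+ (J + i).+2 * eps ^+ (J + i) * (2 * cabs z) ^+ (J + i))).
        apply: ler_pM => //; rewrite ?exprn_ge0 ?cabs_ge0 //.
          rewrite normrM (ger0_norm (exprn_ge0 _ (ltW eps0))).
          by apply: ler_wpM2r; [exact/exprn_ge0/ltW | exact: aL].
        by apply: lerXn2r; rewrite ?nnegrE ?cabs_ge0 // mulr_ge0 ?cabs_ge0.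
      rewrite le_eqVlt; apply/orP; left; apply/eqP.
      by rewrite -[(J + i).+2]/(J.+2 + i)%N !exprMn !exprD; ring.
    have P0 : 0 <= L ^+ J.+2 * (2 * eps * cabs z) ^+ J.
      by apply: mulr_ge0; [exact/exprn_ge0/ltW | exact: exprn_ge0].
    rewrite -mulr_sumr mulrC; apply: ler_wpM2r => //.
    exact: geometric_le2.
- move=> x x2.
  have x2' : cabs (x%:C%C : R[i]) <= 2 by rewrite cabs_real.
  by split; [apply: geo_lim_real (gH _ x2') | apply: geo_lim_real (gA _ x2')] => j; rewrite ceval_real.
Qed.

End solution.

(** * Moments and densities on a compact interval *)

Section support.
Context {R : realType}.
Implicit Types (mu : borel_prob R) (L : R).

(** A Lindelof argument: every point outside the support lies in a null open interval with rational
    end points, and there are countably many such intervals. *)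
Lemma supp_null mu L : supp mu `<=` `[- L, L] -> mu (~` `[- L, L]%classic) = 0%E.
Proof.
move=> hL.
(* [unpickle] enumerates the pairs of rationals; an index that codes no pair, or a pair whose
   interval is not null, yields the empty set. *)
pose F (k : nat) : set R :=
  if @unpickle (rat * rat)%type k is Some ab then
    if mu `]ratr ab.1, ratr ab.2[%classic == 0%E then `]ratr ab.1, ratr ab.2[%classic else set0
  else set0.
have F0 k : mu.-negligible (F k).
  rewrite /F; case: unpickle => [ab|]; last exact: negligible_set0.
  case: eqP => [h|_]; last exact: negligible_set0.
  by apply/negligibleP.
have sub : ~` `[- L, L] `<=` \bigcup_k F k.
  move=> x /= nx; have : ~ supp mu x by move=> /hL.
  move=> /existsNP[U /not_implyP[oU /not_implyP[Ux /negP]]].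
  rewrite lt_neqAle measure_ge0 andbT negbK => /eqP U0.
  have /nbhs_ballP[e /= e0 he] : nbhs x U by exact: open_nbhs_nbhs.
  have [a] := @rat_in_itvoo R (x - e) x ltac:(by rewrite ltrBlDr ltrDl).
  have [b] := @rat_in_itvoo R x (x + e) ltac:(by rewrite ltrDl).
  rewrite !in_itv /= => /andP[b1 b2] /andP[a1 a2].
  have abU : `]ratr a, ratr b[ `<=` U.
    move=> y /=; rewrite in_itv /= => /andP[y1 y2]; apply: he.
    rewrite /ball /= ltr_distlC; apply/andP; split.
      by apply: lt_trans y1.
    by apply: lt_trans y2 _.
  have ab0 : mu `]ratr a, ratr b[%classic = 0%E.
    apply/eqP; rewrite eq_le measure_ge0 andbT U0.
    apply: le_measure => //; rewrite inE //.
    exact: open_measurable.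
  have [k hk] : exists k, @unpickle (rat * rat)%type k = Some (a, b).
    by exists (pickle (a, b)); exact: pickleK.
  exists k; first exact: I.
  have -> : F k = `]ratr a, ratr b[%classic by rewrite /F hk /= ab0 eqxx.
  by rewrite /= in_itv /= a2 b1.
have mI : measurable (~` `[- L, L]%classic : set (measurableTypeR R)).
  exact: measurableC.
apply: (measure_negligible mI).
have nF : mu.-negligible (\bigcup_k F k) by apply: negligible_bigcup; exact: F0.
apply: (negligibleS _ nF). exact: sub.
Qed.

Lemma compact_supp_bounded mu : compact (supp mu) -> exists2 L, 1 <= L & supp mu `<=` `[- L, L].
Proof.
move=> /compact_bounded [M [_ hM]]; exists (Num.max 1 (M + 1)).
  by rewrite le_max lexx.
move=> x /hM h; rewrite /= in_itv /= -ler_norml le_max.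
by apply/orP; right; apply: h; rewrite ltrDl.
Qed.

Lemma moment_itv mu L k : mu (~` `[- L, L]%classic) = 0%E ->
  moment mu k = \int[mu]_(x in `[- L, L]) (x ^+ k).
Proof.
move=> h; rewrite /moment /Rintegral [in RHS]integral_mkcond; congr fine.
have mf : measurable_fun [set: measurableTypeR R] (fun x : R => (x ^+ k)%:E).
  by apply/measurable_EFinP; exact: measurable_funX.
apply: ae_eq_integral => //.
  by apply/(measurable_restrictT _ _).1 => //; exact: measurable_funTS.
exists (~` `[- L, L]%classic); split => //; first exact: measurableC.
move=> x /= nx xL; apply: nx => _.
by rewrite patchE mem_set.
Qed.

Lemma integrable_itv (m : {measure set (measurableTypeR R) -> \bar R}) (a b : R)
    (g : R -> R) (C : R) :
  (m `[a, b]%classic < +oo)%E ->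
  measurable_fun `[a, b]%classic g -> (forall x : R, x \in `[a, b] -> `|g x| <= C) ->
  m.-integrable `[a, b]%classic (EFin \o g).
Proof.
move=> mfin mg hC; apply: measurable_bounded_integrable => //.
exists C; split; first exact: num_real.
by move=> M CM x /= xL; apply: le_trans (hC x xL) (ltW CM).
Qed.

End support.

(** * Polynomials approximating a step *)

Section step_polynomials.
Context {R : realType}.
Implicit Types (a t : R).

Lemma bernoulli a k : -1 <= a -> 1 + k%:R * a <= (1 + a) ^+ k.
Proof.
move=> a1; elim: k => [|k IH]; first by rewrite mul0r addr0.
rewrite exprS; have p : 0 <= 1 + a by lra.
apply: le_trans (ler_wpM2l p IH); rewrite -addn1 natrD.
have : 0 <= k%:R * a ^+ 2 :> R by rewrite mulr_ge0 ?sqr_ge0.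
by rewrite expr2; lra.
Qed.

(* On [0, 1] these polynomials tend to the indicator of t < 1/2, by Bernoulli's
   inequality. *)
Definition step_fun t n := (1 - t ^+ n) ^+ (2 ^ n).

Lemma step_fun_ge0 t n : 0 <= t <= 1 -> 0 <= step_fun t n.
Proof. by move=> /andP[t0 t1]; rewrite exprn_ge0 // subr_ge0 exprn_ile1. Qed.

Lemma step_fun_le1 t n : 0 <= t <= 1 -> step_fun t n <= 1.
Proof.
move=> /andP[t0 t1]; rewrite exprn_ile1 //; first by rewrite subr_ge0 exprn_ile1.
by rewrite lerBlDr lerDl exprn_ge0.
Qed.

Lemma step_fun_lower t n : 0 <= t <= 1 -> 1 - (2 * t) ^+ n <= step_fun t n.
Proof.
move=> /andP[t0 t1]; apply: le_trans (bernoulli (- t ^+ n) (2 ^ n) _).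
  by rewrite mulrN natrX exprMn.
by rewrite lerN2 exprn_ile1.
Qed.

(** Bernoulli's inequality bounds (2 t)^n by (1 + t^n)^(2^n), and the product of this power with the
    step polynomial is (1 - t^(2 n))^(2^n) <= 1. *)
Lemma step_fun_upper t n : 0 < t <= 1 -> step_fun t n <= ((2 * t) ^+ n)^-1.
Proof.
move=> /andP[t0 t1]; have p : 0 < (2 * t) ^+ n by rewrite exprn_gt0 // mulr_gt0.
have a0 : 0 <= t ^+ n by rewrite exprn_ge0 // ltW.
have s0 : 0 <= step_fun t n by apply: step_fun_ge0; rewrite ltW.
rewrite -[X in _ <= X]div1r ler_pdivlMr //.
have h : (2 * t) ^+ n <= (1 + t ^+ n) ^+ (2 ^ n).
  apply: le_trans (bernoulli (t ^+ n) (2 ^ n) _); last by apply: le_trans a0; lra.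
  by rewrite natrX -exprMn lerDr.
apply: le_trans (ler_wpM2l s0 h) _; rewrite /step_fun -exprMn.
have -> : (1 - t ^+ n) * (1 + t ^+ n) = 1 - (t ^+ n) ^+ 2 by ring.
have q : (t ^+ n) ^+ 2 <= 1 by rewrite exprn_ile1 // exprn_ile1 // ltW.
by rewrite exprn_ile1 ?subr_ge0 // lerBlDr lerDl sqr_ge0.
Qed.

Lemma expn_small_le0 (x C r : R) : 0 <= r < 1 -> (forall n, x <= C * r ^+ n) -> x <= 0.
Proof.
move=> /andP[r0 r1] h.
have cv : (fun n => C * r ^+ n) @ \oo --> (0 : R).
  by apply: cvg_geometric; rewrite ger0_norm.
by rewrite -(cvg_lim _ cv) //; apply: limr_ge; [apply: cvgP cv | exact: nearW].
Qed.

End step_polynomials.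

(** * Integrals with a bounded weight *)

Section weighted_integrals.
Context {R : realType} (a b : R).
Local Notation D := (`[a, b]%classic : set (measurableTypeR R)).

Definition bmeas (g : R -> R) :=
  measurable_fun D g /\ exists C : R, forall x : R, x \in `[a, b] -> `|g x| <= C.

Lemma bmeas_cst c : bmeas (fun=> c).
Proof. by split; [exact: measurable_cst | exists `|c|]. Qed.

Lemma bmeas_id : bmeas id.
Proof.
split; first exact: measurable_id.
exists (Num.max `|a| `|b|) => x; rewrite in_itv /= le_max => /andP[ax xb].
have [x0|x0] := leP 0 x; apply/orP.
  by right; rewrite ger0_norm // (le_trans xb) // ler_norm.
left; rewrite ltr0_norm //; apply: (@le_trans _ _ (- a)); first by rewrite lerN2.
by rewrite -normrN ler_norm.
Qed.

Lemma bmeasD f g : bmeas f -> bmeas g -> bmeas (fun x => f x + g x).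
Proof.
move=> [mf [C hC]] [mg [C' hC']]; split; first exact: measurable_funD.
by exists (C + C') => x xB; apply: le_trans (ler_normD _ _) _; rewrite lerD ?hC ?hC'.
Qed.

Lemma bmeasM f g : bmeas f -> bmeas g -> bmeas (fun x => f x * g x).
Proof.
move=> [mf [C hC]] [mg [C' hC']]; split; first exact: measurable_funM.
by exists (C * C') => x xB; rewrite normrM ler_pM ?hC ?hC'.
Qed.

Lemma bmeas_horner (p : {poly R}) : bmeas (fun x => p.[x]).
Proof.
elim/poly_ind: p => [|p c IH].
  by have -> : (fun x => (0 : {poly R}).[x]) = (fun=> 0); [apply/funext => x; rewrite horner0 | exact: bmeas_cst].
have -> : (fun x => (p * 'X + c%:P).[x]) = (fun x => p.[x] * x + c).
  by apply/funext => x; rewrite hornerMXaddC.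
by apply: bmeasD; [apply: bmeasM => //; exact: bmeas_id | exact: bmeas_cst].
Qed.

Lemma bmeas_le s : bmeas (fun x => (x <= s)%R%:R).
Proof.
split; last by exists 1 => x _; case: (x <= s); rewrite ?normr1 ?normr0.
have -> : (fun x => (x <= s)%R%:R) = \1_(`]-oo, s]%classic) :> (R -> R).
  by apply/funext => x; rewrite indicE; congr (_%:R); rewrite mem_setE in_itv.
by apply: measurable_funTS; exact: measurable_indic.
Qed.

Context (m : {measure set (measurableTypeR R) -> \bar R}) (w : R -> R).
Hypothesis mfin : (m D < +oo)%E.
Hypothesis bw : bmeas w.
Hypothesis w_ge0 : forall x : R, x \in `[a, b] -> 0 <= w x.

(** Measure and weight are kept apart so that the same rules serve [nu] with weight 1 and Lebesgue
    measure weighted by a density, by a Poisson kernel or by a Cauchy kernel times a density. *)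
Definition wint (g : R -> R) := \int[m]_(x in D) (g x * w x).

Lemma wint_integrable g : bmeas g -> m.-integrable D (fun x => (g x * w x)%:E).
Proof.
move=> bg; have [mgw [C hC]] := bmeasM _ _ bg bw.
exact: (integrable_itv m a b (fun x => g x * w x) C).
Qed.

Lemma wint_le f g : bmeas f -> bmeas g ->
  (forall x : R, x \in `[a, b] -> f x <= g x) -> wint f <= wint g.
Proof.
move=> bf bg h; apply: le_Rintegral => //; try exact: wint_integrable.
by move=> x xB; rewrite ler_wpM2r ?w_ge0 ?h.
Qed.

Lemma wintD f g : bmeas f -> bmeas g -> wint (fun x => f x + g x) = wint f + wint g.
Proof.
move=> bf bg; rewrite /wint -RintegralD //; try exact: wint_integrable.
by apply: eq_Rintegral => x _; rewrite mulrDl.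
Qed.

Lemma wintZ c f : bmeas f -> wint (fun x => c * f x) = c * wint f.
Proof.
move=> bf; rewrite /wint -RintegralZl //; try exact: wint_integrable.
by apply: eq_Rintegral => x _; rewrite mulrA.
Qed.

Lemma wint_ge0 f : (forall x : R, x \in `[a, b] -> 0 <= f x) -> 0 <= wint f.
Proof.
by move=> h; apply: Rintegral_ge0 => x xB; rewrite mulr_ge0 ?w_ge0 ?h.
Qed.

Lemma wint_horner (p : {poly R}) : wint (fun x => p.[x]) =
  \sum_(i < size p) p`_i * wint (fun x => x ^+ i).
Proof.
rewrite -{1}[p]coefK poly_def.
have bX i : bmeas (fun x => x ^+ i).
  have -> : (fun x => x ^+ i) = (fun x => ('X^i : {poly R}).[x]); last exact: bmeas_horner.
  by apply/funext => x; rewrite hornerXn.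
elim: (size p) => [|n IH].
  rewrite !big_ord0; have -> : (fun x => (0 : {poly R}).[x]) = (fun x => 0 * x).
    by apply/funext => x; rewrite horner0 mul0r.
  by rewrite wintZ ?mul0r //; exact: bmeas_id.
rewrite !big_ord_recr /= -IH -wintZ // -wintD; last 2 first.
- exact: bmeas_horner.
- by apply: bmeasM => //; exact: bmeas_cst.
by congr wint; apply/funext => x; rewrite hornerD hornerZ hornerXn.
Qed.

End weighted_integrals.

(** * Comparing distribution functions through moments *)

Section cdf_comparison.
Context {R : realType} (B : R).
Local Notation D := (`[- B, B]%classic : set (measurableTypeR R)).
Context (m1 m2 : {measure set (measurableTypeR R) -> \bar R}) (w1 w2 : R -> R).
Hypothesis m1fin : (m1 D < +oo)%E.
Hypothesis m2fin : (m2 D < +oo)%E.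
Hypothesis bw1 : bmeas (- B) B w1.
Hypothesis bw2 : bmeas (- B) B w2.
Hypothesis w1_ge0 : forall x : R, x \in `[- B, B] -> 0 <= w1 x.
Hypothesis w2_ge0 : forall x : R, x \in `[- B, B] -> 0 <= w2 x.
Hypothesis same_moments : forall k,
  wint (- B) B m1 w1 (fun x => x ^+ k) = wint (- B) B m2 w2 (fun x => x ^+ k).

Definition wcdf (m : {measure set (measurableTypeR R) -> \bar R}) w s :=
  wint (- B) B m w (fun x => (x <= s)%R%:R).

(** The gap between s and s' leaves room for a polynomial that is nearly 1 to the left of s and
    nearly 0 to the right of s'; its two integrals agree. The hypotheses are symmetric in the two
    measures, so the reverse comparison follows too. *)
Lemma wcdf_le s s' : s < s' -> wcdf m1 w1 s <= wcdf m2 w2 s'.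
Proof.
move=> ss'.
(* H exceeds |x - s0| on [-B, B], so t = 1/2 + (x - s0) / (2 H) maps the interval into [0, 1] and s0
   to 1/2. The margin y is how far 2 t stays from 1 outside ]s, s'[, and r = 1 / (1 + y) is the
   resulting rate. *)
pose s0 := (s + s') / 2; pose H := `|B| + `|s| + `|s'| + 1.
have H0 : 0 < H by rewrite /H ltr_wpDl // !addr_ge0.
pose y := (s' - s) / (2 * H).
have y0 : 0 < y by rewrite divr_gt0 ?subr_gt0 ?mulr_gt0.
have y1 : y <= 1.
  rewrite /y ler_pdivrMr ?mulr_gt0 // mul1r /H.
  by have := ler_norm (s' - s); have := ler_normB s' s; have := normr_ge0 B;
    have := normr_ge0 s; have := normr_ge0 s'; lra.
pose r := (1 + y)^-1.
have r01 : 0 <= r < 1.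
  by rewrite invr_ge0 invf_lt1; [apply/andP; split; lra | lra].
pose t x := 2^-1 + (x - s0) / (2 * H).
have t01 x : x \in `[- B, B] -> 0 <= t x <= 1.
  rewrite in_itv /= => /andP[b1 b2].
  have : `|(x - s0) / (2 * H)| <= 2^-1.
    rewrite normrM normfV (ger0_norm (_ : 0 <= 2 * H)) ?mulr_ge0 ?(ltW H0) //.
    rewrite ler_pdivrMr ?mulr_gt0 // mulrA mulVf ?mul1r ?pnatr_eq0 //.
    have e1 : `|x| <= `|B| by rewrite ler_norml; have := ler_norm B; lra.
    have e2 : `|s0| <= `|s| + `|s'|.
      rewrite /s0 normrM normfV (ger0_norm (_ : 0 <= 2)) //.
      by have := ler_normD s s'; have := normr_ge0 s; have := normr_ge0 s'; lra.
    by have := ler_normB x s0; rewrite /H; lra.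
  by rewrite ler_norml /t => /andP[c1 c2]; apply/andP; split; lra.
have H20 : 2 * H != 0 by rewrite gt_eqF // mulr_gt0.
have tlow x : x <= s -> 2 * t x <= r.
  move=> xs; apply: (@le_trans _ _ (1 - y)).
    have -> : 2 * t x = 1 + 2 * ((x - s0) / (2 * H)) by rewrite /t; field; rewrite gt_eqF.
    have k0 : 0 <= (2 * H)^-1 by rewrite invr_ge0 mulr_ge0 // ltW.
    have h : 0 <= (s0 * 2 - 2 * x - (s' - s)) * (2 * H)^-1.
      by apply: mulr_ge0 => //; rewrite /s0; lra.
    by rewrite /y; lra.
  rewrite /r -[X in _ <= X]div1r ler_pdivlMr; last by lra.
  by nra.
have thigh x : s' <= x -> (1 + y) <= 2 * t x.
  move=> xs; have -> : 2 * t x = 1 + 2 * ((x - s0) / (2 * H)) by rewrite /t; field; rewrite gt_eqF.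
  have k0 : 0 <= (2 * H)^-1 by rewrite invr_ge0 mulr_ge0 // ltW.
  have h : 0 <= (2 * x - s0 * 2 - (s' - s)) * (2 * H)^-1.
    by apply: mulr_ge0 => //; rewrite /s0; lra.
  by rewrite /y; lra.
pose T : {poly R} := (2^-1 - s0 / (2 * H))%:P + (2 * H)^-1 *: 'X.
pose q n : {poly R} := (1 - T ^+ n) ^+ (2 ^ n).
have qE n x : (q n).[x] = step_fun (t x) n.
  rewrite /q /step_fun horner_exp hornerD hornerN horner_exp hornerC hornerD hornerC hornerZ hornerX.
  by rewrite /t; congr ((1 - _ ^+ _) ^+ _); ring.
have Q n : wint (- B) B m1 w1 (fun x => (q n).[x]) = wint (- B) B m2 w2 (fun x => (q n).[x]).
  by rewrite !wint_horner //; apply: eq_bigr => i _; rewrite same_moments.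
pose one2 := wint (- B) B m2 w2 (fun=> 1).
suff key n : wcdf m1 w1 s - wcdf m2 w2 s' <= (one2 + wcdf m1 w1 s) * r ^+ n.
  by rewrite -subr_le0; apply: (expn_small_le0 _ _ _ r01 key).
have lo : (1 - r ^+ n) * wcdf m1 w1 s <= wint (- B) B m1 w1 (fun x => (q n).[x]).
  rewrite /wcdf -wintZ //; last exact: bmeas_le.
  apply: wint_le => //.
  - by apply: bmeasM; [exact: bmeas_cst | exact: bmeas_le].
  - exact: bmeas_horner.
  move=> x xB; rewrite qE; have tx := t01 x xB; case: (leP x s) => xs; last by rewrite mulr0 step_fun_ge0.
  rewrite mulr1; apply: le_trans (step_fun_lower _ n tx); rewrite lerD2l lerN2.
  apply: lerXn2r; rewrite ?nnegrE ?tlow //; first by rewrite mulr_ge0 //; case/andP: tx.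
  by case/andP: r01.
have up : wint (- B) B m2 w2 (fun x => (q n).[x]) <= wcdf m2 w2 s' + r ^+ n * one2.
  rewrite /wcdf -wintZ //; last exact: bmeas_cst.
  rewrite -wintD //; [|exact: bmeas_le|by apply: bmeasM; exact: bmeas_cst].
  apply: wint_le => //; first exact: bmeas_horner.
    by apply: bmeasD; [exact: bmeas_le|apply: bmeasM; exact: bmeas_cst].
  move=> x xB; rewrite qE mulr1; have tx := t01 x xB.
  have rn0 : 0 <= r ^+ n by rewrite exprn_ge0 //; case/andP: r01.
  case: (leP x s') => xs.
    by apply: le_trans (step_fun_le1 _ n tx) _; rewrite lerDl.
  rewrite add0r; have tp := thigh x (ltW xs).
  have tx' : 0 < t x <= 1 by case/andP: tx => _ ->; rewrite andbT; lra.
  apply: le_trans (step_fun_upper _ n tx') _.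
  rewrite /r exprVn lef_pV2 ?posrE ?exprn_gt0 //; try lra.
  by apply: lerXn2r; rewrite ?nnegrE //; lra.
by move: lo up; rewrite (Q n); lra.
Qed.

End cdf_comparison.

Definition density_measure {R : realType} (p : R -> R) :
    set (measurableTypeR R) -> \bar R :=
  fun A => (\int[lebesgue_measure]_(x in A) (p x)%:E)%E.

Section density_measure.
Context {R : realType} (p : R -> R).
Hypothesis mp : measurable_fun [set: measurableTypeR R] p.
Hypothesis p_ge0 : forall x, 0 <= p x.

Let density0 : density_measure p set0 = 0%E.
Proof. by rewrite /density_measure integral_set0. Qed.

Let density_ge0 A : (0 <= density_measure p A)%E.
Proof. by apply: integral_ge0 => x _; rewrite lee_fin. Qed.

Let density_sigma_additive : semi_sigma_additive (density_measure p).
Proof.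
move=> /= A mA tA mUA; rewrite /density_measure ge0_integral_bigcup //=; last 2 first.
- by apply/measurable_EFinP; exact: measurable_funTS.
- by move=> x _; rewrite lee_fin.
by apply: is_cvg_ereal_nneg_natsum_cond => n _ _; exact: density_ge0.
Qed.

HB.instance Definition _ := isMeasure.Build _ _ _
  (density_measure p) density0 density_ge0 density_sigma_additive.

Lemma eq_density_measure (nu : borel_prob R) :
  (forall a b : R, a <= b -> nu `]a, b]%classic = density_measure p `]a, b]%classic) ->
  is_density nu p.
Proof.
move=> h; split => // A mA; rewrite -[RHS]/(density_measure p A).
have uniq := measure_unique (@ocitv R : set (set (measurableTypeR R)))
  (fun k : nat => `](- k%:R), k%:R]%classic).
apply: (uniq _ _ _ _ _ nu (density_measure p)) => //.
- exact: ocitvI.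
- by move=> k; exact: is_ocitv.
- rewrite -subTset => x _.
  have hb := archi_boundP (normr_ge0 x); exists (Num.bound `|x|) => //=.
  rewrite in_itv /=; apply/andP; split; last by rewrite (le_trans (ler_norm x)) // ltW.
  by rewrite ltrNl (le_lt_trans _ hb) // -normrN ler_norm.
- move=> _ [[a b] _ <-] /=; have [ab|ba] := leP a b; first exact: h.
  by rewrite set_itv_ge ?measure0 // bnd_simp -leNgt ltW.
- by move=> k; rewrite (le_lt_trans (probability_le1 _ _)) // ltry.
Qed.

End density_measure.

(** * A bounded density is determined by its moments *)

Section moments_determine_density.
Context {R : realType} (nu : borel_prob R) (p : R -> R) (B P : R).
Local Notation D := (`[- B, B]%classic : set (measurableTypeR R)).
Hypothesis nuD : nu (~` D) = 0%E.
Hypothesis mp : measurable_fun [set: measurableTypeR R] p.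
Hypothesis p_ge0 : forall x, 0 <= p x.
Hypothesis p_le : forall x, p x <= P.
Hypothesis p_out : forall x : R, x \notin `[- B, B] -> p x = 0.
Hypothesis same_moments : forall k,
  moment nu k = \int[lebesgue_measure]_(x in D) (x ^+ k * p x).

Let w1 : R -> R := fun=> 1.
Let nu_fin : (nu D < +oo)%E.
Proof. by rewrite (le_lt_trans (probability_le1 _ _)) // ltry. Qed.
Let leb_fin : (lebesgue_measure D < +oo)%E.
Proof. by rewrite lebesgue_measure_itv /=; case: ifP => _; rewrite ?ltry // -EFinD ltry. Qed.
Let bw1 : bmeas (- B) B w1. Proof. exact: bmeas_cst. Qed.
Let bp : bmeas (- B) B p.
Proof.
split; first exact: measurable_funTS.
by exists P => x _; rewrite ger0_norm.
Qed.
Let w1_ge0 (x : R) : x \in `[- B, B] -> 0 <= w1 x. Proof. by []. Qed.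
Let p_ge0' (x : R) : x \in `[- B, B] -> 0 <= p x. Proof. by []. Qed.

Let same k : wint (- B) B nu w1 (fun x => x ^+ k) = wint (- B) B lebesgue_measure p (fun x => x ^+ k).
Proof.
rewrite /wint -same_moments (moment_itv _ _ k nuD).
by apply: eq_Rintegral => x _; rewrite mulr1.
Qed.

Let F1 := wcdf B nu w1.
Let F2 := wcdf B lebesgue_measure p.

Let F12 s s' : s < s' -> F1 s <= F2 s'.
Proof. exact: wcdf_le. Qed.

Let F21 s s' : s < s' -> F2 s <= F1 s'.
Proof. by apply: wcdf_le => // k; rewrite same. Qed.

(** The bound P on the density makes [F2] Lipschitz; this closes the gap between s and s' that [F12]
    and [F21] leave open. *)
Let F2_lip s s' : s <= s' -> F2 s' <= F2 s + P * (s' - s).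
Proof.
move=> ss'.
have P0 : 0 <= P by exact: le_trans (p_ge0 0) (p_le 0).
have bI : bmeas (- B) B (fun x => (x <= s')%R%:R + - 1 * (x <= s)%R%:R).
  by apply: bmeasD; [exact: bmeas_le | apply: bmeasM; [exact: bmeas_cst | exact: bmeas_le]].
have -> : F2 s' = F2 s + wint (- B) B lebesgue_measure p (fun x => (x <= s')%R%:R + - 1 * (x <= s)%R%:R).
  rewrite wintD // ?wintZ //; first by rewrite /F2 /wcdf; lra.
  - exact: bmeas_le.
  - exact: bmeas_le.
  - by apply: bmeasM; [exact: bmeas_cst | exact: bmeas_le].
rewrite lerD2l.
have indE x : (x <= s')%R%:R + - 1 * (x <= s)%R%:R = \1_(`]s, s']%classic) x :> R.
  rewrite indicE mem_setE in_itv /=; case: (leP x s) => xs.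
    by rewrite (le_trans xs ss') /= mulr1 subrr.
  by rewrite mulr0 addr0.
apply: (@le_trans _ _ (\int[lebesgue_measure]_(x in D) (P * \1_(`]s, s']%classic) x))).
  apply: le_Rintegral => //.
  - exact: wint_integrable.
  - apply: (integrable_itv lebesgue_measure (- B) B (fun x => P * \1_(`]s, s']%classic) x) P leb_fin).
      by apply: measurable_funM; [exact: measurable_cst|apply: measurable_funTS; exact: measurable_indic].
    move=> x _; rewrite normrM ger0_norm // ler_piMr // indicE.
    by case: (_ \in _); rewrite ?normr1 ?normr0.
  - move=> x _; rewrite indE mulrC ler_wpM2r // indicE.
have iI : lebesgue_measure.-integrable D (EFin \o \1_(`]s, s']%classic)).
  apply: (integrable_itv lebesgue_measure (- B) B (\1_(`]s, s']%classic)) 1 leb_fin).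
    by apply: measurable_funTS; exact: measurable_indic.
  by move=> x _; rewrite indicE; case: (_ \in _); rewrite ?normr1 ?normr0.
rewrite RintegralZl // ler_wpM2l //.
rewrite /Rintegral integral_indic //.
have le1 : (lebesgue_measure (`]s, s']%classic `&` D) <= (s' - s)%:E)%E.
  apply: (@le_trans _ _ (lebesgue_measure `]s, s']%classic)).
    by apply: le_measure; rewrite ?inE //; exact: measurableI.
  by rewrite lebesgue_measure_itv /= lte_fin; case: ltP => // _; rewrite lee_fin subr_ge0.
rewrite -lee_fin fineK //; apply/fin_numPlt; rewrite (le_lt_trans le1) ?ltry // andbT.
exact: lt_le_trans (ltNyr _) (measure_ge0 _ _).
Qed.

Let F_eq s : F1 s = F2 s.
Proof.
have P0 : 0 <= P by exact: le_trans (p_ge0 0) (p_le 0).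
apply/eqP; rewrite eq_le; apply/andP; split; apply/ler_addgt0Pr => e e0.
  pose d := e / (P + 1); have d0 : 0 < d by rewrite divr_gt0 // ltr_wpDl.
  have sd : s < s + d by rewrite ltrDl.
  apply: le_trans (F12 _ _ sd) _; apply: le_trans (F2_lip _ _ (ltW sd)) _.
  rewrite lerD2l addrAC subrr add0r /d mulrCA ler_piMr ?(ltW e0) //.
  by rewrite ler_pdivrMr ?mul1r ?lerDl // ltr_wpDl.
pose d := e / (P + 1); have d0 : 0 < d by rewrite divr_gt0 // ltr_wpDl.
have sd : s - d < s by rewrite ltrBlDr ltrDl.
apply: le_trans (F2_lip _ _ (ltW sd)) _; apply: lerD; first exact: F21.
rewrite opprB addrCA subrr addr0 /d mulrCA ler_piMr ?(ltW e0) //.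
by rewrite ler_pdivrMr ?mul1r ?lerDl // ltr_wpDl.
Qed.

Lemma moments_determine_density : is_density nu p.
Proof.
apply: eq_density_measure => // a b ab.
have indE x : (x <= b)%R%:R + - 1 * (x <= a)%R%:R = \1_(`]a, b]%classic) x :> R.
  rewrite indicE mem_setE in_itv /=; case: (leP x a) => xa.
    by rewrite (le_trans xa ab) /= mulr1 subrr.
  by rewrite mulr0 addr0.
have split_F (m : {measure set (measurableTypeR R) -> \bar R}) w : (m D < +oo)%E -> bmeas (- B) B w ->
    wcdf B m w b - wcdf B m w a = wint (- B) B m w (\1_(`]a, b]%classic)).
  move=> mf bw; have -> : \1_(`]a, b]%classic) = (fun x => (x <= b)%R%:R + - 1 * (x <= a)%R%:R) :> (R -> R).
    by apply/funext => x; rewrite indE.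
  rewrite wintD // ?wintZ //; first by rewrite /wcdf; lra.
  - exact: bmeas_le.
  - exact: bmeas_le.
  - by apply: bmeasM; [exact: bmeas_cst | exact: bmeas_le].
have E : wint (- B) B nu w1 (\1_(`]a, b]%classic)) = wint (- B) B lebesgue_measure p (\1_(`]a, b]%classic)).
  by rewrite -!split_F //; rewrite -/F1 -/F2 -/(F1 b) -/(F1 a) -/(F2 b) -/(F2 a) !F_eq.
have bI : bmeas (- B) B (\1_(`]a, b]%classic) : R -> R).
  split; first by apply: measurable_funTS; exact: measurable_indic.
  by exists 1 => x _; rewrite indicE; case: (_ \in _); rewrite ?normr1 ?normr0.
have finE (m : {measure set (measurableTypeR R) -> \bar R}) w : (m D < +oo)%E -> bmeas (- B) B w ->
    (wint (- B) B m w (\1_(`]a, b]%classic)))%:E = (\int[m]_(x in D) (\1_(`]a, b]%classic) x * w x)%:E)%E.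
  move=> mf bw; rewrite /wint /Rintegral fineK //.
  by apply: integrable_fin_num => //; exact: wint_integrable.
have L1 : nu `]a, b]%classic = (wint (- B) B nu w1 (\1_(`]a, b]%classic)))%:E.
  rewrite finE //; under eq_integral do rewrite mulr1.
  rewrite integral_indic //; apply/eqP; rewrite eq_le; apply/andP; split; last first.
    by apply: le_measure; rewrite ?inE //; exact: measurableI.
  (* [wint] sees only the part of ]a, b] inside [-B, B]; the rest is null by [nuD]. *)
  apply: (@le_trans _ _ (nu ((`]a, b]%classic `&` D) `|` ~` D))).
    apply: le_measure; rewrite ?inE //.
      by apply: measurableU; [exact: measurableI | exact: measurableC].
    by move=> x xI; have [xD|xD] := pselect (D x); [left | right].
  apply: le_trans (measureU2 _ _ _) _; [exact: measurableI | exact: measurableC |].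
  by rewrite [X in (_ + X)%E]nuD adde0.
have L2 : density_measure p `]a, b]%classic = (wint (- B) B lebesgue_measure p (\1_(`]a, b]%classic)))%:E.
  rewrite finE // /density_measure integral_mkcond [in RHS]integral_mkcond.
  apply: eq_integral => x _; rewrite !patchE.
  case: (boolP (x \in D)) => xD; last first.
    case: ifP => // _; rewrite p_out //.
    by move: xD; rewrite mem_setE.
  rewrite indicE; case: (boolP (x \in _)) => xI; first by rewrite mul1r.
  by rewrite mul0r.
by rewrite L1 L2 E.
Qed.

End moments_determine_density.

(** * Density from boundary values *)

Section trigonometry.
Context {R : realType}.
Implicit Types (x y : R).

Lemma sin_lipschitz x y : `|sin x - sin y| <= `|x - y|.
Proof.
wlog yx : x y / y <= x.
  by move=> h; have [/h//|/ltW/h] := leP y x; rewrite distrC [X in _ <= X]distrC.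
have [|c _ ->] := @MVT_segment R (@sin R) (@cos R) y x yx (fun z _ => is_derive_sin z).
  by apply: continuous_subspaceT => z; exact: continuous_sin.
by rewrite normrM ler_piMl // ler_norml cos_geN1 cos_le1.
Qed.

Lemma sin_nat_le k x : `|sin (k%:R * x)| <= k%:R * `|sin x|.
Proof.
elim: k => [|k IH]; first by rewrite !mul0r sin0 normr0.
rewrite -addn1 natrD !mulrDl !mul1r sinD; apply: le_trans (ler_normD _ _) _.
apply: lerD.
  rewrite normrM; apply: le_trans IH; rewrite ler_piMr //.
  by rewrite ler_norml cos_geN1 cos_le1.
by rewrite normrM ler_piMl // ler_norml cos_geN1 cos_le1.
Qed.

Lemma sin_nat_pi k : sin (k%:R * pi) = 0 :> R.
Proof.
have := sin_nat_le k pi; rewrite sinpi normr0 mulr0 normr_le0 => /eqP //.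
Qed.

Definition eit x : R[i] := (cos x +i* sin x)%C.

Lemma cabs_eit x : cabs (eit x) = 1.
Proof. by rewrite /cabs normc_def /= cos2Dsin2 sqrtr1. Qed.

Lemma eitX x k : eit x ^+ k = eit (k%:R * x).
Proof.
elim: k => [|k IH]; first by rewrite expr0 mul0r /eit cos0 sin0.
rewrite exprS IH -addn1 natrD mulrDl mul1r /eit cosD sinD.
by apply/eqP; rewrite eq_complex /=; apply/andP; split; apply/eqP; ring.
Qed.

Lemma Im_sum (I : Type) (r : seq I) (F : I -> R[i]) :
  complex.Im (\sum_(i <- r) F i) = \sum_(i <- r) complex.Im (F i).
Proof. by elim/big_rec2: _ => // i a b _ <-; rewrite ImD. Qed.

Lemma Im_ceval_eit (p : {poly R}) x :
  complex.Im (ceval p (eit x)) = \sum_(i < size p) p`_i * sin (i%:R * x).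
Proof.
rewrite cevalE Im_sum; apply: eq_bigr => i _; rewrite eitX.
by rewrite /= mul0r addr0.
Qed.

(** The frequency i gives the i-th term its Lipschitz constant, and the weight 2^i of [nrm] absorbs
    it. *)
Lemma sin_series_lipschitz (p : {poly R}) x y :
  `|complex.Im (ceval p (eit x)) - complex.Im (ceval p (eit y))| <= nrm p * `|x - y|.
Proof.
rewrite !Im_ceval_eit -sumrB /nrm mulr_suml; apply: le_trans (ler_norm_sum _ _ _) _.
apply: ler_sum => i _; rewrite -mulrBr normrM -mulrA ler_wpM2l //.
apply: le_trans (sin_lipschitz _ _) _; rewrite -mulrBr normrM ler_wpM2r //.
by rewrite normr_nat; exact: nat_le_exp2.
Qed.

Lemma sin_series_le (p : {poly R}) x :
  `|complex.Im (ceval p (eit x))| <= nrm p * `|sin x|.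
Proof.
rewrite Im_ceval_eit /nrm mulr_suml; apply: le_trans (ler_norm_sum _ _ _) _.
apply: ler_sum => i _; rewrite normrM -mulrA ler_wpM2l //.
by apply: le_trans (sin_nat_le _ _) _; rewrite ler_wpM2r // nat_le_exp2.
Qed.

Lemma integral_derivative (a b : R) (f F : R -> R) : a < b -> continuous f ->
  (forall x, is_derive x 1 F (f x)) ->
  \int[lebesgue_measure]_(x in `[a, b]) f x = F b - F a.
Proof.
move=> ab cf dF; rewrite /Rintegral (@continuous_FTC2 R f F a b) //.
- exact: continuous_subspaceT.
- have cF : continuous F.
    by move=> x; apply/differentiable_continuous/derivable1_diffP; have [] := dF x.
  split; first by move=> x _; have [] := dF x.
  + by apply: cvg_at_right_filter; exact: cF.
  + by apply: cvg_at_left_filter; exact: cF.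
- by move=> x _; rewrite derive1E; exact: derive_val.
Qed.

Lemma continuous_sin_lin (k : R) : continuous (fun x => sin (k * x)).
Proof.
move=> x; apply: (cvg_comp (fun y => k * y) sin); first exact: mulrl_continuous.
exact: continuous_sin.
Qed.

Lemma is_derive_sin_lin (k x : R) :
  is_derive x 1 (fun y => sin (k * y)) (k * cos (k * x)).
Proof.
have h1 : is_derive x 1 (fun y : R => k * y) k.
  by apply: is_derive_eq (is_deriveZ k (is_derive_id x 1)) _; rewrite /GRing.scale /= mulr1.
have h := is_derive1_comp (is_derive_sin (k * x)) h1.
by apply: is_derive_eq h _; rewrite mulrC.
Qed.

Lemma integral_sin_sin k : (0 < k)%N ->
  \int[lebesgue_measure]_(x in `[0, pi]) (sin (k%:R * x) * sin x) =
    if k == 1%N then pi / 2 else 0 :> R.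
Proof.
have sin2E (a b : R) : sin a * sin b = 2^-1 * (cos (a - b) - cos (a + b)).
  by rewrite cosB cosD; field.
have cf (k' : nat) : continuous (fun x : R => sin (k'%:R * x) * sin x).
  by move=> x; apply: cvgM; [exact: continuous_sin_lin | exact: continuous_sin].
case: k => // -[|k] _ /=.
  pose F (x : R) := 2^-1 * x + (- 4^-1) * sin (2 * x).
  have dF (x : R) : is_derive x 1 F (sin (1%:R * x) * sin x).
    apply: is_derive_eq (is_deriveD (is_deriveZ 2^-1 (is_derive_id x 1)) (is_deriveZ (- 4^-1) (is_derive_sin_lin 2 x))) _.
    rewrite mul1r sin2E subrr cos0 /GRing.scale /=.
    have -> : x + x = 2 * x by ring.
    by field.
  rewrite (@integral_derivative _ _ _ F (pi_gt0 R) (cf 1%N) dF).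
  by rewrite /F (sin_nat_pi 2) !mulr0 sin0 mulr0 !addr0 subr0 mulrC.
have [p pE] : exists p : R, p = k.+1%:R by exists k.+1%:R.
have [q qE] : exists q : R, q = k.+3%:R by exists k.+3%:R.
have p0 : p != 0 by rewrite pE pnatr_eq0.
have q0 : q != 0 by rewrite qE pnatr_eq0.
pose F (x : R) := (2^-1 / p) * sin (p * x) + (- (2^-1 / q)) * sin (q * x).
have dF (x : R) : is_derive x 1 F (sin (k.+2%:R * x) * sin x).
  apply: is_derive_eq (is_deriveD (is_deriveZ _ (is_derive_sin_lin p x)) (is_deriveZ _ (is_derive_sin_lin q x))) _.
  rewrite sin2E /GRing.scale /=.
  have -> : k.+2%:R * x - x = p * x by rewrite pE -[k.+2]addn1 natrD; ring.
  have -> : k.+2%:R * x + x = q * x by rewrite qE -[k.+3]addn1 natrD; ring.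
  by field; rewrite p0 q0.
rewrite (@integral_derivative _ _ _ F (pi_gt0 R) (cf k.+2) dF).
by rewrite /F pE qE !sin_nat_pi !mulr0 sin0 !mulr0 addr0 subr0.
Qed.

End trigonometry.

(** * The conjugate Poisson kernel *)

Section poisson_kernel.
Context {R : realType} (u : R).
Hypothesis u0 : 0 < u.
Hypothesis u_half : u <= 2^-1.
Notation leb := (@lebesgue_measure R).

Let d : R := u + u^-1.
Let d_ge : 5 / 2 <= d.
Proof.
have h : (u * u^-1) = 1 by rewrite divff // gt_eqF.
have v2 : 2 <= u^-1 by rewrite -[2]invrK lef_pV2 ?posrE ?invr_gt0.
by rewrite /d; nra.
Qed.

(** The conjugate Poisson kernel, the sum of u^k sin(k x) over k >= 1. *)
Definition poisson (x : R) : R := sin x / (u + u^-1 - 2 * cos x).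

Lemma poisson_den x : 2^-1 <= u + u^-1 - 2 * cos x.
Proof. by have := d_ge; rewrite /d; have := cos_le1 x; lra. Qed.

Lemma continuous_poisson : continuous poisson.
Proof.
move=> x; apply: cvgM; first exact: continuous_sin.
apply: cvgV; first by rewrite gt_eqF // (lt_le_trans _ (poisson_den x)).
apply: cvgB; first exact: cvg_cst.
by apply: cvgM; [exact: cvg_cst | exact: continuous_cos].
Qed.

Lemma poisson_ge0 x : x \in `[0, pi] -> 0 <= poisson x.
Proof.
rewrite in_itv /= => /sin_ge0_pi h; rewrite mulr_ge0 // invr_ge0.
by apply: le_trans (poisson_den x).
Qed.

Lemma bmeas_continuous (a b C : R) f : continuous f -> (forall x, `|f x| <= C) -> bmeas a b f.
Proof.
move=> cf hC; split; last by exists C.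
apply: measurable_funTS; exact: continuous_measurable_fun.
Qed.

Lemma bmeas_poisson : bmeas 0 pi poisson.
Proof.
apply: (bmeas_continuous _ _ 2); first exact: continuous_poisson.
move=> x; rewrite /poisson normrM normfV; have h := poisson_den x.
rewrite [X in _ / X]ger0_norm; last by lra.
rewrite ler_pdivrMr; last by lra.
have : `|sin x| <= 1 by rewrite ler_norml sin_geN1 sin_le1.
by lra.
Qed.

Lemma bmeas_sin k : bmeas 0 pi (fun x : R => sin (k%:R * x)).
Proof.
apply: (bmeas_continuous _ _ 1); last by move=> x; rewrite ler_norml sin_geN1 sin_le1.
exact: continuous_sin_lin.
Qed.

Let leb_fin : (leb `[0%R, pi]%classic < +oo)%E.
Proof. by rewrite lebesgue_measure_itv /=; case: ifP => _; rewrite ?ltry // -EFinD ltry. Qed.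

Definition poisson_int := wint 0 pi leb poisson.

Let J k := poisson_int (fun x : R => sin (k%:R * x)).

Let J0 : J 0 = 0.
Proof.
rewrite /J /poisson_int; have -> : (fun x : R => sin (0%:R * x)) = (fun x => 0 * sin (1%:R * x)).
  by apply/funext => x; rewrite !mul0r sin0.
by rewrite (wintZ _ _ _ _ leb_fin bmeas_poisson) ?mul0r //; exact: bmeas_sin.
Qed.

(** Start from sin((k+2) x) + sin(k x) = 2 cos x sin((k+1) x) and write 2 cos x = d - (d - 2 cos x).
    The second part cancels the denominator of the kernel and leaves an orthogonality integral,
    nonzero only for k = 0. *)
Let J_rec k : J k.+2 = d * J k.+1 - J k - (if k == 0%N then pi / 2 else 0).
Proof.
have W := wintZ _ _ _ _ leb_fin bmeas_poisson.
have A := wintD _ _ _ _ leb_fin bmeas_poisson.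
have bcos : bmeas 0 pi (fun x : R => d - 2 * cos x).
  apply: (bmeas_continuous _ _ (`|d| + 2)).
    move=> x; apply: cvgB; first exact: cvg_cst.
    by apply: cvgM; [exact: cvg_cst | exact: continuous_cos].
  move=> x; apply: le_trans (ler_normB _ _) _; rewrite lerD2l normrM ger0_norm //.
  by rewrite ler_piMr // ler_norml cos_geN1 cos_le1.
have -> : J k.+2 = poisson_int (fun x => d * sin (k.+1%:R * x) +
    (- 1 * sin (k%:R * x) + - 1 * ((d - 2 * cos x) * sin (k.+1%:R * x)))).
  rewrite /J; congr poisson_int; apply/funext => x.
  have -> : k.+2%:R * x = k.+1%:R * x + x by rewrite -[k.+2]addn1 natrD; ring.
  have -> : k%:R * x = k.+1%:R * x - x by rewrite -[k.+1]addn1 natrD; ring.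
  by rewrite sinD sinB; ring.
have b1 := bmeas_sin k; have b2 := bmeas_sin k.+1; have bc := bmeas_cst 0 (pi : R).
rewrite /poisson_int A; last 2 first.
- by apply: bmeasM => //; exact: bc.
- apply: bmeasD; first by apply: bmeasM => //; exact: bc.
  by apply: bmeasM; [exact: bc | exact: bmeasM].
rewrite A; last 2 first.
- by apply: bmeasM => //; exact: bc.
- by apply: bmeasM; [exact: bc | exact: bmeasM].
rewrite !W //; last exact: bmeasM.
rewrite -/(J k.+1) -/(J k) !mulN1r -addrA; congr (_ + (_ - _)).
rewrite /wint -[RHS]/(if k.+1 == 1%N then pi / 2 else 0) -integral_sin_sin //.
apply: eq_Rintegral => x _; rewrite /poisson -/d.
have h : d - 2 * cos x != 0 by rewrite gt_eqF // (lt_le_trans _ (poisson_den x)).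
by rewrite -/d; field.
Qed.

(** The recursion does not determine [J 1]; boundedness does. The error [b] solves the homogeneous
    recursion with [b 0 = 0], and as d >= 5/2 it at least doubles at each step. The integrals are
    bounded, so it vanishes. *)
Lemma poisson_sin k : J k = if k is 0%N then 0 else pi / 2 * u ^+ k.
Proof.
pose e k := if k is 0%N then 0 else pi / 2 * u ^+ k.
pose b k := J k - e k.
have u_n0 : u != 0 by rewrite gt_eqF.
have b0 : b 0%N = 0 by rewrite /b J0 subrr.
have brec i : b i.+2 = d * b i.+1 - b i.
  rewrite /b J_rec /e /d; case: i => [|i] /=; rewrite !exprS ?expr0; field; exact: u_n0.
have grow i : 2 * `|b i| <= `|b i.+1|.
  elim: i => [|i IH]; first by rewrite b0 normr0 mulr0.
  rewrite brec; have h1 : d * `|b i.+1| - `|b i| <= `|d * b i.+1 - b i|.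
    rewrite -[X in X * _](ger0_norm (_ : 0 <= d)); last by have := d_ge; lra.
    by rewrite -normrM lerB_dist.
  have h2 := normr_ge0 (b i.+1); have := d_ge.
  by move: IH h1 h2; nra.
have grow1 i : 2 ^+ i * `|b 1%N| <= `|b i.+1|.
  elim: i => [|i IH]; first by rewrite mul1r.
  by rewrite exprS -mulrA (le_trans _ (grow i.+1)) // ler_wpM2l.
have [C hC] : exists C, forall i, `|b i| <= C.
  have one := wint_ge0 0 pi leb poisson poisson_ge0.
  pose C1 := poisson_int (fun=> 1).
  have hJ i : `|J i| <= C1.
    have bc := bmeas_cst 0 (pi : R) 1; have bs := bmeas_sin i.
    have L := wint_le _ _ _ _ leb_fin bmeas_poisson poisson_ge0.
    rewrite ler_norml; apply/andP; split; last first.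
      by apply: L => // x _; exact: sin_le1.
    rewrite -mulN1r -(wintZ _ _ _ _ leb_fin bmeas_poisson) //; apply: L => //.
      by apply: bmeasM; exact: bmeas_cst.
    by move=> x _; rewrite mulr1; exact: sin_geN1.
  have pi0 := pi_ge0 R.
  exists (C1 + pi / 2) => i; apply: le_trans (ler_normB _ _) _; apply: lerD => //.
  rewrite /e; case: i => [|i]; first by rewrite normr0 divr_ge0.
  rewrite ger0_norm ?mulr_ge0 ?divr_ge0 ?exprn_ge0 ?(ltW u0) //.
  rewrite ler_piMr ?divr_ge0 // exprn_ile1 ?(ltW u0) //.
  by move: u_half; lra.
have b1 : b 1%N = 0.
  apply/eqP; rewrite -normr_eq0; apply/eqP; apply: (geo_small_eq0 C) => // i.
  rewrite exprVn ler_pdivlMr ?exprn_gt0 // mulrC.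
  exact: le_trans (grow1 i) (hC _).
suff [H _] : b k = 0 /\ b k.+1 = 0 by apply/eqP; rewrite -subr_eq0 -/(e k) -/(b k) H.
elim: k => [//|i [h1 h2]]; split => //; rewrite brec h1 h2 mulr0 subrr //.
Qed.

Lemma poisson_int_sin_series (p : {poly R}) : p`_0 = 0 ->
  poisson_int (fun x => complex.Im (ceval p (eit x))) = pi / 2 * p.[u].
Proof.
move=> p0.
have -> : (fun x => complex.Im (ceval p (eit x))) = (fun x => \sum_(i < size p) p`_i * sin (i%:R * x)).
  by apply/funext => x; rewrite Im_ceval_eit.
have bS n : bmeas 0 pi (fun x : R => \sum_(i < n) p`_i * sin (i%:R * x)).
  elim: n => [|n IH].
    have -> : (fun x => \sum_(i < 0) p`_i * sin (i%:R * x)) = (fun=> 0) :> (R -> R).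
      by apply/funext => x; rewrite big_ord0.
    exact: bmeas_cst.
  have -> : (fun x => \sum_(i < n.+1) p`_i * sin (i%:R * x)) =
     (fun x => \sum_(i < n) p`_i * sin (i%:R * x) + p`_n * sin (n%:R * x)) :> (R -> R).
    by apply/funext => x; rewrite big_ord_recr.
  by apply: bmeasD => //; apply: bmeasM; [exact: bmeas_cst | exact: bmeas_sin].
rewrite horner_coef mulr_sumr; elim: (size p) => [|n IH].
  rewrite big_ord0; have -> : (fun x => \sum_(i < 0) p`_i * sin (i%:R * x)) = (fun x => 0 * sin (1%:R * x)) :> (R -> R).
    by apply/funext => x; rewrite big_ord0 mul0r.
  by rewrite /poisson_int (wintZ _ _ _ _ leb_fin bmeas_poisson) ?mul0r //; exact: bmeas_sin.
rewrite big_ord_recr /= -IH.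
have -> : (fun x => \sum_(i < n.+1) p`_i * sin (i%:R * x)) =
   (fun x => \sum_(i < n) p`_i * sin (i%:R * x) + p`_n * sin (n%:R * x)) :> (R -> R).
  by apply/funext => x; rewrite big_ord_recr.
have bn := bmeas_sin n.
rewrite /poisson_int (wintD _ _ _ _ leb_fin bmeas_poisson) //; last first.
  by apply: bmeasM => //; exact: bmeas_cst.
rewrite (wintZ _ _ _ _ leb_fin bmeas_poisson) //; congr (_ + _).
rewrite [wint _ _ _ _ (fun x => sin (n%:R * x))](poisson_sin n).
move: IH bn => _ _; case: n => [|n']; first by rewrite p0 !(mul0r, mulr0).
by rewrite mulrCA.
Qed.

End poisson_kernel.

(** * Extending the arc cosine to the line *)

Section arccosine.
Context {R : realType}.

(** With [acos] continued by constants beyond [-1, 1], one continuous formula gives the density on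
    the whole line. It vanishes beyond the edges because W is real at u = 1 and u = -1. *)
Definition clamp (y : R) : R := Num.max (- 1) (Num.min 1 y).

Lemma clamp_itv y : -1 <= clamp y <= 1.
Proof.
rewrite /clamp le_max lexx /= ge_max; apply/andP; split; first lra.
by rewrite ge_min lexx.
Qed.

Lemma clamp_id y : -1 <= y <= 1 -> clamp y = y.
Proof. by move=> /andP[h1 h2]; rewrite /clamp (min_idPr h2) (max_idPr h1). Qed.

Lemma continuous_clamp : continuous clamp.
Proof.
move=> y; apply: (@continuous_max R R (fun=> -1) (fun y => Num.min 1 y)).
  exact: cvg_cst.
by apply: (@continuous_min R R (fun=> 1) id); [exact: cvg_cst | exact: cvg_id].
Qed.

Lemma acos_within_continuous : {within `[(-1 : R), 1], continuous (@acos R)}.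
Proof.
have N11 : -1 <= 1 :> R by lra.
have := @segment_can_continuous R 0 pi cos acos (pi_ge0 R) _ (@cosK R).
rewrite cos0 cospi (min_idPr N11) (max_idPl N11); apply.
exact/continuous_subspaceT/continuous_cos.
Qed.

Lemma continuous_acos_clamp : continuous (fun y => acos (clamp y)).
Proof.
have /subspace_continuousP h := acos_within_continuous.
move=> y; have yI := clamp_itv y.
apply: (@cvg_comp _ _ _ clamp (@acos R) _ (within `[(-1 : R), 1] (nbhs (clamp y)))).
  move=> U /= hU.
  have H : nbhs y [set z | `[(-1 : R), 1]%classic (clamp z) -> U (clamp z)] :=
    continuous_clamp y _ hU.
  rewrite nbhs_filterE /=; apply: filterS H => z /=; apply.
  by rewrite in_itv /=; exact: clamp_itv.
by apply: h; rewrite /= in_itv /=; exact: clamp_itv.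
Qed.

End arccosine.

(** * The density read off from the boundary values of W *)

Section arcsine_density.
Context {R : realType} (c s : R) (W_ : nat -> {poly R}) (W : R[i] -> R[i]).
Hypothesis c_small : `|c| <= 200^-1.
Hypothesis s_small : `|s| <= 200^-1.
Hypothesis W_near : forall j, nrm (W_ j - 'X) <= 2^-1 /\ (W_ j)`_0 = 0.
Hypothesis W_lim : forall z, cabs z <= 2 -> forall j,
  cabs (ceval (W_ j) z - W z) <= 12 * 2^-1 ^+ j.
Notation leb := (@lebesgue_measure R).
Local Notation rho := (1 + s).

Let rho_ge : 199 / 200 <= rho.
Proof. by move: s_small; rewrite ler_norml => /andP[h _]; lra. Qed.
Let rho_le : rho <= 201 / 200.
Proof. by move: s_small; rewrite ler_norml => /andP[_ h]; lra. Qed.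
Let c_ge : - 200^-1 <= c. Proof. by move: c_small; rewrite ler_norml => /andP[]. Qed.
Let c_le : c <= 200^-1. Proof. by move: c_small; rewrite ler_norml => /andP[]. Qed.

Definition angular (x : R) : R := complex.Im (W (eit x)).

Let half_lim (x a C : R) : (forall n, x <= a + C * 2^-1 ^+ n) -> x <= a.
Proof.
move=> h; rewrite -subr_le0; apply: (expn_small_le0 _ C 2^-1) => [|n].
  by rewrite invr_ge0 ler0n /=; lra.
by rewrite lerBlDl.
Qed.

Let approx x j : `|complex.Im (ceval (W_ j) (eit x)) - angular x| <= 12 * 2^-1 ^+ j.
Proof.
rewrite /angular -ImN -ImD; apply: le_trans (Im_le_cabs _) _.
by apply: W_lim; rewrite cabs_eit; lra.
Qed.

Let W_nrm j : nrm (W_ j) <= 3.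
Proof.
rewrite -(subrK 'X (W_ j)); apply: le_trans (nrmD _ _) _; rewrite nrmX.
by have [h _] := W_near j; lra.
Qed.

Lemma angular_lipschitz x y : `|angular x - angular y| <= 3 * `|x - y|.
Proof.
apply: (half_lim _ _ 24) => n.
have h1 := approx x n; have h2 := approx y n.
have h3 := sin_series_lipschitz (W_ n) x y.
have h4 : nrm (W_ n) * `|x - y| <= 3 * `|x - y| by rewrite ler_wpM2r // W_nrm.
move: h1 h2 h3 h4; set a := complex.Im _; set b := complex.Im _.
set d := 2^-1 ^+ n; set e := `|x - y|; set f := nrm _ * e.
rewrite !ler_norml => /andP[? ?] /andP[? ?] /andP[? ?] ?.
by apply/andP; split; lra.
Qed.

Lemma continuous_angular : continuous angular.
Proof.
move=> x; apply/cvgrPdist_le => e e0; near=> y.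
apply: le_trans (angular_lipschitz x y) _.
rewrite mulrC -ler_pdivlMr //; near: y.
by apply: cvgr_dist_le; [exact: cvg_id | exact: divr_gt0].
Unshelve. all: by end_near. Qed.

Lemma angular_le x : `|angular x| <= 3 * `|sin x|.
Proof.
apply: (half_lim _ _ 12) => n.
have h1 := approx x n; have h3 := sin_series_le (W_ n) x.
have h4 : nrm (W_ n) * `|sin x| <= 3 * `|sin x| by rewrite ler_wpM2r // W_nrm.
move: h1 h3 h4; set a := complex.Im _.
set d := 2^-1 ^+ n; set e := `|sin x|; set f := nrm _ * e.
rewrite !ler_norml => /andP[? ?] /andP[? ?] ?.
by apply/andP; split; lra.
Qed.

(** Write W as u plus a perturbation of norm at most 1/2: its imaginary part at exp(i x) differs
    from sin x by at most (sin x) / 2. *)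
Lemma angular_ge0 x : 0 <= x <= pi -> 0 <= angular x.
Proof.
move=> /sin_ge0_pi sx; rewrite -oppr_le0; apply: (half_lim _ _ 12) => n.
rewrite add0r; have h1 := approx x n; have [h2 _] := W_near n.
have h3 := sin_series_le (W_ n - 'X) x.
have h4 : nrm (W_ n - 'X) * `|sin x| <= 2^-1 * sin x.
  by rewrite (ger0_norm sx) ler_wpM2r.
have e : complex.Im (ceval (W_ n) (eit x)) = complex.Im (ceval (W_ n - 'X) (eit x)) + sin x.
  have := cevalD (W_ n - 'X) 'X (eit x); rewrite subrK => ->.
  by rewrite ImD cevalX.
move: h1 h3 h4; rewrite e; set a := complex.Im _.
set d := 2^-1 ^+ n; set f := nrm _ * _.
rewrite !ler_norml => /andP[? ?] /andP[? ?] ?; lra.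
Qed.

(** At u = exp(i x) the map c + rho (u + 1/u) takes the real value c + 2 rho cos x; the formula
    inverts this for 0 <= x <= pi. *)
Definition law_density (t : R) : R := angular (acos (clamp ((t - c) / (2 * rho)))) / pi.

Lemma continuous_law_density : continuous law_density.
Proof.
move=> t; apply: cvgM; last exact: cvg_cst.
apply: (cvg_comp (fun t => acos (clamp ((t - c) / (2 * rho)))) angular); last exact: continuous_angular.
apply: (cvg_comp (fun t => (t - c) / (2 * rho)) (fun y => acos (clamp y))).
  by apply: cvgM; [apply: cvgB; [exact: cvg_id | exact: cvg_cst] | exact: cvg_cst].
exact: continuous_acos_clamp.
Qed.

Lemma law_density_ge0 t : 0 <= law_density t.
Proof.
rewrite divr_ge0 ?pi_ge0 // angular_ge0 // acos_ge0 ?acos_lepi ?clamp_itv //.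
Qed.

Lemma law_density_le t : law_density t <= 3 / pi.
Proof.
rewrite ler_pM2r ?invr_gt0 ?pi_gt0 //; apply: le_trans (ler_norm _) _.
apply: le_trans (angular_le _) _; rewrite ler_piMr //.
by rewrite ler_norml sin_geN1 sin_le1.
Qed.

Lemma law_density_out t : 2 * rho <= `|t - c| -> law_density t = 0.
Proof.
move=> h; rewrite /law_density; set y := (t - c) / (2 * rho).
have r0 : 0 < 2 * rho by have := rho_ge; lra.
have yE : `|y| = `|t - c| / (2 * rho) by rewrite normrM normfV (gtr0_norm r0).
have y1 : 1 <= `|y| by rewrite yE ler_pdivlMr // mul1r.
suff -> : angular (acos (clamp y)) = 0 by rewrite mul0r.
apply/eqP; rewrite -normr_le0; apply: le_trans (angular_le _) _.
have [y0|y0] := leP 0 y.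
  rewrite (ger0_norm y0) in y1.
  have -> : clamp y = 1.
    by rewrite /clamp (min_idPl y1) (max_idPr _) //; lra.
  by rewrite acos1 sin0 normr0 mulr0.
rewrite (ltr0_norm y0) in y1.
have -> : clamp y = -1.
  by rewrite /clamp (min_idPr _) ?(max_idPl _) //; lra.
by rewrite acosN1 sinpi normr0 mulr0.
Qed.

Lemma law_density_out3 t : t \notin `[-3, 3] -> law_density t = 0.
Proof.
rewrite in_itv /= negb_and -!ltNge => h; apply: law_density_out.
have := c_ge; have := c_le; have := rho_le => h1 h2 h3.
by case/orP: h => h; rewrite ler_normr; apply/orP; [right | left]; lra.
Qed.

Lemma law_density_cos x : 0 <= x <= pi -> law_density (c + 2 * rho * cos x) = angular x / pi.
Proof.
move=> h; have r0 : 2 * rho != 0 by have := rho_ge => ?; rewrite gt_eqF //; lra.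
rewrite /law_density; have -> : (c + 2 * rho * cos x - c) / (2 * rho) = cos x by field; lra.
by rewrite clamp_id ?cosK // cos_geN1 cos_le1.
Qed.

Lemma law_density_moment k : \int[leb]_(t in `[-3, 3]) (t ^+ k * law_density t) =
  \int[leb]_(t in `[c - 2 * rho, c + 2 * rho]) (t ^+ k * law_density t).
Proof.
have sub : `[c - 2 * rho, c + 2 * rho]%classic `<=` `[-3, 3]%classic.
  apply: subset_itv; rewrite bnd_simp; have := c_ge; have := c_le; have := rho_le; lra.
rewrite [LHS]Rintegral_mkcond [RHS]Rintegral_mkcond; apply: eq_Rintegral => t _.
rewrite !patchE; case: (boolP (t \in `[c - 2 * rho, c + 2 * rho]%classic)) => h.
  by rewrite mem_set //; apply: sub; exact: set_mem.
case: ifP => // _; rewrite law_density_out ?mulr0 //.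
move: h; rewrite mem_setE in_itv /= negb_and -!ltNge => /orP[h|h];
  rewrite ler_normr; apply/orP; [right | left]; lra.
Qed.

Section cauchy_transform.
Variable u : R.
Hypothesis u0 : 0 < u.
Hypothesis u_half : u <= 2^-1.

Let leb_fin (a b : R) : (leb `[a, b]%classic < +oo)%E.
Proof. by rewrite lebesgue_measure_itv /=; case: ifP => _; rewrite ?ltry // -EFinD ltry. Qed.

Let wu : R := complex.Re (W u%:C%C).

Let wu_lim j : `|(W_ j).[u] - wu| <= 12 * 2^-1 ^+ j.
Proof.
have u2 : cabs (u%:C%C : R[i]) <= 2 by rewrite cabs_real ger0_norm ?ltW //; have := u_half; lra.
have := W_lim _ u2 j; rewrite ceval_real; apply: le_trans.
by apply: le_trans (Re_le_cabs _); rewrite ReD ReN.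
Qed.

(** The identity holds for every polynomial [W_ j], and the uniform error 12 2^-j passes through the
    nonnegative kernel. *)
Lemma poisson_int_angular : poisson_int u angular = pi / 2 * wu.
Proof.
have bp := bmeas_poisson u u0 u_half; have p0 := poisson_ge0 u u0 u_half.
have L := wint_le 0 pi leb (poisson u) (leb_fin 0 pi) bp p0.
have D := wintD 0 pi leb (poisson u) (leb_fin 0 pi) bp.
have Z := wintZ 0 pi leb (poisson u) (leb_fin 0 pi) bp.
have bA : bmeas 0 pi angular.
  apply: (bmeas_continuous _ _ 3); first exact: continuous_angular.
  move=> x; apply: le_trans (angular_le x) _; rewrite ler_piMr //.
  by rewrite ler_norml sin_geN1 sin_le1.
have bS j : bmeas 0 pi (fun x => complex.Im (ceval (W_ j) (eit x))).
  apply: (bmeas_continuous _ _ 3).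
    move=> x; apply/cvgrPdist_le => e e0; near=> y.
    apply: le_trans (sin_series_lipschitz (W_ j) x y) _.
    apply: (@le_trans _ _ (3 * `|x - y|)); first by rewrite ler_wpM2r // W_nrm.
    rewrite mulrC -ler_pdivlMr //; near: y.
    by apply: cvgr_dist_le; [exact: cvg_id | exact: divr_gt0].
  move=> x; apply: le_trans (sin_series_le _ x) _.
  rewrite -[3]mulr1 ler_pM ?nrm_ge0 ?W_nrm //.
  by rewrite ler_norml sin_geN1 sin_le1.
pose C := poisson_int u (fun=> 1).
have C0 : 0 <= C by apply: wint_ge0 => //; exact: leb_fin.
have hC j : `|poisson_int u angular - pi / 2 * (W_ j).[u]| <= C * (12 * 2^-1 ^+ j).
  have [_ z0] := W_near j; rewrite -(poisson_int_sin_series u u0 u_half _ z0).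
  have up : poisson_int u angular <=
      poisson_int u (fun x => complex.Im (ceval (W_ j) (eit x)) + 12 * 2^-1 ^+ j * 1).
    apply: L => //; first by apply: bmeasD => //; apply: bmeasM; exact: bmeas_cst.
    by move=> x _; rewrite mulr1; have := approx x j; rewrite ler_norml => /andP[h _]; lra.
  have lo : poisson_int u (fun x => complex.Im (ceval (W_ j) (eit x))) <=
      poisson_int u (fun x => angular x + 12 * 2^-1 ^+ j * 1).
    apply: L => //; first by apply: bmeasD => //; apply: bmeasM; exact: bmeas_cst.
    by move=> x _; rewrite mulr1; have := approx x j; rewrite ler_norml => /andP[_ h]; lra.
  move: up lo; rewrite /poisson_int !D //; try by apply: bmeasM; exact: bmeas_cst.
  rewrite !Z //; try exact: bmeas_cst.
  rewrite -/(poisson_int u _) -/(poisson_int u angular) -/(poisson_int u (fun=> 1)) -/C.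
  rewrite ler_norml mulrC => ? ?; apply/andP; split; lra.
apply/eqP; rewrite -subr_eq0 -normr_le0; apply: (half_lim _ _ (12 * (C + pi))) => n.
have h1 := hC n; have h2 := wu_lim n; have pi0 := pi_ge0 R.
have -> : poisson_int u angular - pi / 2 * wu = (poisson_int u angular - pi / 2 * (W_ n).[u]) +
   pi / 2 * ((W_ n).[u] - wu) by ring.
apply: le_trans (ler_normD _ _) _; rewrite add0r normrM (ger0_norm (_ : 0 <= pi / 2)) ?divr_ge0 //.
have h3 : pi / 2 * `|(W_ n).[u] - wu| <= pi * (12 * 2^-1 ^+ n).
  by apply: ler_pM => //; rewrite ?divr_ge0 //; lra.
by lra.
Unshelve. all: by end_near. Qed.

Local Notation x0 := (c + rho * (u + u^-1)).

Lemma cauchy_point_gt t : t \in `[c - 2 * rho, c + 2 * rho] -> 0 < x0 - t.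
Proof.
rewrite in_itv /= => /andP[_ h].
have : 2 * rho < rho * (u + u^-1); last by lra.
rewrite mulrC ltr_pM2l; last by have := rho_ge; lra.
have := poisson_den u u0 u_half 0; rewrite cos0 => h1; lra.
Qed.

(** Under t = c + 2 rho cos x the difference x0 - t becomes rho (u + 1/u - 2 cos x) and |dt| becomes
    2 rho sin x dx, so the Cauchy kernel turns into twice the conjugate Poisson kernel. Thus W(u) is
    the Cauchy transform of the density at x0. *)
Lemma law_density_cauchy :
  \int[leb]_(t in `[c - 2 * rho, c + 2 * rho]) ((x0 - t)^-1 * law_density t) = wu.
Proof.
have r0 : 0 < rho by have := rho_ge; lra.
pose G t := (x0 - t)^-1 * law_density t.
pose F x := c + 2 * rho * cos x.
have F0 : F 0 = c + 2 * rho by rewrite /F cos0 mulr1.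
have Fpi : F pi = c - 2 * rho by rewrite /F cospi mulrN1.
have dF (x : R) : is_derive x 1 F (- (2 * rho * sin x)).
  apply: is_derive_eq (is_deriveD (is_derive_cst c x 1) (is_deriveZ (2 * rho) (is_derive_cos x))) _.
  by rewrite /GRing.scale /= add0r mulrN.
have F'E : (derive1 F) = (fun x => - (2 * rho * sin x)).
  by apply/funext => x; rewrite derive1E; exact: derive_val.
have cF : continuous F.
  by move=> x; apply/differentiable_continuous/derivable1_diffP; have [] := dF x.
have cF' : continuous (derive1 F).
  rewrite F'E => x; apply: cvgN; apply: cvgM; [exact: cvg_cst | exact: continuous_sin].
have subst : (\int[leb]_(x in `[F pi, F 0%R]) (G x)%:E =
    \int[leb]_(x in `[0%R, pi]) (((G \o F) * - (derive1 F)) x)%:E)%E.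
  apply: integration_by_substitution_decreasing; first exact: pi_ge0.
  - move=> x y xI yI xy; rewrite /F ltrD2l ltr_pM2l ?mulr_gt0 //.
    by rewrite ltr_cos.
  - by move=> x _; exact: cF'.
  - by apply: cvgP; apply: cvg_at_right_filter; exact: cF'.
  - by apply: cvgP; apply: cvg_at_left_filter; exact: cF'.
  - split; first by move=> x _; have [] := dF x.
    + by apply: cvg_at_right_filter; exact: cF.
    + by apply: cvg_at_left_filter; exact: cF.
  - rewrite F0 Fpi; apply: continuous_in_subspaceT => t; rewrite mem_setE => tI.
    apply: cvgM; last exact: continuous_law_density.
    apply: cvgV; first by rewrite gt_eqF // cauchy_point_gt.
    by apply: cvgB; [exact: cvg_cst | exact: cvg_id].
rewrite -[X in \int[leb]_(t in X) _ = _]/(`[c - 2 * rho, c + 2 * rho]%classic) -F0 -Fpi.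
rewrite -[LHS]/(\int[leb]_(t in `[F pi, F 0]) G t).
rewrite /Rintegral subst -[X in fine X = _]/(\int[leb]_(x in `[0%R, pi]) (((G \o F) * - (derive1 F)) x)%:E)%E.
rewrite -/(Rintegral leb `[0, pi]%classic ((G \o F) * - (derive1 F))).
have -> : \int[leb]_(x in `[0, pi]) ((G \o F) * - (derive1 F)) x =
    \int[leb]_(x in `[0, pi]) ((2 / pi * angular x) * poisson u x).
  apply: eq_Rintegral => x; rewrite mem_setE in_itv /= => xI.
  have den := poisson_den u u0 u_half x.
  have e1 : (- (derive1 F)) x = 2 * rho * sin x by rewrite F'E /= fctE opprK.
  rewrite -[LHS]/((G (F x)) * (- (derive1 F)) x) e1 /G law_density_cos // /poisson.
  have -> : x0 - F x = rho * (u + u^-1 - 2 * cos x) by rewrite /F; ring.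
  have n1 : rho != 0 by rewrite gt_eqF.
  have n2 : u + u^-1 - 2 * cos x != 0 by rewrite gt_eqF //; lra.
  have n3 : pi != 0 :> R by rewrite gt_eqF // pi_gt0.
  move: n2 n3; generalize (u + u^-1 - 2 * cos x) (pi : R) => k q n2 n3.
  by field; rewrite n1 n2 n3.
rewrite -[LHS]/(wint 0 pi leb (poisson u) (fun x => 2 / pi * angular x)).
rewrite (wintZ _ _ _ _ (leb_fin 0 pi) (bmeas_poisson u u0 u_half)); last first.
  apply: (bmeas_continuous _ _ 3); first exact: continuous_angular.
  move=> x; apply: le_trans (angular_le x) _; rewrite ler_piMr //.
  by rewrite ler_norml sin_geN1 sin_le1.
rewrite -/(poisson_int u angular) poisson_int_angular.
have n3 : pi != 0 :> R by rewrite gt_eqF // pi_gt0.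
by move: n3; generalize (pi : R) => q n3; field.
Qed.

End cauchy_transform.
End arcsine_density.

(** * Moments of the density *)

Section small_order.
Context {R : realType}.
Implicit Types f g : R -> R.

(** The counterpart of [eqmodX] for functions of a small real u. Order 0 against the zero function
    expresses boundedness. *)
Definition eqO N f g := exists C : R, forall u : R, 0 < u -> u <= 2^-1 -> `|f u - g u| <= C * u ^+ N.

Lemma eqO_refl N f g : (forall u : R, 0 < u -> u <= 2^-1 -> f u = g u) -> eqO N f g.
Proof. by move=> h; exists 0 => u u0 u1; rewrite h // subrr normr0 mul0r. Qed.

Lemma eqO_sym N f g : eqO N f g -> eqO N g f.
Proof. by move=> [C h]; exists C => u u0 u1; rewrite distrC h. Qed.

Lemma eqO_trans N f g k : eqO N f g -> eqO N g k -> eqO N f k.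
Proof.
move=> [C h] [C' h']; exists (C + C') => u u0 u1; rewrite mulrDl.
have -> : f u - k u = (f u - g u) + (g u - k u) by ring.
by apply: le_trans (ler_normD _ _) _; rewrite lerD ?h ?h'.
Qed.

Lemma eqOD N f g f' g' : eqO N f g -> eqO N f' g' -> eqO N (fun u => f u + f' u) (fun u => g u + g' u).
Proof.
move=> [C h] [C' h']; exists (C + C') => u u0 u1; rewrite mulrDl.
have -> : f u + f' u - (g u + g' u) = (f u - g u) + (f' u - g' u) by ring.
by apply: le_trans (ler_normD _ _) _; rewrite lerD ?h ?h'.
Qed.

Lemma eqO_bounded N f g : eqO N f g -> eqO 0 g (fun=> 0) -> eqO 0 f (fun=> 0).
Proof.
move=> [C h] [C' h']; exists (`|C| + C') => u u0 u1.
have -> : f u - 0 = (f u - g u) + (g u - 0) by ring.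
apply: le_trans (ler_normD _ _) _; rewrite expr0 mulr1 lerD //; last first.
  by have := h' u u0 u1; rewrite expr0 mulr1.
apply: le_trans (h u u0 u1) _; have uN : `|u ^+ N| <= 1.
  rewrite normrX (gtr0_norm u0) exprn_ile1 ?ltW //; lra.
apply: le_trans (ler_norm _) _; rewrite normrM ler_piMr //.
Qed.

Lemma eqOM N f g f' g' : eqO 0 f (fun=> 0) -> eqO 0 g' (fun=> 0) ->
  eqO N f g -> eqO N f' g' -> eqO N (fun u => f u * f' u) (fun u => g u * g' u).
Proof.
move=> [A hA] [B hB] [C h] [C' h']; exists (A * C' + C * B) => u u0 u1.
have -> : f u * f' u - g u * g' u = f u * (f' u - g' u) + (f u - g u) * g' u by ring.
have := hA u u0 u1; have := hB u u0 u1; rewrite !expr0 !mulr1 !subr0 => hB1 hA1.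
have -> : (A * C' + C * B) * u ^+ N = A * (C' * u ^+ N) + C * u ^+ N * B by ring.
apply: le_trans (ler_normD _ _) _; rewrite !normrM.
by apply: lerD; apply: ler_pM => //; [exact: h' | exact: h].
Qed.

Lemma bounded_cst (a : R) : eqO 0 (fun=> a) (fun=> 0).
Proof. by exists `|a| => u _ _; rewrite subr0 expr0 mulr1. Qed.

Lemma boundedD f g : eqO 0 f (fun=> 0) -> eqO 0 g (fun=> 0) -> eqO 0 (fun u => f u + g u) (fun=> 0).
Proof.
by move=> bf bg; apply: eqO_trans (eqOD _ _ _ _ _ bf bg) _; apply: eqO_refl => u _ _; rewrite addr0.
Qed.

Lemma boundedM f g : eqO 0 f (fun=> 0) -> eqO 0 g (fun=> 0) -> eqO 0 (fun u => f u * g u) (fun=> 0).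
Proof.
move=> bf bg; apply: eqO_trans (eqOM _ _ _ _ _ bf (bounded_cst 0) bf bg) _.
by apply: eqO_refl => u _ _; rewrite mulr0.
Qed.

Lemma boundedX f n : eqO 0 f (fun=> 0) -> eqO 0 (fun u => f u ^+ n) (fun=> 0).
Proof.
move=> bf; elim: n => [|n IH]; first exact: bounded_cst.
apply: eqO_trans (boundedM _ _ bf IH); apply: eqO_refl => u _ _.
by rewrite exprS.
Qed.

Lemma eqOX N f g n : eqO 0 f (fun=> 0) -> eqO 0 g (fun=> 0) ->
  eqO N f g -> eqO N (fun u => f u ^+ n) (fun u => g u ^+ n).
Proof.
move=> bf bg fg; elim: n => [|n IH]; first exact: eqO_refl.
have := eqOM N _ _ _ _ bf (boundedX _ n bg) fg IH.
have e k : eqO N (fun u => k u ^+ n.+1) (fun u => k u * k u ^+ n).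
  by apply: eqO_refl => u _ _; rewrite exprS.
move=> h; apply: eqO_trans (e f) _; apply: eqO_trans h _; exact: eqO_sym.
Qed.

Lemma eqO_sum N n (f g : nat -> R -> R) : (forall k, (k < n)%N -> eqO N (f k) (g k)) ->
  eqO N (fun u => \sum_(k < n) f k u) (fun u => \sum_(k < n) g k u).
Proof.
elim: n => [|n IH] h; first by apply: eqO_refl => u _ _; rewrite !big_ord0.
have h1 := IH (fun k kn => h k (ltnW kn)).
apply: eqO_trans (eqO_trans _ _ _ _ _ (eqOD _ _ _ _ _ h1 (h n (ltnSn n)))) _;
  by apply: eqO_refl => u _ _; rewrite big_ord_recr.
Qed.

Lemma bounded_horner (p : {poly R}) f : eqO 0 f (fun=> 0) -> eqO 0 (fun u => p.[f u]) (fun=> 0).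
Proof.
move=> bf; elim/poly_ind: p => [|p c IH]; first by apply: eqO_refl => u _ _; rewrite horner0.
apply: eqO_trans (boundedD _ _ (boundedM _ _ IH bf) (bounded_cst c)).
by apply: eqO_refl => u _ _; rewrite hornerMXaddC.
Qed.

Lemma eqO_horner N (p r : {poly R}) (y : R -> R) : eqmodX N p r -> eqO 1 y (fun=> 0) ->
  eqO N (fun u => p.[y u]) (fun u => r.[y u]).
Proof.
move=> pr y1; have y0 := eqO_bounded _ _ _ y1 (bounded_cst 0).
pose d := drop_poly N (p - r).
have E : p - r = d * 'X^N.
  rewrite -{1}(poly_take_drop N (p - r)) -/d; have -> : take_poly N (p - r) = 0; last by rewrite add0r.
  by apply/polyP => i; rewrite coef_take_poly coef0; case: ifP => // iN; rewrite coefB pr ?subrr.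
have [A hA] := bounded_horner d y y0; case: y1 => B hB.
exists (A * B ^+ N) => u u0 u1; rewrite -hornerN -hornerD E hornerM hornerXn normrM -mulrA -exprMn normrX.
have := hA u u0 u1; have := hB u u0 u1; rewrite expr1 expr0 mulr1 !subr0 => hB1 hA1.
by apply: ler_pM => //; rewrite ?exprn_ge0 // lerXn2r // nnegrE ?(le_trans _ hB1).
Qed.

End small_order.

Section moment_comparison.
Context {R : realType} (q W : R -> R) (C : R).
Hypothesis q_ge1 : forall u : R, 0 < u -> u <= 2^-1 -> 1 <= q u.
Hypothesis W_ge : forall u : R, 0 < u -> u <= 2^-1 -> u / 2 <= W u.
Hypothesis W_le : forall u : R, 0 < u -> u <= 2^-1 -> W u <= C * u.

Let W_small k : exists D : R, forall u : R, 0 < u -> u <= 2^-1 -> `|W u ^+ k| <= D * u ^+ k.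
Proof.
exists (C ^+ k) => u u0 u1; have h1 := W_ge _ u0 u1; have h2 := W_le _ u0 u1.
have W0 : 0 <= W u by apply: le_trans h1; rewrite divr_ge0 // ltW.
rewrite ger0_norm ?exprn_ge0 // -exprMn lerXn2r // nnegrE //; exact: le_trans h2.
Qed.

(* [q W^K] is of exact order [u^K], so the lowest nonzero difference would dominate. *)
Lemma moments_eq_of_expansions (d : nat -> R) :
  (forall N, (1 < N)%N -> eqO N (fun u => \sum_(k < N) d k * (q u ^+ (N.-1 - k) * W u ^+ k)) (fun=> 0)) ->
  forall k, d k = 0.
Proof.
move=> h; elim/ltn_ind => K IH; have [A hA] := h K.+2 isT.
have [D hD] := W_small K.+1.
apply/eqP; rewrite -normr_le0.
apply: (expn_small_le0 _ (2 ^+ K * (`|A| + `|d K.+1| * D)) 2^-1) => [|n].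
  by rewrite invr_ge0 ler0n /=; lra.
pose u : R := 2^-1 ^+ n.+1.
have u0 : 0 < u by rewrite exprn_gt0 // invr_gt0.
have u1 : u <= 2^-1 by rewrite /u exprS ler_piMr ?invr_ge0 // exprn_ile1 ?invr_ge0 //; lra.
have ule : u <= 2^-1 ^+ n by rewrite /u exprS ler_piMl ?exprn_ge0 ?invr_ge0 //; lra.
have := hA u u0 u1; rewrite !big_ord_recr /= big1 => [|i _]; last by rewrite IH ?mul0r.
rewrite add0r subr0 subnn subSnn expr1 expr0 mul1r => h1.
have h2 : `|d K * (q u * W u ^+ K)| <= (`|A| + `|d K.+1| * D) * u ^+ K.+1.
  have -> : d K * (q u * W u ^+ K) = (d K * (q u * W u ^+ K) + d K.+1 * W u ^+ K.+1) +
    - (d K.+1 * W u ^+ K.+1) by ring.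
  apply: le_trans (ler_normD _ _) _; rewrite normrN mulrDl; apply: lerD.
    apply: le_trans h1 _; rewrite [u ^+ K.+2]exprS mulrA ler_wpM2r ?exprn_ge0 ?(ltW u0) //.
    apply: le_trans (ler_norm _) _; rewrite normrM ler_piMr // gtr0_norm //; lra.
  by rewrite normrM -mulrA ler_wpM2l // hD.
have q1 := q_ge1 _ u0 u1.
have h3 : `|d K| * (u / 2) ^+ K <= `|d K * (q u * W u ^+ K)|.
  rewrite normrM ler_wpM2l //; have Wu := W_ge _ u0 u1.
  have W0 : 0 <= W u by apply: le_trans Wu; rewrite divr_ge0 // ltW.
  have WK : (u / 2) ^+ K <= W u ^+ K by rewrite lerXn2r // nnegrE // divr_ge0 // ltW.
  rewrite ger0_norm ?mulr_ge0 ?exprn_ge0 //; last by lra.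
  apply: le_trans WK _; rewrite ler_peMl // exprn_ge0 //.
have h4 := le_trans h3 h2.
have uK : 0 < u ^+ K by rewrite exprn_gt0.
have h5 : `|d K| <= 2 ^+ K * (`|A| + `|d K.+1| * D) * u.
  rewrite -(ler_pM2r uK); move: h4; rewrite exprMn exprVn mulrA ler_pdivrMr ?exprn_gt0 //.
  by rewrite exprSr; lra.
apply: le_trans h5 _; rewrite ler_wpM2l // mulr_ge0 ?exprn_ge0 //.
have D0 : 0 <= D * u ^+ K.+1 by apply: le_trans (hD u u0 u1).
have D1 : 0 <= D by move: D0; rewrite pmulr_lge0 // exprn_gt0.
by rewrite addr_ge0 // mulr_ge0.
Qed.

End moment_comparison.

(** * The parametric Cauchy transform near u = 0 *)

Section free_sum_expansion.
Context {R : realType} (mu nu : borel_prob R) (n : nat) (h A : R -> R).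
Hypothesis n0 : (0 < n)%N.
Hypothesis mu1 : moment mu 1 = 0.
Hypothesis free_sum : is_free_normalized_sum_law mu n nu.
Local Notation eps := ((Num.sqrt n%:R : R)^-1).
Local Notation v := (fun u : R => u * h u).
Hypothesis h_bounded : eqO 0 h (fun=> 0).
Hypothesis A_expansion : forall J,
  eqO J A (fun u => \sum_(k < J) moment mu k.+2 * (eps * v u) ^+ k).
Local Notation q := (fun u : R => 1 + v u ^+ 2 * A u).
Local Notation W := (fun u : R => v u * (1 + eps ^+ 2 * v u ^+ 2 * A u)).

(** The formal congruence is evaluated at y = eps v = O(u), where the moment polynomial agrees with
    1 + y^2 A modulo u^N. As n eps^2 = 1, the factor n disappears from q, and sqrt(n) y = v turns
    the other parameter into W. *)
Lemma free_sum_expansion N : (1 < N)%N ->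
  eqO N (fun u => q u ^+ N) (fun u => \sum_(k < N) moment nu k * (q u ^+ (N.-1 - k) * W u ^+ k)).
Proof.
move=> N1; have N0 := ltnW N1.
have n0R : 0 < n%:R :> R by rewrite ltr0n.
have sq : Num.sqrt (n%:R : R) != 0 by rewrite gt_eqF // sqrtr_gt0.
have sq2 : Num.sqrt (n%:R : R) ^+ 2 = n%:R by rewrite sqr_sqrtr ?ltW.
have bid : eqO 0 (fun u : R => u) (fun=> 0).
  by exists 1 => u u0 u1; rewrite subr0 expr0 mulr1 gtr0_norm //; lra.
pose y u : R := eps * v u.
have y1 : eqO 1 y (fun=> 0).
  have [C hC] := h_bounded; exists (`|eps| * C) => u u0 u1.
  have := hC u u0 u1; rewrite !subr0 expr0 mulr1 expr1 /y => h1.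
  rewrite !normrM (gtr0_norm u0) -mulrA ler_wpM2l // mulrC ler_wpM2r // ltW //.
have y0 := eqO_bounded _ _ _ y1 (bounded_cst 0).
have bv : eqO 0 v (fun=> 0) := boundedM _ _ bid h_bounded.
have bA : eqO 0 A (fun=> 0).
  by apply: eqO_trans (A_expansion 0) _; apply: eqO_refl => u _ _; rewrite big_ord0.
have bq : eqO 0 q (fun=> 0) := boundedD _ _ (bounded_cst 1) (boundedM _ _ (boundedX _ 2 bv) bA).
pose M u := 1 + y u ^+ 2 * A u.
have bM : eqO 0 M (fun=> 0) := boundedD _ _ (bounded_cst 1) (boundedM _ _ (boundedX _ 2 y0) bA).
pose Mp : {poly R} := \poly_(k < N) moment mu k.
pose qp : {poly R} := 1 + n%:R * (Mp - 1).
have key := eqO_horner N _ _ y (free_normalized_sum_moments mu nu n N n0 N0 free_sum) y1.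
have eM : eqO N (fun u => Mp.[y u]) M.
  (* Moments 0 and 1 are 1 and 0, and A starts at the moment of order 2, hence N - 2 terms. *)
  have [C hC] := A_expansion (N - 2); have [B hB] := y1.
  exists (B ^+ 2 * C) => u u0 u1.
  have -> : Mp.[y u] - M u = - (y u ^+ 2 * (A u - \sum_(k < N - 2) moment mu k.+2 * y u ^+ k)).
    rewrite /M horner_poly; case: N N1 {N0 Mp qp key C hC} => // -[//|N] _.
    rewrite subSS subSS subn0 !big_ord_recl /= moment0 mu1 expr0 mulr1 mul0r add0r.
    rewrite mulrBr mulr_sumr opprB.
    have -> : \sum_(i < N) moment mu (bump 0 (bump 0 i)) * y u ^+ bump 0 (bump 0 i) =
      \sum_(i < N) y u ^+ 2 * (moment mu i.+2 * y u ^+ i).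
      by apply: eq_bigr => i _; rewrite /bump /= !add1n !exprS; ring.
    by ring.
  have := hB u u0 u1; have := hC u u0 u1; rewrite subr0 expr1 => hC1 hB1.
  have -> : B ^+ 2 * C * u ^+ N = (B * u) ^+ 2 * (C * u ^+ (N - 2)).
    by rewrite -{1}(subnKC N1) exprD; ring.
  rewrite normrN normrM normrX; apply: ler_pM; rewrite ?exprn_ge0 //.
  by rewrite lerXn2r // nnegrE ?(le_trans _ hB1).
have bMp : eqO 0 (fun u => Mp.[y u]) (fun=> 0) := eqO_bounded _ _ _ eM bM.
have qpE u : qp.[y u] = 1 + n%:R * (Mp.[y u] - 1).
  by rewrite /qp -polyC_natr -polyC1 !(hornerD, hornerM, hornerN, hornerC).
have qE u : q u = 1 + n%:R * (M u - 1).
  by move: sq sq2; rewrite /M /y /=; set r := Num.sqrt _ => sq <-; field.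
have eqq : eqO N (fun u => qp.[y u]) q.
  have [C hC] := eM; exists (n%:R * C) => u u0 u1; rewrite qpE qE.
  have -> : 1 + n%:R * (Mp.[y u] - 1) - (1 + n%:R * (M u - 1)) = n%:R * (Mp.[y u] - M u) by ring.
  by rewrite normrM (gtr0_norm n0R) -mulrA ler_wpM2l ?ler0n ?hC.
have bqp : eqO 0 (fun u => qp.[y u]) (fun=> 0) := eqO_bounded _ _ _ eqq bq.
have bW : eqO 0 W (fun=> 0).
  apply: eqO_trans (boundedM _ _ bv bM); apply: eqO_refl => u _ _; rewrite /M /y; ring.
apply: eqO_trans (eqO_sym _ _ _ (eqOX N _ _ N bqp bq eqq)) _.
have : eqO N (fun u => qp.[y u] ^+ N) (fun u =>
    \sum_(k < N) moment nu k * (qp.[y u] ^+ (N.-1 - k) * (Mp.[y u] * v u) ^+ k)).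
  apply: eqO_trans (eqO_trans _ _ _ _ _ key) _; apply: eqO_refl => u u0 u1; rewrite ?horner_exp //.
  rewrite horner_sum; apply: eq_bigr => k _.
  rewrite hornerZ hornerM !horner_exp hornerM hornerX -/Mp -/qp /y.
  have -> : Mp.[eps * (u * h u)] * (u * h u) = Num.sqrt n%:R * (Mp.[eps * (u * h u)] * (eps * (u * h u))).
    by field.
  by rewrite [(Num.sqrt _ * _) ^+ k]exprMn; ring.
move=> h1; apply: eqO_trans h1 _.
apply: (eqO_sum N N (fun k u => moment nu k * (qp.[y u] ^+ (N.-1 - k) * (Mp.[y u] * v u) ^+ k))
  (fun k u => moment nu k * (q u ^+ (N.-1 - k) * W u ^+ k))) => k _.
have bMv : eqO 0 (fun u => Mp.[y u] * v u) (fun=> 0) := boundedM _ _ bMp bv.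
have eW : eqO N (fun u => Mp.[y u] * v u) W.
  apply: eqO_trans (eqOM N _ _ _ _ bMp bv eM (eqO_refl _ _ _ (fun u _ _ => erefl))) _.
  by apply: eqO_refl => u _ _; rewrite /M /y; ring.
apply: eqOM; [exact: bounded_cst | | exact: eqO_refl | ].
  by apply: boundedM; exact: boundedX.
by apply: eqOM; [exact: boundedX | exact: boundedX | exact: eqOX | exact: eqOX].
Qed.

End free_sum_expansion.

(** * Finite expansion of a Cauchy integral *)

Section cauchy_transform_expansion.
Context {R : realType} (a b P x0 W : R) (p : R -> R).
Notation leb := (@lebesgue_measure R).
Hypothesis p_cont : continuous p.
Hypothesis p_ge0 : forall t, 0 <= p t.
Hypothesis p_le : forall t, p t <= P.
Hypothesis a_ge : -3 <= a.
Hypothesis b_le : b <= 3.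
Hypothesis x0_gt : forall t : R, t \in `[a, b] -> 0 < x0 - t.
Hypothesis ab : a <= b.
Hypothesis cauchy : \int[leb]_(t in `[a, b]) ((x0 - t)^-1 * p t) = W.

(** By the finite geometric sum for x0^N - t^N, the difference equals W^(N-1) times the integral of
    t^N p(t) / (x0 - t); then |t| <= 3 gives the bound. The powers of W are there because in the
    application x0 grows like 1/u, whereas x0 W and W stay bounded. *)
Lemma cauchy_transform_expansion N : (0 < N)%N ->
  `|(x0 * W) ^+ N - \sum_(k < N) \int[leb]_(t in `[a, b]) (t ^+ k * p t) * ((x0 * W) ^+ (N.-1 - k) * W ^+ k)|
    <= 3 ^+ N * W ^+ N.
Proof.
move=> N0; have leb_fin : (leb `[a, b]%classic < +oo)%E.
  by rewrite lebesgue_measure_itv /=; case: ifP => _; rewrite ?ltry // -EFinD ltry.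
have bp : bmeas a b p.
  by apply: (bmeas_continuous _ _ P) => // t; rewrite ger0_norm.
pose w t := (x0 - t)^-1 * p t.
have bw : bmeas a b w.
  apply: bmeasM => //; split.
    apply: subspace_continuous_measurable_fun; first exact: measurable_itv.
    apply: continuous_in_subspaceT => t; rewrite mem_setE => tI.
    apply: cvgV; first by rewrite gt_eqF // x0_gt.
    by apply: cvgB; [exact: cvg_cst | exact: cvg_id].
  exists (x0 - b)^-1 => t tI; have := x0_gt _ tI => h.
  have hb : 0 < x0 - b by apply: x0_gt; rewrite in_itv /= ab lexx.
  rewrite ger0_norm ?invr_ge0 ?(ltW h) // lef_pV2 ?posrE //.
  by move: tI; rewrite in_itv /= => /andP[_ h2]; lra.
have w0 t : t \in `[a, b] -> 0 <= w t.
  by move=> tI; rewrite mulr_ge0 ?invr_ge0 ?p_ge0 // ltW // x0_gt.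
pose I g := wint a b leb w g.
have IW : I (fun=> 1) = W.
  by rewrite -cauchy /I /wint; apply: eq_Rintegral => t _; rewrite mul1r.
have W0 : 0 <= W by rewrite -IW; apply: wint_ge0.
pose Q : {poly R} := \sum_(k < N) x0 ^+ (N.-1 - k) *: 'X^k.
have Qc k : (k < N)%N -> Q`_k = x0 ^+ (N.-1 - k).
  move=> kN; rewrite /Q coef_sum (bigD1 (Ordinal kN)) //= coefZ coefXn eqxx mulr1.
  rewrite big1 ?addr0 // => i ik; rewrite coefZ coefXn.
  by case: eqP => [e|]; rewrite ?mulr0 //; move/eqP: ik; case; apply: val_inj.
have Qs : (size Q <= N)%N.
  rewrite /Q; apply: (leq_trans (size_sum _ _ _)); apply/bigmax_leqP => i _.
  by apply: leq_trans (size_scale_leq _ _) _; rewrite size_polyXn.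
have bX k : bmeas a b (fun t => t ^+ k).
  have -> : (fun t => t ^+ k) = (fun t => ('X^k : {poly R}).[t]); last exact: bmeas_horner.
  by apply/funext => t; rewrite hornerXn.
pose T := I (fun t => t ^+ N).
have E : \sum_(k < N) \int[leb]_(t in `[a, b]) (t ^+ k * p t) * x0 ^+ (N.-1 - k) = x0 ^+ N * W - T.
  transitivity (wint a b leb p (fun t => Q.[t])).
    rewrite (wint_horner _ _ _ _ leb_fin bp).
    rewrite (sum_coef_widen (fun k z => z * wint a b leb p (fun t => t ^+ k)) N) //; last first.
      by move=> i; rewrite mul0r.
    by apply: eq_bigr => k _; rewrite Qc // mulrC.
  transitivity (I (fun t => x0 ^+ N * 1 + -1 * t ^+ N)).
    rewrite /I /wint; apply: eq_Rintegral => t; rewrite mem_setE => tI.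
    have -> : x0 ^+ N * 1 + -1 * t ^+ N = (x0 - t) * Q.[t].
      rewrite mulr1 mulN1r subrXX; congr (_ * _); rewrite /Q horner_sum.
      by apply: eq_bigr => i _; rewrite hornerZ hornerXn -subn1 -subnDA add1n; case: (N) N0 i.
    by rewrite /w [_ * Q.[t]]mulrC -mulrA mulVKf // gt_eqF // x0_gt.
  rewrite /I (wintD _ _ _ _ leb_fin bw); last 2 first.
  - by apply: bmeasM; exact: bmeas_cst.
  - by apply: bmeasM => //; exact: bmeas_cst.
  rewrite !(wintZ _ _ _ _ leb_fin bw) //; last exact: bmeas_cst.
  by rewrite -!/(I _) IW -/T mulN1r.
have -> : (x0 * W) ^+ N - \sum_(k < N) \int[leb]_(t in `[a, b]) (t ^+ k * p t) * ((x0 * W) ^+ (N.-1 - k) * W ^+ k)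
    = W ^+ N.-1 * T.
  have -> : \sum_(k < N) \int[leb]_(t in `[a, b]) (t ^+ k * p t) * ((x0 * W) ^+ (N.-1 - k) * W ^+ k) =
     W ^+ N.-1 * (x0 ^+ N * W - T).
    rewrite -E mulr_sumr; apply: eq_bigr => k _.
    have -> : W ^+ N.-1 = W ^+ (N.-1 - k) * W ^+ k.
      by rewrite -exprD subnK // -ltnS prednK.
    by rewrite exprMn; ring.
  by rewrite exprMn -{2}(prednK N0) exprS; ring.
rewrite normrM ger0_norm ?exprn_ge0 //.
have T1 : T <= 3 ^+ N * W /\ - T <= 3 ^+ N * W.
  have t3 (t : R) : t \in `[a, b] -> `|t ^+ N| <= 3 ^+ N * 1.
    rewrite in_itv /= normrX mulr1 => /andP[h1 h2]; have h3 : `|t| <= 3 by rewrite ler_norml; rewrite (le_trans a_ge h1) (le_trans h2 b_le).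
    by apply: lerXn2r; rewrite ?nnegrE.
  have h1 : T <= I (fun=> 3 ^+ N * 1).
    apply: (wint_le _ _ _ _ leb_fin bw w0) => //; first by apply: bmeasM; exact: bmeas_cst.
    by move=> t tI; apply: le_trans (t3 _ tI); exact: ler_norm.
  have h2 : I (fun t => -1 * t ^+ N) <= I (fun=> 3 ^+ N * 1).
    apply: (wint_le _ _ _ _ leb_fin bw w0).
    - by apply: bmeasM => //; exact: bmeas_cst.
    - by apply: bmeasM; exact: bmeas_cst.
    by move=> t tI; apply: le_trans (t3 _ tI); rewrite mulN1r -normrN ler_norm.
  move: h1 h2; rewrite /I !(wintZ _ _ _ _ leb_fin bw) //; last exact: bmeas_cst.
  by rewrite -!/(I _) IW -/T mulN1r.
have -> : 3 ^+ N * W ^+ N = W ^+ N.-1 * (3 ^+ N * W).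
  by rewrite -{2}(prednK N0) exprSr; ring.
rewrite ler_wpM2l ?exprn_ge0 // ler_norml; case: T1 => ? ?; apply/andP; split => //.
by rewrite lerNl.
Qed.

End cauchy_transform_expansion.

(** * The density has the moments of the free sum *)

Section law_moments.
Context {R : realType} (mu nu : borel_prob R) (n : nat) (L : R).
Local Notation eps := ((Num.sqrt n%:R : R)^-1).
Hypothesis n0 : (0 < n)%N.
Hypothesis mu1 : moment mu 1 = 0.
Hypothesis mu2 : moment mu 2 = 1.
Hypothesis L1 : 1 <= L.
Hypothesis tau_small : tau L eps <= 200^-1.
Hypothesis free_sum : is_free_normalized_sum_law mu n nu.
Context (c s : R) (W_ : nat -> {poly R}) (H A W : R[i] -> R[i]).
Hypothesis c_small : `|c| <= 200^-1.
Hypothesis s_small : `|s| <= 200^-1.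
Hypothesis W_near : forall j, nrm (W_ j - 'X) <= 2^-1 /\ (W_ j)`_0 = 0.
Hypothesis W_lim : forall z, cabs z <= 2 -> forall j,
  cabs (ceval (W_ j) z - W z) <= 12 * 2^-1 ^+ j.
Hypothesis solution : forall z, cabs z <= 2 ->
  [/\ cabs (H z - 1) <= 200^-1,
      1 + z ^+ 2 * H z ^+ 2 * A z = (c%:C%C * z + (1 + s%:C%C) * (1 + z ^+ 2)) * H z *
        (1 + (eps ^+ 2)%:C%C * z ^+ 2 * H z ^+ 2 * A z),
      W z = z * H z * (1 + (eps ^+ 2)%:C%C * (z ^+ 2 * (H z * H z)) * A z)
    & cabs z <= 1 -> forall J, cabs (A z - \sum_(k < J) (moment mu k.+2 * eps ^+ k)%:C%C * (z * H z) ^+ k) <=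
        2 * (L ^+ J.+2 * (2 * eps * cabs z) ^+ J)].
Hypothesis real_solution : forall x : R, `|x| <= 2 ->
  complex.Im (H x%:C%C) = 0 /\ complex.Im (A x%:C%C) = 0.

(** At x0 = c + (1 + s) (u + 1/u) the solved equation reads x0 W = q. Hence the moments of the
    density satisfy, modulo u^N, the same expansion in q and W as those of [nu], and
    [moments_eq_of_expansions] applies to the differences. *)
Lemma law_density_moments k :
  \int[lebesgue_measure]_(t in `[-3, 3]) (t ^+ k * law_density c s W t) = moment nu k.
Proof.
pose h u := complex.Re (H u%:C%C); pose a u := complex.Re (A u%:C%C).
have hE u : `|u| <= 2 -> H u%:C%C = (h u)%:C%C.
  by move=> /real_solution[]; rewrite /h; case: (H _) => x y /= ->.
have aE u : `|u| <= 2 -> A u%:C%C = (a u)%:C%C.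
  by move=> /real_solution[_]; rewrite /a; case: (A _) => x y /= ->.
have real (u : R) : 0 < u -> u <= 2^-1 -> [/\ `|h u - 1| <= 200^-1,
    1 + (u * h u) ^+ 2 * a u = (c + (1 + s) * (u + u^-1)) * complex.Re (W u%:C%C),
    complex.Re (W u%:C%C) = u * h u * (1 + eps ^+ 2 * (u * h u) ^+ 2 * a u)
    & forall J, `|a u - \sum_(k < J) moment mu k.+2 * (eps * (u * h u)) ^+ k| <=
      2 * (L ^+ J.+2 * (2 * eps * u) ^+ J)].
  move=> u0 u1; have u2 : `|u| <= 2 by rewrite gtr0_norm //; lra.
  have /solution[] : cabs (u%:C%C : R[i]) <= 2 by rewrite cabs_real.
  rewrite hE // aE // => h1 h2 h3 h4.
  have injC (x y : R) : x%:C%C = y%:C%C -> x = y by case.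
  pose w := u * h u * (1 + eps ^+ 2 * (u * h u) ^+ 2 * a u).
  have WE : W u%:C%C = w%:C%C.
    by rewrite h3 /w !(rmorphXn, rmorphM, rmorphD, rmorph1) /=; ring.
  rewrite WE /=; split => //.
  - by rewrite -(cabs_real (h u - 1)) rmorphB rmorph1.
  - have q2 : 1 + (u * h u) ^+ 2 * a u = (c * u + (1 + s) * (1 + u ^+ 2)) * h u *
        (1 + eps ^+ 2 * u ^+ 2 * h u ^+ 2 * a u).
      apply: injC; rewrite !(rmorphXn, rmorphM, rmorphD, rmorph1) /= in h2 *.
      by rewrite -h2; ring.
    rewrite q2 /w; field.
    by rewrite !gt_eqF // sqrtr_gt0 ltr0n.
  - move=> J; have := h4 _ J; rewrite cabs_real gtr0_norm // => /(_ _).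
    have -> : \sum_(k < J) (moment mu k.+2 * eps ^+ k)%:C%C * (u%:C%C * (h u)%:C%C) ^+ k =
        (\sum_(k < J) moment mu k.+2 * (eps * (u * h u)) ^+ k)%:C%C.
      rewrite (rmorph_sum (real_complex R)) /=; apply: eq_bigr => i _.
      by rewrite -!(rmorphXn, rmorphM) /= [(eps * _) ^+ i]exprMn mulrA.
    by rewrite -rmorphB cabs_real => h5; apply: h5; lra.
have eps0 : 0 < eps by rewrite invr_gt0 sqrtr_gt0 ltr0n.
have Leps : L ^+ 3 * eps <= 200^-1 * 1000^-1.
  by move: tau_small; rewrite /tau; lra.
have eps1 : eps <= 1.
  have : 1 <= L ^+ 3 by rewrite exprn_ege1.
  by move=> L3; have : 1 * eps <= L ^+ 3 * eps; [rewrite ler_wpM2r // ltW | lra].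
have a_near (u : R) : 0 < u -> u <= 2^-1 -> 2^-1 <= a u <= 2.
  move=> u0 u1; have [_ _ _ /(_ 1%N)] := real u u0 u1.
  rewrite big_ord_recl big_ord0 /= mu2 expr0 mulr1 addr0 expr1.
  have -> : 2 * (L ^+ 3 * (2 * eps * u)) = 4 * u * (L ^+ 3 * eps) by ring.
  have : 4 * u * (L ^+ 3 * eps) <= 2 * (200^-1 * 1000^-1).
    apply: ler_pM => //; rewrite ?mulr_ge0 ?exprn_ge0 ?(ltW u0) ?(ltW eps0) ?(le_trans ler01 L1) //; lra.
  by rewrite ler_norml => h1 /andP[h2 h3]; apply/andP; split; lra.
pose q u := 1 + (u * h u) ^+ 2 * a u.
pose w u := u * h u * (1 + eps ^+ 2 * (u * h u) ^+ 2 * a u).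
have bounds (u : R) : 0 < u -> u <= 2^-1 -> [/\ 1 <= q u, u / 2 <= w u & w u <= 4 * u].
  move=> u0 u1; have [+ _ _ _] := real u u0 u1; have /andP[a1 a2] := a_near _ u0 u1.
  rewrite ler_norml => /andP[h1 h2].
  have v1 : u * (199 / 200) <= u * h u by rewrite ler_wpM2l ?(ltW u0) //; lra.
  have v2 : u * h u <= u * (201 / 200) by rewrite ler_wpM2l ?(ltW u0) //; lra.
  have v0 : 0 <= u * h u by lra.
  have f0 : 0 <= (u * h u) ^+ 2 * a u by rewrite mulr_ge0 ?sqr_ge0 //; lra.
  have v3 : (u * h u) ^+ 2 <= 1 by rewrite exprn_ile1 //; lra.
  have f1 : (u * h u) ^+ 2 * a u <= 1 * 2 by apply: ler_pM; rewrite ?sqr_ge0 //; lra.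
  have e2 : eps ^+ 2 <= 1 by rewrite exprn_ile1 // ltW.
  have g0 : 0 <= eps ^+ 2 * ((u * h u) ^+ 2 * a u) by rewrite mulr_ge0 ?sqr_ge0.
  have g1 : eps ^+ 2 * ((u * h u) ^+ 2 * a u) <= 1 * (1 * 2) by apply: ler_pM; rewrite ?sqr_ge0.
  rewrite /q /w -[eps ^+ 2 * _ * _]mulrA; split; first by lra.
    by apply: (@le_trans _ _ (u * h u * 1)); [lra | rewrite ler_wpM2l //; lra].
  apply: (@le_trans _ _ (u * h u * 3)); last by lra.
  by rewrite ler_wpM2l //; lra.
have cs := c_small; have ss := s_small.
move: cs ss; rewrite !ler_norml => /andP[c1 c2] /andP[s1 s2].
have a3 : -3 <= c - 2 * (1 + s) by lra.
have b3 : c + 2 * (1 + s) <= 3 by lra.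
rewrite (law_density_moment c s W_ W) //.
apply/eqP; rewrite eq_sym -subr_eq0; apply/eqP; move: k.
apply: (moments_eq_of_expansions q w 4) => [u u0 u1|u u0 u1|u u0 u1|N N1]; try by case: (bounds u u0 u1).
have hb : eqO 0 h (fun=> 0).
  exists 2 => u u0 u1; have [+ _ _ _] := real u u0 u1.
  by rewrite subr0 expr0 mulr1 !ler_norml => /andP[? ?]; apply/andP; split; lra.
have aexp J : eqO J a (fun u => \sum_(k < J) moment mu k.+2 * (eps * (u * h u)) ^+ k).
  exists (2 * (L ^+ J.+2 * (2 * eps) ^+ J)) => u u0 u1; have [_ _ _ /(_ J)] := real u u0 u1.
  by rewrite [(_ * u) ^+ J]exprMn !mulrA.
have [B hB] := free_sum_expansion mu nu n h a n0 mu1 free_sum hb aexp N N1.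
exists (B + 3 ^+ N * 4 ^+ N) => u u0 u1; have := hB u u0 u1.
have [_ qE wE _] := real u u0 u1; have [q1 w1 w2] := bounds u u0 u1.
have w0 : 0 <= w u by apply: le_trans w1; rewrite divr_ge0 // ltW.
have ab : c - 2 * (1 + s) <= c + 2 * (1 + s) by lra.
have := cauchy_transform_expansion (c - 2 * (1 + s)) (c + 2 * (1 + s)) (3 / pi)
  (c + (1 + s) * (u + u^-1)) (complex.Re (W u%:C%C)) (law_density c s W)
  (continuous_law_density c s W_ W W_near W_lim)
  (law_density_ge0 c s W_ W W_near W_lim) (law_density_le c s W_ W W_near W_lim)
  a3 b3 (cauchy_point_gt c s s_small u u0 u1) ab (law_density_cauchy c s W_ W s_small W_near W_lim u u0 u1) N (ltnW N1).
rewrite -qE wE -/(q u) -/(w u) => h1 h2.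
rewrite subr0; under eq_bigr do rewrite mulrBl; rewrite sumrB.
set S1 := \sum_(_ < _) _; set S2 := \sum_(_ < _) _.
have -> : S1 - S2 = (q u ^+ N - S2) - (q u ^+ N - S1) by ring.
apply: le_trans (ler_normB _ _) _; rewrite addrC mulrDl; apply: lerD; first exact: h2.
apply: le_trans h1 _.
rewrite -mulrA ler_wpM2l ?exprn_ge0 // -exprMn; apply: lerXn2r; rewrite ?nnegrE ?w0 //.
by rewrite mulr_ge0 ?ltW.
Qed.

End law_moments.

(** * Expansion in the inverse square root of n *)

Section jets.
Context {R : realType} {I : Type} (D : I -> Prop) (e : I -> R).
Hypothesis e01 : forall i, D i -> 0 < e i <= 1.
Implicit Types (F G r f g : I -> R[i]).

Definition bdd F := exists C : R, forall i, D i -> cabs (F i) <= C.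

Lemma bdd_cst (z : R[i]) : bdd (fun=> z).
Proof. by exists (cabs z). Qed.

Lemma bddD F G : bdd F -> bdd G -> bdd (fun i => F i + G i).
Proof.
move=> [C hC] [C' hC']; exists (C + C') => i Di.
by apply: le_trans (cabsD _ _) _; rewrite lerD ?hC ?hC'.
Qed.

Lemma bddN F : bdd F -> bdd (fun i => - F i).
Proof. by move=> [C hC]; exists C => i Di; rewrite cabsN hC. Qed.

Lemma bddM F G : bdd F -> bdd G -> bdd (fun i => F i * G i).
Proof.
move=> [C hC] [C' hC']; exists (C * C') => i Di.
by rewrite cabsM ler_pM ?cabs_ge0 ?hC ?hC'.
Qed.

Lemma bddX F n : bdd F -> bdd (fun i => F i ^+ n).
Proof.
move=> h; elim: n => [|n IH]; first exact: bdd_cst.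
have [C hC] := bddM _ _ h IH.
by exists C => i Di; rewrite exprS hC.
Qed.

Lemma bdd_eps : bdd (fun i => (e i)%:C%C).
Proof.
exists 1 => i Di; have /andP[e0 e1] := e01 i Di.
by rewrite cabs_real ger0_norm // ltW.
Qed.

Lemma bdd_eq F G : (forall i, D i -> F i = G i) -> bdd G -> bdd F.
Proof. by move=> h [C hC]; exists C => i Di; rewrite h // hC. Qed.

(** Third order expansions whose coefficients may depend on the instance i. One bound serves all
    instances in D; this is the uniformity in n and x. *)
Definition jet F f0 f1 f2 f3 :=
  [/\ bdd f0, bdd f1, bdd f2, bdd f3 & exists2 r, bdd r &
    forall i, D i -> let ep := (e i)%:C%C in
      F i = f0 i + ep * f1 i + ep ^+ 2 * f2 i + ep ^+ 3 * f3 i + ep ^+ 4 * r i].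

Lemma jet_bdd F f0 f1 f2 f3 : jet F f0 f1 f2 f3 -> bdd F.
Proof.
move=> [b0 b1 b2 b3 [r br h]]; apply: bdd_eq h _.
by repeat first [exact: b0 | exact: b1 | exact: b2 | exact: b3 | exact: br
  | apply: bddD | apply: bddM | apply: bddX | exact: bdd_eps].
Qed.

Lemma jet_cst F : bdd F -> jet F F (fun=> 0) (fun=> 0) (fun=> 0).
Proof.
by move=> b; split; try exact: bdd_cst; [exact: b | exists (fun=> 0); [exact: bdd_cst|]] => // i _ /=; ring.
Qed.

Lemma jet_eps : jet (fun i => (e i)%:C%C) (fun=> 0) (fun=> 1) (fun=> 0) (fun=> 0).
Proof.
by split; try exact: bdd_cst; exists (fun=> 0); [exact: bdd_cst | move=> i _ /=; ring].
Qed.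

Lemma jetD F f0 f1 f2 f3 G g0 g1 g2 g3 :
  jet F f0 f1 f2 f3 -> jet G g0 g1 g2 g3 ->
  jet (fun i => F i + G i) (fun i => f0 i + g0 i) (fun i => f1 i + g1 i)
    (fun i => f2 i + g2 i) (fun i => f3 i + g3 i).
Proof.
move=> [b0 b1 b2 b3 [r br h]] [c0 c1 c2 c3 [t bt h']].
split; try exact: bddD; exists (fun i => r i + t i); first exact: bddD.
by move=> i Di /=; rewrite (h i Di) (h' i Di); ring.
Qed.

Lemma jetN F f0 f1 f2 f3 : jet F f0 f1 f2 f3 ->
  jet (fun i => - F i) (fun i => - f0 i) (fun i => - f1 i) (fun i => - f2 i) (fun i => - f3 i).
Proof.
move=> [b0 b1 b2 b3 [r br h]].
split; try exact: bddN; exists (fun i => - r i); first exact: bddN.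
by move=> i Di /=; rewrite (h i Di); ring.
Qed.

Lemma jetM F f0 f1 f2 f3 G g0 g1 g2 g3 :
  jet F f0 f1 f2 f3 -> jet G g0 g1 g2 g3 ->
  jet (fun i => F i * G i) (fun i => f0 i * g0 i)
    (fun i => f0 i * g1 i + f1 i * g0 i)
    (fun i => f0 i * g2 i + f1 i * g1 i + f2 i * g0 i)
    (fun i => f0 i * g3 i + f1 i * g2 i + f2 i * g1 i + f3 i * g0 i).
Proof.
move=> jF jG; have bG := jet_bdd _ _ _ _ _ jG.
move: jF jG => [b0 b1 b2 b3 [r br h]] [c0 c1 c2 c3 [t bt h']].
split; try by repeat (apply: bddD || apply: bddM).
exists (fun i => r i * G i + (f1 i * g3 i + f2 i * g2 i + f3 i * g1 i)
  + (e i)%:C%C * (f2 i * g3 i + f3 i * g2 i) + (e i)%:C%C ^+ 2 * (f3 i * g3 i)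
  + (f0 i + (e i)%:C%C * f1 i + (e i)%:C%C ^+ 2 * f2 i + (e i)%:C%C ^+ 3 * f3 i) * t i).
  by repeat first [done | exact: bdd_eps | apply: bddD | apply: bddM | apply: bddX].
move=> i Di /=; rewrite (h i Di) /= mulrDl {1}(h' i Di) /=.
by move: (G i) => Gi; ring.
Qed.

Lemma jet_ext F F' f0 f1 f2 f3 g0 g1 g2 g3 : jet F f0 f1 f2 f3 ->
  (forall i, D i -> F' i = F i) ->
  (forall i, D i -> [/\ f0 i = g0 i, f1 i = g1 i, f2 i = g2 i & f3 i = g3 i]) ->
  jet F' g0 g1 g2 g3.
Proof.
move=> [b0 b1 b2 b3 [r br h]] hF hf; split.
- by apply: bdd_eq b0 => i /hf[].
- by apply: bdd_eq b1 => i /hf[].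
- by apply: bdd_eq b2 => i /hf[].
- by apply: bdd_eq b3 => i /hf[].
- by exists r => // i Di; have [<- <- <- <-] := hf i Di; rewrite hF // h.
Qed.

Lemma jet0_bdd F : jet F (fun=> 0) (fun=> 0) (fun=> 0) (fun=> 0) ->
  exists2 r, bdd r & forall i, D i -> F i = (e i)%:C%C ^+ 4 * r i.
Proof.
by move=> [_ _ _ _ [r br h]]; exists r => // i Di; rewrite h //=; ring.
Qed.

End jets.

(** * Closed form of the coefficients *)

Section imaginary_parts.
Context {R : realType}.
Implicit Types (z w : R[i]).

Lemma ImM z w : complex.Im (z * w) =
  complex.Re z * complex.Im w + complex.Im z * complex.Re w.
Proof. by case: z; case: w. Qed.

Lemma imaginary_coefficients (c s l3 l4 l5 : R) :
  0 < s -> c ^+ 2 + s ^+ 2 = 1 ->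
  let e := (c +i* s)%C in
  let Di := (0 -i* (2 * s)^-1)%C in
  let k3 := l3%:C%C in let k4 := l4%:C%C in let k5 := l5%:C%C in
  let g1 := - (k3 * e ^+ 3) * Di in
  let g2 := - (g1 ^+ 2 + 3 * k3 * e ^+ 2 * g1 + k4 * e ^+ 4) * Di in
  let g3 := - (2 * g1 * g2 + k3 * (3 * e ^+ 2 * g2 + 3 * e * g1 ^+ 2)
    + 4 * k4 * e ^+ 3 * g1 + k5 * e ^+ 5) * Di in
  let x := 2 * c in
  [/\ complex.Im g1 = l3 * (x ^+ 2 - 3) * x * s / (4 - x ^+ 2),
      complex.Im g2 = - ((l4 * (x ^+ 6 - 8 * x ^+ 4 + 18 * x ^+ 2 - 8)
     - l3 ^+ 2 * (2 * x ^+ 6 - 15 * x ^+ 4 + 30 * x ^+ 2 - 10)) * s / (4 - x ^+ 2) ^+ 2)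
   & complex.Im g3 = (l5 * (x ^+ 4 - 5 * x ^+ 2 + 5) * x / (4 - x ^+ 2)
     + l3 * l4 * (5 * x ^+ 6 - 42 * x ^+ 4 + 105 * x ^+ 2 - 70) * x
       / (4 - x ^+ 2) ^+ 2
     + l3 ^+ 3 * (5 * x ^+ 8 - 60 * x ^+ 6 + 252 * x ^+ 4 - 420 * x ^+ 2 + 210)
       * x / (4 - x ^+ 2) ^+ 3) * s].
Proof.
move=> s0 cs e Di k3 k4 k5 g1 g2 g3 x.
have c1 : 0 < 1 + c by nra.
have s2 : s ^+ 2 = 1 - c ^+ 2 by rewrite -cs addrC addKr.
have [t t0 [cE sE]] : exists2 t, 0 < t &
    c = (1 - t ^+ 2) / (1 + t ^+ 2) /\ s = 2 * t / (1 + t ^+ 2).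
  have c10 : 1 + c != 0 by rewrite gt_eqF.
  exists (s / (1 + c)); first exact: divr_gt0.
  have -> : 1 + (s / (1 + c)) ^+ 2 = 2 / (1 + c) by rewrite expr_div_n s2; field.
  by split; [rewrite expr_div_n s2|]; field.
have tn : t != 0 by rewrite gt_eqF.
have tt0 : 1 + t ^+ 2 != 0 by rewrite gt_eqF // ltr_wpDr ?sqr_ge0.
have y0 : 4 - x ^+ 2 = 4 * s ^+ 2 by rewrite /x s2; ring.
rewrite y0.
have sn : s != 0 by rewrite gt_eqF.
pose e2r := c ^+ 2 - s ^+ 2; pose e2i := 2 * c * s.
pose e3r := c ^+ 3 - 3 * c * s ^+ 2; pose e3i := 3 * c ^+ 2 * s - s ^+ 3.
have pairE (a b a' b' : R) : a = a' -> b = b' -> (a +i* b)%C = (a' +i* b')%C by move=> -> ->.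
have mulE (a b a' b' : R) : (a +i* b)%C * (a' +i* b')%C = ((a * a' - b * b') +i* (a * b' + b * a'))%C by [].
have addE (a b a' b' : R) : (a +i* b)%C + (a' +i* b')%C = ((a + a') +i* (b + b'))%C by [].
have DiE (a b : R) : - (a +i* b)%C * Di = (- b / (2 * s) +i* (a / (2 * s)))%C.
  by rewrite /Di; apply: pairE; field.
have kE (k a b : R) : k%:C%C * (a +i* b)%C = (k * a +i* (k * b))%C.
  by apply: pairE; ring.
have E2 : e ^+ 2 = (e2r +i* e2i)%C by rewrite expr2 /e mulE; apply: pairE; rewrite /e2r /e2i; ring.
have E3 : e ^+ 3 = (e3r +i* e3i)%C by rewrite exprS E2 /e mulE; apply: pairE; rewrite /e2r /e2i /e3r /e3i; ring.
have E4 : e ^+ 4 = ((e2r * e2r - e2i * e2i) +i* (e2r * e2i + e2i * e2r))%C.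
  by rewrite -[4%N]/(2 + 2)%N exprD E2 mulE.
have E5 : e ^+ 5 = ((e2r * e3r - e2i * e3i) +i* (e2r * e3i + e2i * e3r))%C.
  by rewrite -[5%N]/(2 + 3)%N exprD E2 E3 mulE.
pose u := l3 * e3r; pose v := l3 * e3i.
have g1E : g1 = (- v / (2 * s) +i* (u / (2 * s)))%C.
  by rewrite /g1 E3 /k3 kE DiE.
pose a := - v / (2 * s); pose b := u / (2 * s); rewrite -/a -/b in g1E.
pose xr := a * a - b * b + 3 * l3 * (e2r * a - e2i * b) + l4 * (e2r * e2r - e2i * e2i).
pose xi := a * b + b * a + 3 * l3 * (e2r * b + e2i * a) + l4 * (e2r * e2i + e2i * e2r).
have g2E : g2 = (- xi / (2 * s) +i* (xr / (2 * s)))%C.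
  have -> : g2 = - (g1 * g1 + (3 * l3)%:C%C * (e ^+ 2 * g1) + k4 * e ^+ 4) * Di.
    by rewrite /g2 rmorphM /= (rmorph_nat (real_complex R)) /k3; ring.
  rewrite g1E E2 E4 /k4 (mulE a b a b) (mulE e2r e2i a b) !kE !addE DiE.
  by apply: pairE; rewrite /xi /xr; ring.
pose a2 := - xi / (2 * s); pose b2 := xr / (2 * s); rewrite -/a2 -/b2 in g2E.
pose yr := 2 * (a * a2 - b * b2) + l3 * (3 * (e2r * a2 - e2i * b2)
   + 3 * (c * (a * a - b * b) - s * (a * b + b * a)))
   + 4 * l4 * (e3r * a - e3i * b) + l5 * (e2r * e3r - e2i * e3i).
have g3E : complex.Im g3 = yr / (2 * s).
  have -> : g3 = - ((2 : R)%:C%C * (g1 * g2) + l3%:C%C * ((3 : R)%:C%C * (e ^+ 2 * g2)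
      + (3 : R)%:C%C * (e * (g1 * g1))) + (4 * l4)%:C%C * (e ^+ 3 * g1) + k5 * e ^+ 5) * Di.
    by rewrite /g3 rmorphM /= !(rmorph_nat (real_complex R)) /k3 /k4; ring.
  rewrite g1E g2E E2 E3 E5 /k5 /e.
  have ImDi Y : complex.Im (- Y * Di) = complex.Re Y / (2 * s) by case: Y => p q; rewrite DiE.
  by rewrite ImDi /=; congr (_ / _); rewrite /yr; ring.
rewrite g3E g2E g1E; split=> /=;
  rewrite /yr /b2 /a2 /xr /xi /b /a /u /v /e3r /e3i /e2r /e2i /x sE cE;
  by field; rewrite tn tt0.
Qed.
End imaginary_parts.

(** * Stability of the perturbed quadratic equation *)

Section expansion.
Context {R : realType} (delta K a1 a2 a3 : R).
Hypothesis delta0 : 0 < delta.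
Hypothesis delta1 : delta < 1.

(* An instance of 1 + v^2 A = x W at n = ep^-2, v = vv, x = xx, where ep^4 tl is
   the tail of A; the estimates are uniform over the valid instances. *)
Record config := Config { ep : R; vv : R[i]; tl : R[i]; xx : R }.

Definition cfgA i := 1 + (ep i)%:C%C * (a1%:C%C * vv i)
  + (ep i)%:C%C ^+ 2 * (a2%:C%C * vv i ^+ 2)
  + (ep i)%:C%C ^+ 3 * (a3%:C%C * vv i ^+ 3) + (ep i)%:C%C ^+ 4 * tl i.
Definition cfgW i := vv i + (ep i)%:C%C * (ep i)%:C%C * (vv i ^+ 3 * cfgA i).
Local Notation A := cfgA.
Local Notation W := cfgW.

Definition valid i :=
  [/\ 0 < ep i <= 1 /\ cabs (vv i) <= 2, cabs (tl i) <= K,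
      - 2 + 2 * delta <= xx i <= 2 - 2 * delta,
      1 + vv i ^+ 2 * A i = (xx i)%:C%C * W i & 0 <= complex.Im (W i)].

Let cc i := xx i / 2.
Let ss i := Num.sqrt (1 - cc i ^+ 2).
Let root i : R[i] := (cc i +i* ss i)%C.
Let croot i : R[i] := (cc i -i* ss i)%C.

Let ss_ge i : valid i -> delta <= ss i.
Proof.
move=> [_ _ /andP[h1 h2] _ _]; rewrite /ss -(ger0_norm (ltW delta0)) -sqrtr_sqr.
have p : 0 <= (2 - 2 * delta - xx i) * (2 - 2 * delta + xx i).
  by rewrite mulr_ge0 //; lra.
have q : 0 <= delta * (1 - delta) by rewrite mulr_ge0 ?(ltW delta0) //; lra.
by apply: ler_wsqrtr; rewrite /cc; lra.
Qed.

Let ss2 i : valid i -> ss i ^+ 2 = 1 - cc i ^+ 2.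
Proof.
move=> [_ _ /andP[h1 h2] _ _]; rewrite /ss sqr_sqrtr //.
have p : 0 <= (2 - 2 * delta - xx i) * (2 - 2 * delta + xx i).
  by rewrite mulr_ge0 //; lra.
have q : 0 <= delta * (1 - delta) by rewrite mulr_ge0 ?(ltW delta0) //; lra.
by rewrite /cc; nra.
Qed.

Let rootD i : root i + croot i = (xx i)%:C%C.
Proof. by rewrite /root /croot /cc; apply/eqP; rewrite eq_complex /= subrr eqxx -splitr eqxx. Qed.

Let rootM i : valid i -> root i * croot i = 1.
Proof.
move=> vi; have := ss2 i vi; rewrite /root /croot => h; apply/eqP; rewrite eq_complex /=.
by apply/andP; split; apply/eqP; [rewrite mulrN opprK -!expr2 h addrC subrK | ring].
Qed.

Let Dinv i : R[i] := (0 -i* (2 * ss i)^-1)%C.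
Let DD i : R[i] := root i - croot i.

Let DDE i : DD i = (0 +i* (2 * ss i))%C.
Proof.
by rewrite /DD /root /croot; apply/eqP; rewrite eq_complex /= subrr eqxx /=; apply/eqP; ring.
Qed.

Let DDinv i : valid i -> DD i * Dinv i = 1.
Proof.
move=> vi; have s0 : ss i != 0 by rewrite gt_eqF // (lt_le_trans delta0) // ss_ge.
by rewrite DDE /Dinv; apply/eqP; rewrite eq_complex /=; apply/andP; split; apply/eqP; field.
Qed.

Let k3 : R[i] := a1%:C%C.
Let k4 : R[i] := a2%:C%C - 2.
Let k5 : R[i] := a3%:C%C - 5 * a1%:C%C.

(** These cancel the coefficients of ep, ep^2 and ep^3 in [Q i (W1 i)] one after another. The linear
    coefficient is always 2 root - x = root - croot, with inverse [Dinv]. *)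
Let g1 i := - (k3 * root i ^+ 3) * Dinv i.
Let g2 i := - (g1 i ^+ 2 + 3 * k3 * root i ^+ 2 * g1 i + k4 * root i ^+ 4) * Dinv i.
Let g3 i := - (2 * g1 i * g2 i + k3 * (3 * root i ^+ 2 * g2 i + 3 * root i * g1 i ^+ 2)
  + 4 * k4 * root i ^+ 3 * g1 i + k5 * root i ^+ 5) * Dinv i.
Let W1 i := root i + (ep i)%:C%C * g1 i + (ep i)%:C%C ^+ 2 * g2 i + (ep i)%:C%C ^+ 3 * g3 i.

Let e01 i : valid i -> 0 < ep i <= 1. Proof. by case=> [[]]. Qed.

Let b_ep := bdd_eps valid ep e01.
Let b_v : bdd valid vv. Proof. by exists 2 => i [[_ h]]. Qed.
Let b_tl : bdd valid tl. Proof. by exists K => i [_ h]. Qed.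
Let b_x : bdd valid (fun i => (xx i)%:C%C).
Proof.
exists 2 => i [_ _ /andP[h1 h2] _ _]; rewrite cabs_real ler_norml.
by have := delta0; lra.
Qed.
Let cc_le i : valid i -> `|cc i| <= 1.
Proof.
move=> [_ _ /andP[h1 h2] _ _]; rewrite ler_norml /cc.
by have := delta0; lra.
Qed.
Let ss_le i : valid i -> `|ss i| <= 1.
Proof.
move=> vi; rewrite ger0_norm ?sqrtr_ge0 //.
by rewrite -[1](sqrtr1) ler_wsqrtr // lerBlDr lerDl sqr_ge0.
Qed.
Let b_root : bdd valid root.
Proof.
exists 2 => i vi; apply: le_trans (cabs_le_ReIm _) _ => /=.
have h1 := cc_le i vi; have h2 := ss_le i vi; lra.
Qed.
Let b_croot : bdd valid croot.
Proof.
exists 2 => i vi; apply: le_trans (cabs_le_ReIm _) _ => /=.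
have h1 := cc_le i vi; have h2 := ss_le i vi; rewrite normrN; lra.
Qed.
Let b_Dinv : bdd valid Dinv.
Proof.
exists delta^-1 => i vi; apply: le_trans (cabs_le_ReIm _) _ => /=.
have h := ss_ge i vi.
rewrite normr0 add0r normrN normfV lef_pV2 ?posrE ?normr_gt0 //.
  by rewrite ger0_norm ?mulr_ge0 ?sqrtr_ge0 //; have := delta0; lra.
by rewrite gt_eqF // mulr_gt0 // (lt_le_trans delta0).
Qed.

Ltac bdds := lazymatch goal with
  | |- bdd _ (fun i => @?F i + @?G i) => apply: (bddD _ F G); bdds
  | |- bdd _ (fun i => - @?F i) => apply: (bddN _ F); bdds
  | |- bdd _ (fun i => @?F i * @?G i) => apply: (bddM _ F G); bdds
  | |- bdd _ (fun i => @?F i ^+ ?n) => apply: (bddX _ F n); bdds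
  | H : bdd valid ?F |- bdd valid ?F => exact: H
  | H : bdd valid ?F |- bdd valid (fun i => ?F i) => exact: H
  | |- _ => exact: bdd_cst
  end.

Let b_g1 : bdd valid g1. Proof. by rewrite /g1; bdds. Qed.
Let b_g2 : bdd valid g2. Proof. by rewrite /g2; bdds. Qed.
Let b_g3 : bdd valid g3. Proof. by rewrite /g3; bdds. Qed.
Let b_A : bdd valid A. Proof. by rewrite /A; bdds. Qed.
Let b_W : bdd valid W. Proof. by rewrite /W; bdds. Qed.
Let b_W1 : bdd valid W1. Proof. by rewrite /W1; bdds. Qed.

Let jet_v := jet_cst valid ep vv b_v.
Let j_ep := jet_eps valid ep.
Let jk3 := jet_cst valid ep (fun=> k3) (bdd_cst _ _).
Let jk4 := jet_cst valid ep (fun=> k4) (bdd_cst _ _).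
Let jk5 := jet_cst valid ep (fun=> k5) (bdd_cst _ _).

Let jet_A : jet valid ep A (fun=> 1) (fun i => a1%:C%C * vv i)
  (fun i => a2%:C%C * vv i ^+ 2) (fun i => a3%:C%C * vv i ^+ 3).
Proof.
split; try by bdds.
by exists tl.
Qed.

Let jet_W : jet valid ep W vv (fun=> 0) (fun i => vv i ^+ 3) (fun i => a1%:C%C * vv i ^+ 4).
Proof.
have jv3 := jet_cst valid ep (fun i => vv i ^+ 3) (bddX _ _ _ b_v).
have := jetD _ _ _ _ _ _ _ _ _ _ _ _ jet_v (jetM _ _ e01 _ _ _ _ _ _ _ _ _ _
  (jetM _ _ e01 _ _ _ _ _ _ _ _ _ _ j_ep j_ep) (jetM _ _ e01 _ _ _ _ _ _ _ _ _ _ jv3 jet_A)).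
move=> h; apply: jet_ext h _ _ => // i vi; split=> /=; ring.
Qed.

Let jet_W1 : jet valid ep W1 root g1 g2 g3.
Proof.
split=> //; exists (fun=> 0); first exact: bdd_cst.
by move=> i vi /=; rewrite mulr0 addr0.
Qed.

(** [Q i w = 0] is x = 1/w + R(w) multiplied by w, where R is the R-transform of mu_n cut after the
    fifth free cumulant; the j-th cumulant of mu_n is ep^(j-2) times that of mu. Powers are written
    as products to match [jetM]. *)
Let Qh i (w : R[i]) := (ep i)%:C%C * k3 * (w * w * w)
  + (ep i)%:C%C * (ep i)%:C%C * k4 * (w * w * (w * w))
  + (ep i)%:C%C * ((ep i)%:C%C * (ep i)%:C%C) * k5 * (w * w * (w * w * w)).
Let Q i (w : R[i]) := w * w + 1 - (xx i)%:C%C * w + Qh i w.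

Let jet_Qh F f0 f1 f2 f3 : jet valid ep F f0 f1 f2 f3 ->
  jet valid ep (fun i => Qh i (F i)) (fun=> 0) (fun i => k3 * f0 i ^+ 3)
    (fun i => 3 * k3 * f0 i ^+ 2 * f1 i + k4 * f0 i ^+ 4)
    (fun i => k3 * (3 * f0 i ^+ 2 * f2 i + 3 * f0 i * f1 i ^+ 2)
      + 4 * k4 * f0 i ^+ 3 * f1 i + k5 * f0 i ^+ 5).
Proof.
move=> jF; have M := jetM _ _ e01 _ _ _ _ _ _ _ _ _ _.
have j2 := M _ _ _ _ _ _ _ _ _ _ jF jF; have j3 := M _ _ _ _ _ _ _ _ _ _ j2 jF.
have je2 := M _ _ _ _ _ _ _ _ _ _ j_ep j_ep.
have h := jetD _ _ _ _ _ _ _ _ _ _ _ _ (jetD _ _ _ _ _ _ _ _ _ _ _ _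
  (M _ _ _ _ _ _ _ _ _ _ (M _ _ _ _ _ _ _ _ _ _ j_ep jk3) j3)
  (M _ _ _ _ _ _ _ _ _ _ (M _ _ _ _ _ _ _ _ _ _ je2 jk4) (M _ _ _ _ _ _ _ _ _ _ j2 j2)))
  (M _ _ _ _ _ _ _ _ _ _ (M _ _ _ _ _ _ _ _ _ _ (M _ _ _ _ _ _ _ _ _ _ j_ep je2) jk5) (M _ _ _ _ _ _ _ _ _ _ j2 j3)).
by apply: jet_ext h _ _ => // i vi; split=> /=; ring.
Qed.

(** Validity replaces x W by 1 + v^2 A; what remains expands in ep with coefficients polynomial in
    v. Their identical vanishing is what dictates k4 = a2 - 2 and k5 = a3 - 5 a1. *)
Let QW : exists2 r, bdd valid r & forall i, valid i -> Q i (W i) = (ep i)%:C%C ^+ 4 * r i.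
Proof.
apply: jet0_bdd.
have j1 := jet_cst valid ep (fun=> 1) (bdd_cst _ _).
have jv2 := jet_cst valid ep (fun i => vv i ^+ 2) (bddX _ _ _ b_v).
have M := jetM _ _ e01 _ _ _ _ _ _ _ _ _ _.
have h := jetD _ _ _ _ _ _ _ _ _ _ _ _ (jetD _ _ _ _ _ _ _ _ _ _ _ _
   (jetD _ _ _ _ _ _ _ _ _ _ _ _ (M _ _ _ _ _ _ _ _ _ _ jet_W jet_W) j1)
   (jetN _ _ _ _ _ _ _ (jetD _ _ _ _ _ _ _ _ _ _ _ _ j1 (M _ _ _ _ _ _ _ _ _ _ jv2 jet_A))))
   (jet_Qh _ _ _ _ _ jet_W).
apply: jet_ext h _ _.
  by move=> i [_ _ _ h _]; rewrite /Q -h.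
by move=> i vi; split=> /=; rewrite /k3 /k4 /k5; ring.
Qed.

Let QW1 : exists2 r, bdd valid r & forall i, valid i -> Q i (W1 i) = (ep i)%:C%C ^+ 4 * r i.
Proof.
apply: jet0_bdd.
have j1 := jet_cst valid ep (fun=> 1) (bdd_cst _ _).
have jx := jet_cst valid ep _ b_x.
have M := jetM _ _ e01 _ _ _ _ _ _ _ _ _ _.
have h := jetD _ _ _ _ _ _ _ _ _ _ _ _ (jetD _ _ _ _ _ _ _ _ _ _ _ _
   (jetD _ _ _ _ _ _ _ _ _ _ _ _ (M _ _ _ _ _ _ _ _ _ _ jet_W1 jet_W1) j1)
   (jetN _ _ _ _ _ _ _ (M _ _ _ _ _ _ _ _ _ _ jx jet_W1)))
   (jet_Qh _ _ _ _ _ jet_W1).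
apply: jet_ext h _ _ => // i vi; rewrite -(rootD i).
have d1 : 1 - DD i * Dinv i = 0 by rewrite DDinv // subrr.
split=> /=.
- have -> : root i * root i + 1 + - ((root i + croot i) * root i) + 0 = 1 - root i * croot i by ring.
  by rewrite rootM // subrr.
- transitivity (k3 * root i ^+ 3 * (1 - DD i * Dinv i)); last by rewrite d1 mulr0.
  by rewrite /g1 /DD; ring.
- transitivity ((g1 i ^+ 2 + 3 * k3 * root i ^+ 2 * g1 i + k4 * root i ^+ 4) * (1 - DD i * Dinv i)); last by rewrite d1 mulr0.
  by rewrite /g2 /DD; ring.
- transitivity ((2 * g1 i * g2 i + k3 * (3 * root i ^+ 2 * g2 i + 3 * root i * g1 i ^+ 2)
  + 4 * k4 * root i ^+ 3 * g1 i + k5 * root i ^+ 5) * (1 - DD i * Dinv i)); last by rewrite d1 mulr0.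
  by rewrite /g3 /DD; ring.
Qed.

Let cabs_ep i : valid i -> cabs (ep i)%:C%C = ep i.
Proof. by move=> /e01/andP[h _]; rewrite cabs_real ger0_norm // ltW. Qed.

(** (W - root) (W - croot) is O(ep), and Im W >= 0 keeps W at distance at least delta from [croot]:
    the sign selects the root. *)
Let W_root : exists C, forall i, valid i -> cabs (W i - root i) <= C * ep i.
Proof.
have [r [Cr hr] hQ] := QW.
have b_q : bdd valid (fun i => (ep i)%:C%C ^+ 3 * r i - (k3 * (W i * W i * W i)
  + (ep i)%:C%C * k4 * (W i * W i * (W i * W i))
  + ((ep i)%:C%C * (ep i)%:C%C) * k5 * (W i * W i * (W i * W i * W i)))).
  by have br : bdd valid r; [exists Cr | bdds].
have [C hC] := b_q; exists (C / delta) => i vi.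
have e0 : 0 < ep i by have /andP[] := e01 i vi.
rewrite mulrAC ler_pdivlMr //.
have lower : delta <= cabs (W i - croot i).
  apply: le_trans (Im_le_cabs _); rewrite ImD ImN.
  have -> : complex.Im (croot i) = - ss i by [].
  rewrite opprK; have [_ _ _ _ im] := vi; have h := ss_ge i vi.
  have d0 := delta0; by rewrite ger0_norm; lra.
apply: (@le_trans _ _ (cabs (W i - root i) * cabs (W i - croot i))).
  by rewrite ler_wpM2l ?cabs_ge0.
rewrite -cabsM.
have -> : (W i - root i) * (W i - croot i) = (ep i)%:C%C * ((ep i)%:C%C ^+ 3 * r i - (k3 * (W i * W i * W i)
  + (ep i)%:C%C * k4 * (W i * W i * (W i * W i))
  + ((ep i)%:C%C * (ep i)%:C%C) * k5 * (W i * W i * (W i * W i * W i)))).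
  have -> : (W i - root i) * (W i - croot i) = Q i (W i) - Qh i (W i) + (root i * croot i - 1).
    by rewrite /Q -(rootD i); ring.
  by rewrite (hQ i vi) (rootM i vi) subrr addr0 /Qh; ring.
by rewrite cabsM (cabs_ep i vi) mulrC ler_wpM2r ?(ltW e0) // hC.
Qed.

Let Q_diff (F : comRingType) (E x l3 l4 l5 w w1 : F) :
  let q u := u * u + 1 - x * u + (E * l3 * (u * u * u) + E * E * l4 * (u * u * (u * u))
    + E * (E * E) * l5 * (u * u * (u * u * u))) in
  q w - q w1 = (w - w1) * (w + w1 - x + E * (l3 * (w * w + w * w1 + w1 * w1)
    + E * l4 * ((w + w1) * (w * w + w1 * w1))
    + E * E * l5 * (w ^+ 4 + w ^+ 3 * w1 + w ^+ 2 * w1 ^+ 2 + w * w1 ^+ 3 + w1 ^+ 4))).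
Proof. by move=> q; rewrite /q; ring. Qed.

(** [Q] is O(ep^4) at both W and W1, and its divided difference there is root - croot + O(ep), of
    modulus at least 2 delta - delta once ep <= e1. *)
Let W_W1 : exists2 e1, 0 < e1 & exists C, forall i, valid i -> ep i <= e1 ->
  cabs (W i - W1 i) <= C * ep i ^+ 4.
Proof.
have [r [Cr hr] hQ] := QW; have [r1 [Cr1 hr1] hQ1] := QW1.
have [CW hW] := W_root.
pose G i := g1 i + (ep i)%:C%C * g2 i + (ep i)%:C%C ^+ 2 * g3 i.
pose B i := G i + (k3 * (W i * W i + W i * W1 i + W1 i * W1 i)
  + (ep i)%:C%C * k4 * ((W i + W1 i) * (W i * W i + W1 i * W1 i))
  + (ep i)%:C%C * (ep i)%:C%C * k5 * (W i ^+ 4 + W i ^+ 3 * W1 i + W i ^+ 2 * W1 i ^+ 2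
     + W i * W1 i ^+ 3 + W1 i ^+ 4)).
have [CB hB] : bdd valid B by rewrite /B /G; bdds.
have diff i : Q i (W i) - Q i (W1 i) =
    (W i - W1 i) * (DD i + ((W i - root i) + (ep i)%:C%C * B i)).
  have hw1 : W1 i = root i + (ep i)%:C%C * G i by rewrite /W1 /G; ring.
  rewrite /Q /Qh /B -(rootD i) /DD; move: (W1 i) hw1 => w1 hw1.
  move: (W i) (G i) (ep i)%:C%C (root i) (croot i) (k3) (k4) (k5) hw1.
  move=> w G' E r0 r1' l3 l4 l5 hw1.
  have := Q_diff _ E (r0 + r1') l3 l4 l5 w w1 => /= ->.
  by congr (_ * _); rewrite hw1; ring.
pose C1 := `|CW| + `|CB| + 1.
have C10 : 0 < C1 by rewrite /C1 ltr_wpDl ?addr_ge0.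
exists (delta / C1); first exact: divr_gt0.
exists ((Cr + Cr1) / delta) => i vi ei.
have /andP[e0 _] := e01 i vi.
have lower : delta <= cabs (DD i + ((W i - root i) + (ep i)%:C%C * B i)).
  have h1 : cabs ((W i - root i) + (ep i)%:C%C * B i) <= delta.
    apply: (@le_trans _ _ (C1 * ep i)); last by rewrite mulrC -ler_pdivlMr.
    apply: le_trans (cabsD _ _) _; rewrite cabsM (cabs_ep i vi).
    have h2 : CW * ep i <= `|CW| * ep i by rewrite ler_wpM2r ?(ltW e0) // ler_norm.
    have h3 : ep i * cabs (B i) <= `|CB| * ep i.
      by rewrite mulrC ler_wpM2r ?(ltW e0) // (le_trans (hB i vi)) // ler_norm.
    by have := hW i vi; rewrite /C1 !mulrDl mul1r; lra.
  have h2 : 2 * delta <= cabs (DD i).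
    apply: le_trans (Im_le_cabs _); rewrite DDE /= ger0_norm ?mulr_ge0 ?sqrtr_ge0 //.
    by rewrite ler_pM2l // ss_ge.
  have := cabsB (DD i + ((W i - root i) + (ep i)%:C%C * B i)) ((W i - root i) + (ep i)%:C%C * B i).
  by rewrite addrK; lra.
rewrite mulrAC ler_pdivlMr //.
apply: (@le_trans _ _ (cabs (Q i (W i) - Q i (W1 i)))).
  by rewrite diff cabsM ler_wpM2l ?cabs_ge0.
rewrite (hQ i vi) (hQ1 i vi) -mulrBr cabsM cabsX (cabs_ep i vi) mulrC.
rewrite ler_wpM2r ?exprn_ge0 ?(ltW e0) //; apply: le_trans (cabsB _ _) _.
by rewrite lerD ?hr ?hr1.
Qed.

Lemma Im_cauchy_expansion : exists2 e1, 0 < e1 & exists C, forall i, valid i -> ep i <= e1 ->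
  forall x s l4, x = xx i -> s = Num.sqrt (1 - (x / 2) ^+ 2) -> l4 = a2 - 2 ->
  `|complex.Im (W i) -
    (s + ep i * (a1 * (x ^+ 2 - 3) * x * s / (4 - x ^+ 2))
     - ep i ^+ 2 * ((l4 * (x ^+ 6 - 8 * x ^+ 4 + 18 * x ^+ 2 - 8)
        - a1 ^+ 2 * (2 * x ^+ 6 - 15 * x ^+ 4 + 30 * x ^+ 2 - 10)) * s / (4 - x ^+ 2) ^+ 2)
     + ep i ^+ 3 * (((a3 - 5 * a1) * (x ^+ 4 - 5 * x ^+ 2 + 5) * x / (4 - x ^+ 2)
        + a1 * l4 * (5 * x ^+ 6 - 42 * x ^+ 4 + 105 * x ^+ 2 - 70) * x / (4 - x ^+ 2) ^+ 2
        + a1 ^+ 3 * (5 * x ^+ 8 - 60 * x ^+ 6 + 252 * x ^+ 4 - 420 * x ^+ 2 + 210)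
          * x / (4 - x ^+ 2) ^+ 3) * s))| <= C * ep i ^+ 4.
Proof.
have [e1 e10 [C hC]] := W_W1; exists e1; first exact: e10.
exists C => i vi ei x s l4 xe se l4e.
apply: le_trans (hC i vi ei); apply: le_trans (Im_le_cabs _).
set T := (X in `| _ - X | <= _).
suff TE : complex.Im (W1 i) = T by rewrite -TE -ImN -ImD.
rewrite {}/T.
have s0 : 0 < ss i by rewrite (lt_le_trans delta0) // ss_ge.
have cs : cc i ^+ 2 + ss i ^+ 2 = 1 by rewrite ss2 // addrC subrK.
have [i1 i2 i3] := imaginary_coefficients _ _ a1 l4 (a3 - 5 * a1) s0 cs.
have xE : 2 * cc i = x by rewrite xe /cc mulrC divfK.
have sE : ss i = s by rewrite se xe.
have k4E : l4%:C%C = k4 by rewrite l4e /k4 rmorphB /= (rmorph_nat (real_complex R)).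
have k5E : (a3 - 5 * a1)%:C%C = k5.
  by rewrite /k5 rmorphB rmorphM /= (rmorph_nat (real_complex R)).
rewrite k4E k5E in i1 i2 i3.
have Im_real (k : R) (z : R[i]) : complex.Im (k%:C%C * z) = k * complex.Im z.
  by rewrite ImM /= mul0r addr0.
have -> : W1 i = root i + (ep i)%:C%C * g1 i + (ep i ^+ 2)%:C%C * g2 i + (ep i ^+ 3)%:C%C * g3 i.
  by rewrite /W1 !rmorphXn.
have j1 : complex.Im (g1 i) = _ := i1; have j2 : complex.Im (g2 i) = _ := i2.
have j3 : complex.Im (g3 i) = _ := i3.
rewrite xE sE in j1 j2 j3.
have j0 : complex.Im (root i) = s := sE.
by rewrite !ImD !Im_real j0 j1 j2 j3 mulrN.
Qed.

End expansion.

(** * Proof of the theorem *)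

Section low_moments.
Context {R : realType} (mu : borel_prob R).

Lemma moment1_mean : ('E_mu[fun x : R => x] = 0)%E -> moment mu 1 = 0.
Proof. by rewrite unlock /moment /Rintegral /= => ->. Qed.

Lemma moment2_variance : ('E_mu[fun x : R => x] = 0)%E -> ('V_mu[fun x : R => x] = 1)%E ->
  moment mu 2 = 1.
Proof.
move=> e0; rewrite /variance unlock e0 /= unlock /moment /Rintegral => e1.
rewrite [X in fine X](_ : _ = 1%E) // -e1; apply: eq_integral => x _.
by congr (_%:E); rewrite /= !fctE /= subr0 expr2.
Qed.

Lemma moment_le (L : R) k : 0 <= L -> mu (~` `[- L, L]%classic) = 0%E -> `|moment mu k| <= L ^+ k.
Proof.
move=> L0 mu0; pose D := (`[- L, L]%classic : set (measurableTypeR R)).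
have fin : (mu D < +oo)%E.
  by rewrite /D (le_lt_trans (probability_le1 _ _)) // ltry.
have b1 := bmeas_cst (- L) L 1.
have E j : moment mu j = wint (- L) L mu (fun=> 1) (fun x => x ^+ j).
  rewrite (moment_itv _ _ j mu0); apply: eq_Rintegral => x _; by rewrite mulr1.
have bX : bmeas (- L) L (fun x => x ^+ k).
  have -> : (fun x : R => x ^+ k) = (fun x => ('X^k : {poly R}).[x]); last exact: bmeas_horner.
  by apply/funext => x; rewrite hornerXn.
have p1 (x : R) : x \in `[- L, L] -> 0 <= (fun=> 1 : R) x by [].
have one : wint (- L) L mu (fun=> 1) (fun=> 1) = 1 by have := E 0%N; rewrite moment0.
have bC c := bmeas_cst (- L) L c.
have xk (x : R) : x \in `[- L, L] -> `|x ^+ k| <= L ^+ k.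
  rewrite in_itv /= normrX => h; apply: lerXn2r; rewrite ?nnegrE //.
  by rewrite ler_norml.
have Z c f := wintZ (- L) L mu (fun=> 1) fin b1 c f.
rewrite E ler_norml; apply/andP; split.
  have := wint_le _ _ _ _ fin b1 p1 (fun x => -1 * x ^+ k) (fun=> L ^+ k * 1)
    (bmeasM _ _ _ _ (bC _) bX) (bmeasM _ _ _ _ (bC _) (bC _)).
  rewrite !Z // one mulr1 mulN1r lerNl; apply => x xI.
  by apply: le_trans (xk _ xI); rewrite mulN1r -normrN ler_norm.
have := wint_le _ _ _ _ fin b1 p1 (fun x => x ^+ k) (fun=> L ^+ k * 1)
    bX (bmeasM _ _ _ _ (bC _) (bC _)).
rewrite Z // one mulr1; apply => x xI.
by apply: le_trans (xk _ xI); rewrite ler_norm.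
Qed.

End low_moments.

(** * The expansion in the stated form *)

Section expansion_terms.
Context {R : realType}.
Implicit Types delta e x s : R.

(** This is pi times the stated expansion, with e = 1 / sqrt(n) and s equal to pi times the
    semicircle density. *)
Definition expansion_sum (k3 k4 k5 e x s : R) : R :=
  s + e * (k3 * (x ^+ 2 - 3) * x * s / (4 - x ^+ 2))
  - e ^+ 2 * ((k4 * (x ^+ 6 - 8 * x ^+ 4 + 18 * x ^+ 2 - 8)
     - k3 ^+ 2 * (2 * x ^+ 6 - 15 * x ^+ 4 + 30 * x ^+ 2 - 10)) * s / (4 - x ^+ 2) ^+ 2)
  + e ^+ 3 * ((k5 * (x ^+ 4 - 5 * x ^+ 2 + 5) * x / (4 - x ^+ 2)
     + k3 * k4 * (5 * x ^+ 6 - 42 * x ^+ 4 + 105 * x ^+ 2 - 70) * x / (4 - x ^+ 2) ^+ 2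
     + k3 ^+ 3 * (5 * x ^+ 8 - 60 * x ^+ 6 + 252 * x ^+ 4 - 420 * x ^+ 2 + 210)
       * x / (4 - x ^+ 2) ^+ 3) * s).

Lemma powR_three_halves n : (0 < n)%N -> (n%:R : R) `^ (3 / 2) = Num.sqrt n%:R ^+ 3.
Proof.
move=> n0; have n0R : 0 < n%:R :> R by rewrite ltr0n.
have -> : 3 / 2 = 1 + 2^-1 :> R by field.
rewrite powRD; last by rewrite (gt_eqF n0R) implybT.
rewrite powRr1 ?ltW // powR12_sqrt ?ltW //.
by rewrite [RHS]exprS sqr_sqrtr ?ltW // mulrC.
Qed.

Lemma semicircle_densityE x : -2 <= x <= 2 ->
  semicircle_density x = Num.sqrt (1 - (x / 2) ^+ 2) / pi.
Proof.
move=> /andP[x1 x2]; have x3 : 0 <= 1 - (x / 2) ^+ 2 by nra.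
have x4 : 4 - x ^+ 2 = 2 ^+ 2 * (1 - (x / 2) ^+ 2) by field.
rewrite /semicircle_density (max_idPr _); last by rewrite x4 mulr_ge0.
rewrite x4 sqrtrM // sqrtr_sqr ger0_norm // invfM mulrACA mulVf // mul1r mulrC.
by [].
Qed.

Lemma density_expansionE (mu : borel_prob R) n x : (0 < n)%N -> -2 < x < 2 ->
  moment mu 1 = 0 -> moment mu 2 = 1 ->
  density_expansion mu n x = expansion_sum (moment mu 3) (moment mu 4 - 2)
    (moment mu 5 - 5 * moment mu 3) (Num.sqrt n%:R)^-1 x (Num.sqrt (1 - (x / 2) ^+ 2)) / pi.
Proof.
move=> n0 /andP[x1 x2] m1 m2; have n0R : 0 < n%:R :> R by rewrite ltr0n.
have [_ _ k3 k4 k5] := free_cumulants_low m1 m2.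
have x4 : 4 - x ^+ 2 != 0 by rewrite gt_eqF //; nra.
have pi0 : pi != 0 :> R by rewrite gt_eqF // pi_gt0.
rewrite /density_expansion k3 k4 k5 powR_three_halves // semicircle_densityE ?ltW //.
have r0 : Num.sqrt (n%:R : R) != 0 by rewrite gt_eqF // sqrtr_gt0.
have r2 : Num.sqrt (n%:R : R) ^+ 2 = n%:R by rewrite sqr_sqrtr ?ltW.
rewrite /expansion_sum; move: r0 r2 x4 pi0; set r := Num.sqrt n%:R; set s := Num.sqrt _.
generalize (pi : R) (moment mu 3) (moment mu 4 - 2) (moment mu 5 - 5 * moment mu 3).
by move=> p a b c r0 <- d0 p0; field; rewrite r0 d0 p0.
Qed.

Definition bounded_on {I : Type} (D : I -> Prop) (f : I -> R) :=
  exists C : R, forall i, D i -> `|f i| <= C.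

Section bounded_on.
Context {I : Type} (D : I -> Prop).
Implicit Types f g : I -> R.

Lemma bounded_on_cst (a : R) : bounded_on D (fun=> a).
Proof. by exists `|a|. Qed.

Lemma bounded_onD f g : bounded_on D f -> bounded_on D g -> bounded_on D (fun i => f i + g i).
Proof.
move=> [A hA] [B hB]; exists (A + B) => i Di.
by apply: le_trans (ler_normD _ _) _; rewrite lerD ?hA ?hB.
Qed.

Lemma bounded_onN f : bounded_on D f -> bounded_on D (fun i => - f i).
Proof. by move=> [A hA]; exists A => i Di; rewrite normrN hA. Qed.

Lemma bounded_onM f g : bounded_on D f -> bounded_on D g -> bounded_on D (fun i => f i * g i).
Proof.
by move=> [A hA] [B hB]; exists (A * B) => i Di; rewrite normrM ler_pM ?hA ?hB.
Qed.

Lemma bounded_onX f n : bounded_on D f -> bounded_on D (fun i => f i ^+ n).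
Proof.
by move=> [A hA]; exists (A ^+ n) => i Di; rewrite normrX lerXn2r ?nnegrE ?(le_trans _ (hA i Di)) ?hA.
Qed.
End bounded_on.

(** Serves those n for which eps exceeds the threshold of [Im_cauchy_expansion]. The margin delta
    keeps 4 - x^2 at least 4 delta. *)
Lemma expansion_sum_bounded k3 k4 k5 delta : 0 < delta -> delta < 1 -> exists C : R,
  forall e x, 0 <= e <= 1 -> -2 + 2 * delta <= x <= 2 - 2 * delta ->
  `|expansion_sum k3 k4 k5 e x (Num.sqrt (1 - (x / 2) ^+ 2))| <= C.
Proof.
move=> d0 d1.
pose D (i : R * R) := 0 <= i.1 <= 1 /\ -2 + 2 * delta <= i.2 <= 2 - 2 * delta.
suff [C hC] : bounded_on D (fun i => expansion_sum k3 k4 k5 i.1 i.2 (Num.sqrt (1 - (i.2 / 2) ^+ 2))).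
  by exists C => e x he hx; exact: (hC (e, x)).
have b1 : bounded_on D (fun i => i.1).
  by exists 1 => -[e x] [/= /andP[e0 e1] _]; rewrite ger0_norm.
have b2 : bounded_on D (fun i => i.2).
  by exists 2 => -[e x] [/= _ /andP[x0 x1]]; rewrite ler_norml; apply/andP; split; lra.
have b3 : bounded_on D (fun i => Num.sqrt (1 - (i.2 / 2) ^+ 2)).
  exists 1 => -[e x] [/= _ _]; rewrite ger0_norm ?sqrtr_ge0 //.
  by rewrite -[leRHS]sqrtr1 ler_wsqrtr // gerBl sqr_ge0.
have b4 : bounded_on D (fun i => (4 - i.2 ^+ 2)^-1).
  exists (4 * delta)^-1 => -[e x] [/= _ /andP[x0 x1]].
  have x4 : 4 * delta <= 4 - x ^+ 2 by nra.
  have d4 : 0 < 4 * delta by lra.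
  by rewrite gtr0_norm ?invr_gt0 ?(lt_le_trans d4) // lef_pV2 // posrE // (lt_le_trans d4).
have bc := bounded_on_cst D.
rewrite /expansion_sum.
have E1 i : (4 - i ^+ 2) ^- 2 = (4 - i ^+ 2)^-1 ^+ 2 :> R by rewrite exprVn.
have E2 i : (4 - i ^+ 2) ^- 3 = (4 - i ^+ 2)^-1 ^+ 3 :> R by rewrite exprVn.
under [X in bounded_on D X]eq_fun do rewrite !E1 !E2.
by repeat first [exact: bc | exact: b1 | exact: b2 | exact: b3 | exact: b4 | apply: bounded_onD
  | apply: bounded_onN | apply: bounded_onM | apply: bounded_onX].
Qed.

End expansion_terms.

(** * The density for a fixed n *)

Section density_of_free_sum.
Context {R : realType} (mu nu : borel_prob R) (n : nat) (L : R).
Local Notation eps := ((Num.sqrt n%:R : R)^-1).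
Hypothesis n0 : (0 < n)%N.
Hypothesis mu1 : moment mu 1 = 0.
Hypothesis mu2 : moment mu 2 = 1.
Hypothesis L1 : 1 <= L.
Hypothesis mu_supp : mu (~` `[- L, L]%classic) = 0%E.
Hypothesis tau_small : tau L eps <= 200^-1.
Hypothesis free_sum : is_free_normalized_sum_law mu n nu.

(** The edges c - 2 (1 + s) and c + 2 (1 + s) are within 3 tau of -2 and 2, so 3 tau <= 2 delta puts
    x between them. Then x = c + 2 (1 + s) cos th, and the solution at u = exp(i th) gives a valid
    instance with v = u H(u). *)
Lemma free_sum_density : exists p : R -> R,
  [/\ is_density nu p, continuous p, forall x, p x <= 3 / pi
    & forall (delta x : R), 0 < delta -> 3 * tau L eps <= 2 * delta ->
      -2 + 2 * delta <= x <= 2 - 2 * delta -> exists i : config,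
      [/\ valid delta (32 * L ^+ 6) (moment mu 3) (moment mu 4) (moment mu 5) i,
          ep i = eps, xx i = x
        & p x = complex.Im (cfgW (moment mu 3) (moment mu 4) (moment mu 5) i) / pi]].
Proof.
have t0 := tau_small.
have eps0 : 0 < eps by rewrite invr_gt0 sqrtr_gt0 ltr0n.
have L0 : 0 <= L := le_trans ler01 L1.
have Leps : 0 <= L ^+ 3 * eps by rewrite mulr_ge0 ?exprn_ge0 ?(ltW eps0).
have eps1 : eps <= 1.
  have L3 : 1 <= L ^+ 3 by rewrite exprn_ege1.
  have : 1 * eps <= L ^+ 3 * eps by rewrite ler_wpM2r // ltW.
  by move: t0; rewrite /tau; lra.
have mL k : `|moment mu k.+2| <= L ^+ k.+2 by exact: moment_le.
have [c [s [W_ [H [A [W [[cs ss] near lim sol real]]]]]]] :=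
  exists_solution (fun k => moment mu k.+2) L eps L1 mu2 mL eps0 tau_small.
have c1 := le_trans cs t0; have s1 := le_trans ss t0.
exists (law_density c s W); split.
- have [_ [_ [_ _ _ [/compact_supp_bounded[B B1 hB] _]]]] := free_sum.
  have cp := continuous_law_density c s W_ W near lim.
  (* The interval must contain both the support of [nu] and [-3, 3], where the density lives. *)
  apply: (moments_determine_density _ _ (Num.max 3 B) (3 / pi)).
  + apply: supp_null; apply: subset_trans hB _; apply: subset_itv; rewrite bnd_simp /=.
      by rewrite lerN2 le_max lexx orbT.
    by rewrite le_max lexx orbT.
  + exact: continuous_measurable_fun.
  + exact: law_density_ge0 near lim.
  + exact: law_density_le near lim.
  + move=> x xB; apply: (law_density_out3 c s W_ W c1 s1 near lim); apply: contra xB.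
    rewrite !in_itv /= => /andP[x1 x2]; rewrite (le_trans _ x1) ?lerN2 ?le_max ?lexx //=.
    by rewrite ?orbT x2.
  + move=> k; rewrite -(law_density_moments mu nu n L n0 mu1 mu2 L1 tau_small free_sum c s W_ H A W) //.
    rewrite [LHS]Rintegral_mkcond [RHS]Rintegral_mkcond; apply: eq_Rintegral => x _.
    rewrite !patchE; case: (boolP (x \in `[-3, 3]%classic)) => x3.
      rewrite mem_set //; apply: subset_itv (set_mem x3); rewrite bnd_simp /=.
        by rewrite lerN2 le_max lexx.
      by rewrite le_max lexx.
    case: ifP => // _; rewrite (law_density_out3 c s W_ W c1 s1 near lim) ?mulr0 //.
    by move: x3; rewrite mem_setE.
- exact: continuous_law_density near lim.
- exact: law_density_le near lim.
move=> delta x d0 td /andP[x1 x2].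
move: (cs) (ss) (c1) (s1); rewrite !ler_norml => /andP[c2 c3] /andP[s2 s3] /andP[_ c4] /andP[s4 _].
pose y := (x - c) / (2 * (1 + s)); have r0 : 0 < 2 * (1 + s) by lra.
have yI : -1 <= y <= 1.
  by rewrite ler_pdivlMr // ler_pdivrMr // mulN1r mul1r; apply/andP; split; lra.
pose th := acos y; have cth : cos th = y by rewrite acosK.
have thI : 0 <= th <= pi by rewrite acos_ge0 // acos_lepi.
have xE : c + 2 * (1 + s) * cos th = x.
  by rewrite cth /y mulrCA divff ?mulr1 ?gt_eqF // addrC subrK.
pose z := eit th; have z1 : cabs z = 1 := cabs_eit th.
have z2 : cabs z <= 2 by rewrite z1 ler1n.
(* Four terms of A at |z| = 1 leave a remainder of at most 2 L^6 (2 eps)^4 = 32 L^6 eps^4, the bound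
   required of [tl]. *)
have [h1 h2 h3 tail] := sol z z2; have := tail (eq_ind_r (fun r => r <= 1) (lexx 1) z1) 4%N.
have sum4 (f : nat -> R[i]) : \sum_(k < 4) f k = f 0%N + (f 1%N + (f 2%N + f 3%N)).
  by rewrite !big_ord_recl big_ord0 addr0.
rewrite z1 (sum4 (fun k => (moment mu k.+2 * eps ^+ k)%:C%C * (z * H z) ^+ k)) /= => h4.
have zx : c%:C%C * z + (1 + s%:C%C) * (1 + z ^+ 2) = x%:C%C * z.
  have ez : 1 + z ^+ 2 = (2 * cos th)%:C%C * z.
    rewrite /z /eit -[1]/(1%:C%C) expr2.
    have sc := cos2Dsin2 th.
    apply/eqP; rewrite eq_complex /=; apply/andP; split; apply/eqP; last by ring.
    by rewrite -{1}[1]sc; ring.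
  by rewrite ez -xE !(rmorphD, rmorphM, rmorph1) /=; ring.
pose T := A z - (1 + (eps%:C%C * ((moment mu 3)%:C%C * (z * H z))
  + eps%:C%C ^+ 2 * ((moment mu 4)%:C%C * (z * H z) ^+ 2)
  + eps%:C%C ^+ 3 * ((moment mu 5)%:C%C * (z * H z) ^+ 3))).
have epsC : eps%:C%C != 0 :> R[i].
  by apply/eqP => -[e]; move: eps0; rewrite e ltxx.
exists (Config eps (z * H z) (T / eps%:C%C ^+ 4) x).
have AE : cfgA (moment mu 3) (moment mu 4) (moment mu 5) (Config eps (z * H z) (T / eps%:C%C ^+ 4) x) = A z.
  by rewrite /cfgA /= [_ ^+ 4 * _]mulrC divfK ?expf_neq0 // /T; ring.
have WE : cfgW (moment mu 3) (moment mu 4) (moment mu 5) (Config eps (z * H z) (T / eps%:C%C ^+ 4) x) = W z.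
  by rewrite /cfgW AE /= h3 rmorphXn /=; ring.
have Iw : 0 <= complex.Im (W z) := angular_ge0 W_ W near lim th thI.
split=> //=; last first.
  by rewrite WE -xE law_density_cos.
split=> /=; rewrite ?WE ?AE ?x1 ?x2 ?eps0 ?eps1 //.
- split=> //; rewrite cabsM z1 mul1r -(subrK 1 (H z)).
  by apply: le_trans (cabsD _ _) _; rewrite cabs1; lra.
- rewrite cabsM cabsV cabsX cabs_real (gtr0_norm eps0) ler_pdivrMr ?exprn_gt0 //.
  have -> : 32 * L ^+ 6 * eps ^+ 4 = 2 * (L ^+ 6 * (2 * eps * 1) ^+ 4) by ring.
  apply: le_trans h4; rewrite le_eqVlt; apply/orP; left; apply/eqP; congr cabs.
  by rewrite /T mu2 !(rmorphM, rmorphXn, rmorph1) /=; ring.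
by rewrite exprMn h2 zx h3; ring.
Qed.

End density_of_free_sum.

Theorem corollary2p3 (R : realType) (mu : borel_prob R)
    (mean0 : ('E_mu[fun x : R => x] = 0)%E)
    (var1 : ('V_mu[fun x : R => x] = 1)%E)
    (beta9 : (\int[mu]_x (`|x : R| ^+ 9)%:E < +oo)%E) :
  exists2 c : R, 0 < c &
    forall delta : R, 0 < delta < 1 / 10 ->
    exists C : R,
      forall n : nat, c * delta ^- 6 <= n%:R ->
      supp mu `<=` `[- (n%:R `^ 3^-1), n%:R `^ 3^-1] ->
      forall nu : borel_prob R, is_free_normalized_sum_law mu n nu ->
      exists p : R -> R,
        [/\ is_density nu p,
            {within `[-2 + 2 * delta, 2 - 2 * delta], continuous p}
          & forall x : R, x \in `[-2 + 2 * delta, 2 - 2 * delta] ->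
              `|p x - density_expansion mu n x| <= C / n%:R ^+ 2].
Proof.
have mu1 := moment1_mean mu mean0; have mu2 := moment2_variance mu mean0 var1.
have [[L [L1 muL]]|unb] := pselect (exists L : R, 1 <= L /\ mu (~` `[- L, L]%classic) = 0%E); last first.
  (* If no bounded interval carries mu, the support condition fails for every n, and any constants
     do. *)
  exists 1 => // delta _; exists 0 => n _ hs; exfalso; apply: unb.
  exists (Num.max 1 (n%:R `^ 3^-1)); rewrite le_max lexx; split => //.
  apply: supp_null; apply: subset_trans hs _; apply: subset_itv; rewrite bnd_simp /=.
    by rewrite lerN2 le_max lexx orbT.
  by rewrite le_max lexx orbT.
have L0 : 0 < L by rewrite (lt_le_trans ltr01).
(* Chosen so that 200 tau = k eps. The lower bound on n gives k eps <= delta, hence both tau <=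
   1/200 and 3 tau <= 2 delta. *)
pose k := 200 * 1000 * 1000 * L ^+ 3.
have k1 : 1 <= k by have := exprn_ege1 3 L1; rewrite /k; lra.
have k0 : 0 < k by lra.
exists (k ^+ 2); first by rewrite exprn_gt0.
move=> delta /andP[d0 d10]; have d1 : delta < 1 by lra.
have [e1 e10 [C hC]] := Im_cauchy_expansion delta (32 * L ^+ 6)
  (moment mu 3) (moment mu 4) (moment mu 5) d0.
have [B hB] := expansion_sum_bounded (moment mu 3) (moment mu 4 - 2)
  (moment mu 5 - 5 * moment mu 3) delta d0 d1.
have pi0 := pi_gt0 R.
(* The first summand serves eps <= e1. For eps > e1 the density is at most 3 / pi and the expansion
   at most |B| / pi in modulus, while eps^4 / e1^4 > 1. As e1 depends on delta, this case is paid
   for by the implied constant and not by c. *)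
exists (`|C| / pi + (3 + `|B|) / pi / e1 ^+ 4) => n nk _ nu free_sum.
have kd : k / delta <= Num.sqrt n%:R.
  rewrite -(ger0_norm (_ : 0 <= k / delta)); last by rewrite divr_ge0 // ltW.
  rewrite -sqrtr_sqr ler_wsqrtr //; apply: le_trans nk.
  rewrite exprMn exprVn ler_wpM2l ?exprn_ge0 ?(ltW k0) // lef_pV2 ?posrE ?exprn_gt0 //.
  by rewrite ler_wiXn2l // ltW.
have r0 : 0 < Num.sqrt (n%:R : R) by apply: lt_le_trans kd; rewrite divr_gt0.
have n0 : (0 < n)%N by move: r0; rewrite sqrtr_gt0 ltr0n.
set eps := (Num.sqrt n%:R : R)^-1; have eps0 : 0 < eps by rewrite invr_gt0.
have keps : k * eps <= delta.
  by rewrite ler_pdivrMr // mulrC -ler_pdivrMr.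
have eps1 : eps <= 1.
  have : 1 * eps <= k * eps by rewrite ler_wpM2r // ltW.
  lra.
have tauE : 200 * tau L eps = k * eps by rewrite /tau /k; ring.
have t1 : tau L eps <= 200^-1 by lra.
have [p [dp cp p3 hp]] := free_sum_density mu nu n L n0 mu1 mu2 L1 muL t1 free_sum.
have p0 x : 0 <= p x by case: dp.
exists p; split=> //; first exact: continuous_subspaceT.
move=> x; rewrite in_itv /= => xI; have /andP[x1 x2] := xI.
have t3 : 3 * tau L eps <= 2 * delta by lra.
have [i [vi ei xi px]] := hp delta x d0 t3 xI.
have x22 : -2 < x < 2.
  by rewrite (lt_le_trans _ x1) ?(le_lt_trans x2) ?ltrDl ?ltrBlDr ?ltrDl ?mulr_gt0.
rewrite density_expansionE //.
have n4 : n%:R ^- 2 = eps ^+ 4 :> R.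
  by rewrite /eps exprVn -{1}(sqr_sqrtr (ler0n R n)) -exprM.
rewrite n4 -/eps.
set T := expansion_sum _ _ _ _ _ _.
have e4 : 0 < eps ^+ 4 by rewrite exprn_gt0.
have C1 : 0 <= `|C| / pi by rewrite divr_ge0 // ltW.
have C2 : 0 <= (3 + `|B|) / pi / e1 ^+ 4.
  by rewrite divr_ge0 ?exprn_ge0 ?(ltW e10) // divr_ge0 ?(ltW pi0) ?addr_ge0.
have [ee|ee] := leP eps e1.
  have h : `|complex.Im (cfgW (moment mu 3) (moment mu 4) (moment mu 5) i) - T| <= C * eps ^+ 4.
    have := hC i vi; rewrite ei => /(_ ee x _ _ (esym xi) erefl erefl).
    exact.
  rewrite px -mulrBl normrM (gtr0_norm (_ : 0 < pi^-1)) ?invr_gt0 //.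
  apply: (@le_trans _ _ (`|C| / pi * eps ^+ 4)).
    rewrite mulrAC ler_wpM2r ?invr_ge0 ?(ltW pi0) //; apply: le_trans h _.
    by rewrite ler_wpM2r ?ler_norm // ltW.
  by rewrite ler_wpM2r ?lerDl ?(ltW e4).
have hT : `|T| <= `|B|.
  apply: le_trans (ler_norm _); apply: hB => //.
  by rewrite (ltW eps0).
apply: (@le_trans _ _ ((3 + `|B|) / pi)).
  apply: le_trans (ler_normB _ _) _; rewrite [leRHS]mulrDl; apply: lerD; first by rewrite ger0_norm.
  by rewrite normrM (gtr0_norm (_ : 0 < pi^-1)) ?invr_gt0 // ler_wpM2r ?invr_ge0 ?(ltW pi0).
apply: (@le_trans _ _ ((3 + `|B|) / pi / e1 ^+ 4 * eps ^+ 4)); last first.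
  by rewrite ler_wpM2r ?lerDr ?(ltW e4).
have B0 : 0 <= (3 + `|B|) / pi by rewrite divr_ge0 ?(ltW pi0) ?addr_ge0.
rewrite [leRHS]mulrAC ler_pdivlMr ?exprn_gt0 //; apply: ler_wpM2l => //.
by apply: lerXn2r; rewrite ?nnegrE ?ltW.
Qed.
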